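(* Let $\psi$ and $\phi$ be the Meyer mother wavelet and scaling function, and for $\alpha>0$ let $$\Phi^\alpha=\{\psi^\alpha_{j,k}(\cdot)=2^{j/2}\psi(2^j\cdot-\alpha k)\}_{j\in\mathbb{N},k\in\mathbb{Z}}\cup\{\phi^\alpha_{0,k}(\cdot)=\phi(\cdot-\alpha k)\}_{k\in\mathbb{Z}}\subset L^2(\mathbb{R}).$$ If $\alpha\le 3/16$, then $\Phi^\alpha$ does sign retrieval.
   Context: Here $\mathbb{N}=\{0,1,2,\dots\}$ and the Fourier transform is $\hat f(\xi)=\int_{\mathbb{R}}f(x)e^{-2\pi i x\xi}\,dx$. The functions $\psi,\phi$ are defined by $$\widehat\psi(\xi)=\begin{cases}\sin\big[\tfrac{\pi}{2}\beta(3|\xi|-1)\big]e^{i\pi\xi},&|\xi|\in[\tfrac13,\tfrac23],\\ \cos\big[\tfrac{\pi}{2}\beta(3|\xi|/2-1)\big]e^{i\pi\xi},&|\xi|\in[\tfrac23,\tfrac43],\\0,&\text{otherwise,}\end{cases}\qquad \widehat\phi(\xi)=\begin{cases}\cos\big[\tfrac{\pi}{2}\beta(3|\xi|-1)\big],&|\xi|\le\tfrac23,\\0,&|\xi|>\tfrac23,\end{cases}$$ where $\beta$ is any function going smoothly from $0$ to $1$ on $[0,1]$ (with $\beta(x)=0$ for $x\le0$ and $\beta(x)=1$ for $x\ge1$) and satisfying $\beta(x)+\beta(1-x)=1$ for all $x\in[0,1]$. A family $\Omega=\{\omega_\mu\}_{\mu\in\mathcal{M}}\subset L^2(\mathbb{R}^d)$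 with discrete index set $\mathcal{M}$ is a frame if there are constants $0<A\le B<\infty$ with $A\|f\|^2\le\sum_{\mu\in\mathcal{M}}|\langle f,\omega_\mu\rangle|^2\le B\|f\|^2$ for all $f\in L^2(\mathbb{R}^d)$. The system $\Phi^\alpha$ is a frame of $L^2(\mathbb{R})$ for every $\alpha<1$. Sign retrieval: a frame $\Omega=\{\omega_\mu\}_{\mu\in\mathcal{M}}$ of real-valued functions in $L^2(\mathbb{R}^d)$ does sign retrieval if any exponentially-decaying real-valued $f\in L^2(\mathbb{R}^d)$ (i.e. $\int_{\mathbb{R}^d}|f(x)|e^{a|x|}\,dx<\infty$ for some $a>0$) can be uniquely recovered, up to a global sign factor, from its unsigned frame coefficients $\{|\langle f,\omega_\mu\rangle|\}_{\mu\in\mathcal{M}}$; that is, if $h\in L^2(\mathbb{R}^d)$ is real-valued with $|\langle h,\omega_\mu\rangle|=|\langle f,\omega_\mu\rangle|$ for all $\mu\in\mathcal{M}$, then $h=\pm f$. *)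

(* Defs.v *)
From HB Require Import structures.
From mathcomp Require Import all_boot all_order all_algebra.
From mathcomp Require Import complex.
From mathcomp Require Import all_classical all_reals all_analysis.

Set Implicit Arguments.
Unset Strict Implicit.
Unset Printing Implicit Defensive.
Import Order.TTheory GRing.Theory Num.Theory.
Import numFieldNormedType.Exports.

Local Open Scope classical_set_scope.
Local Open Scope ring_scope.
Local Open Scope complex_scope.

Section fourier.
Context {R : realType}.
Local Notation mu := (@lebesgue_measure R).

Definition cintegral (f : R -> R[i]) : R[i] :=
  (\int[mu]_x complex.Re (f x)) +i* (\int[mu]_x complex.Im (f x)).

Definition expi (t : R) : R[i] := cos t +i* sin t.

Definition fourier (f : R -> R) (xi : R) : R[i] :=
  cintegral (fun x => (f x)%:C * expi (- (2 * pi * x * xi))).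

End fourier.

Section frame.
Context {R : realType}.
Local Notation mu := (@lebesgue_measure R).

(* Complex-valued square-integrable functions on the real line, not quotiented
   by almost-everywhere equality. *)
Definition L2 (f : R -> R[i]) : Prop :=
  (fun x => complex.Re (f x)) \in Lfun mu 2%:E /\
  (fun x => complex.Im (f x)) \in Lfun mu 2%:E.

Definition inner (f g : R -> R[i]) : R[i] :=
  cintegral (fun x => f x * conjc (g x)).

(* The norm of [R[i]] takes values in [R[i]], hence the real part. *)
Definition modulus (z : R[i]) : R := complex.Re `|z|.

Definition normL2_sq (f : R -> R[i]) : \bar R :=
  (\int[mu]_x (modulus (f x) ^+ 2)%:E)%E.

Definition is_frame (I : countType) (omega : I -> R -> R[i]) : Prop :=
  (forall m, L2 (omega m)) /\
  exists A B : R, [/\ 0 < A, A <= B &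
    forall f : R -> R[i], L2 f ->
      (A%:E * normL2_sq f <=
         \esum_(m in [set: I]) (modulus (inner f (omega m)) ^+ 2)%:E)%E /\
      (\esum_(m in [set: I]) (modulus (inner f (omega m)) ^+ 2)%:E <=
         B%:E * normL2_sq f)%E].

Definition toC (f : R -> R) : R -> R[i] := fun x => (f x)%:C.

Definition exp_decaying (f : R -> R) : Prop :=
  exists2 a : R, 0 < a &
    (\int[mu]_x (`|f x| * expR (a * `|x|))%:E < +oo)%E.

(* Being a frame is part of the property; equality in L^2 is equality
   almost everywhere. *)
Definition sign_retrieval (I : countType) (omega : I -> R -> R) : Prop :=
  is_frame (fun m => toC (omega m)) /\
  forall f h : R -> R,
    L2 (toC f) -> exp_decaying f -> L2 (toC h) ->
    (forall m, `|inner (toC h) (toC (omega m))| =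
               `|inner (toC f) (toC (omega m))|) ->
    {ae mu, forall x, h x = f x} \/ {ae mu, forall x, h x = - f x}.

End frame.

Section meyer.
Context {R : realType}.
Local Notation mu := (@lebesgue_measure R).

Definition smooth (f : R -> R) : Prop :=
  forall (n : nat) (x : R), derivable (derive1n n f) x 1.

Definition meyer_profile (beta : R -> R) : Prop :=
  [/\ smooth beta,
      forall x, x <= 0 -> beta x = 0,
      forall x, 1 <= x -> beta x = 1 &
      forall x, 0 <= x <= 1 -> beta x + beta (1 - x) = 1].

Definition psi_hat (beta : R -> R) (xi : R) : R[i] :=
  if 1 / 3 <= `|xi| <= 2 / 3 then
    (sin (pi / 2 * beta (3 * `|xi| - 1)))%:C * expi (pi * xi)
  else if 2 / 3 <= `|xi| <= 4 / 3 then
    (cos (pi / 2 * beta (3 * `|xi| / 2 - 1)))%:C * expi (pi * xi)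
  else 0.

Definition phi_hat (beta : R -> R) (xi : R) : R[i] :=
  if `|xi| <= 2 / 3 then (cos (pi / 2 * beta (3 * `|xi| - 1)))%:C else 0.

(* psi_hat and phi_hat are smooth and compactly supported, and satisfy
   g (- xi) = conjc (g xi); hence each is the Fourier transform of a real
   Schwartz function, unique up to almost-everywhere equality. *)
Definition is_meyer_wavelet (beta psi : R -> R) : Prop :=
  mu.-integrable setT (EFin \o psi) /\
  forall xi, fourier psi xi = psi_hat beta xi.

Definition is_meyer_scaling (beta phi : R -> R) : Prop :=
  mu.-integrable setT (EFin \o phi) /\
  forall xi, fourier phi xi = phi_hat beta xi.

(* [inl (j, k)] indexes psi^alpha_{j,k}, [inr k] indexes phi^alpha_{0,k}. *)
Definition meyer_system (psi phi : R -> R) (alpha : R)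
    (m : ((nat * int) + int)%type) : R -> R :=
  match m with
  | inl (j, k) => fun x =>
      2 `^ (j%:R / 2) * psi (2 ^+ j * x - alpha * k%:~R)
  | inr k => fun x => phi (x - alpha * k%:~R)
  end.

End meyer.

(* Main.v *)
(* Replace the Fourier transform by the real Hartley transform [hartley]. At each
   scale the coefficients of [u] are the samples, on a lattice, of a function
   [voice A u] with spectrum in [-c, c]. The bound alpha <= 3/16 makes the lattice
   step at most 1 / (4 c), and the squared generators of all scales add up to 1,
   so Parseval on each scale gives the frame inequalities.

   If [f] and [h] have the same unsigned coefficients, put u = f - h and
   v = f + h. At each scale the product of the voices of u and v vanishes on the
   lattice; its bandwidth is 2 c, so it is determined by its samples and vanishes
   identically. Voices are analytic, so one of the two is zero: at each scale
   the coefficients of h are those of f up to a single sign. If two adjacent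
   scales carried opposite signs, the transform of f would vanish where the two
   frequency bands overlap; as f decays exponentially its transform is analytic,
   and f = 0. Otherwise the sign is the same at all scales, and the lower frame
   bound gives h = f or h = - f. *)

Require Import Defs.
From HB Require Import structures.
From mathcomp Require Import all_boot all_order all_algebra.
From mathcomp Require Import complex.
From mathcomp Require Import all_classical all_reals all_analysis.
From mathcomp Require Import measurable_realfun.
From mathcomp Require Import ring lra zify.

Set Implicit Arguments.
Unset Strict Implicit.
Unset Printing Implicit Defensive.
Import Order.TTheory GRing.Theory Num.Theory.
Import numFieldNormedType.Exports.

Local Open Scope classical_set_scope.
Local Open Scope ring_scope.

(** * Integration over the line *)

(** The constant 3/16 is [1 / (4 * (4 / 3))]: at scale 1 the generators live in [[-4/3, 4/3]],
    products of two voices in [[-8/3, 8/3]], and 3/16 is the critical sampling step for the latter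
    interval.

    The obstacle is that [h], hence [u] and [v], is only square integrable, while the transform is
    an integral. Voices are therefore defined on the space side, and every statement about
    frequencies is proved for bounded functions of compact support and carried over by truncation.
    Truncation destroys the vanishing on the lattice, so the sampling theorem for products is a
    bound by the mean of the absolute samples, not a bare uniqueness statement.

    For the same reason [u] and [v] cannot be transformed separately when adjacent signs differ: the
    product of the two adjacent generators serves as a common multiplier for which both voices
    vanish, and only the sum [2 f] is transformed.

    Lattice sums are taken as Cesaro means because the Fejer kernel is nonnegative of constant mass,
    which makes dominated convergence sufficient. *)

Section integration_on_the_line.
Context {R : realType}.
Local Notation mu := (@lebesgue_measure R).
Local Notation Int := (Rintegral mu setT).
Implicit Types (f g w : R -> R) (a b c M : R).

Definition intg f : Prop := mu.-integrable setT (EFin \o f).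

Definition msr f : Prop := measurable_fun [set: R] f.

Lemma intg_msr f : intg f -> msr f.
Proof. by move=> /integrableP[/measurable_EFinP]. Qed.

Lemma intg_le f g : msr f -> intg g -> (forall x, `|f x| <= g x) -> intg f.
Proof.
move=> mf ig fg; apply: (le_integrable measurableT _ _ ig).
  exact/measurable_EFinP.
by move=> x _ /=; rewrite lee_fin (le_trans (fg x))// ler_norm.
Qed.

Lemma intgD f g : intg f -> intg g -> intg (fun x => f x + g x).
Proof.
move=> fi gi; have := integrableD measurableT fi gi.
by apply: eq_integrable => // x _ /=; rewrite EFinD.
Qed.

Lemma intgZ c f : intg f -> intg (fun x => c * f x).
Proof.
move=> fi; have := integrableZl measurableT c fi.
by apply: eq_integrable => // x _ /=; rewrite EFinM.
Qed.

Lemma intgN f : intg f -> intg (fun x => - f x).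
Proof. by move=> /(intgZ (-1)); under eq_fun do rewrite mulN1r. Qed.

Lemma intgB f g : intg f -> intg g -> intg (fun x => f x - g x).
Proof. by move=> fi /intgN; exact: intgD. Qed.

Lemma intg_abs f : intg f -> intg (fun x => `|f x|).
Proof. by move=> /integrable_norm. Qed.

Lemma intg0 : intg (fun=> 0).
Proof. exact: integrable0. Qed.

Lemma intgMb f g M : intg f -> msr g -> (forall x, `|g x| <= M) ->
  intg (fun x => f x * g x).
Proof.
move=> fi mg gM; apply: (intg_le _ (intgZ M (intg_abs fi))).
  by apply: measurable_funM => //; exact: intg_msr.
by move=> x; rewrite normrM mulrC ler_wpM2r.
Qed.

Lemma intg_sum (I : Type) (s : seq I) (F : I -> R -> R) :
  (forall i, intg (F i)) -> intg (fun x => \sum_(i <- s) F i x).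
Proof.
move=> Fi; elim: s => [|i s ih].
  by under eq_fun do rewrite big_nil; exact: intg0.
by under eq_fun do rewrite big_cons; exact: intgD.
Qed.

Lemma IntD f g : intg f -> intg g ->
  Int (fun x => f x + g x) = Int f + Int g.
Proof. exact: RintegralD. Qed.

Lemma IntB f g : intg f -> intg g ->
  Int (fun x => f x - g x) = Int f - Int g.
Proof. exact: RintegralB. Qed.

Lemma IntZ c f : intg f -> Int (fun x => c * f x) = c * Int f.
Proof. exact: RintegralZl. Qed.

Lemma IntZr c f : intg f -> Int (fun x => f x * c) = Int f * c.
Proof. exact: RintegralZr. Qed.

Lemma Int0 : Int (fun=> 0) = 0.
Proof. by rewrite /Rintegral integral0. Qed.

Lemma Int_sum (I : Type) (s : seq I) (F : I -> R -> R) :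
  (forall i, intg (F i)) ->
  Int (fun x => \sum_(i <- s) F i x) = \sum_(i <- s) Int (F i).
Proof.
move=> Fi; elim: s => [|i s ih].
  by under eq_Rintegral do rewrite big_nil; rewrite big_nil Int0.
under eq_Rintegral do rewrite big_cons.
by rewrite big_cons -ih IntD//; exact: intg_sum.
Qed.

Lemma le_Int f g : intg f -> intg g -> (forall x, f x <= g x) ->
  Int f <= Int g.
Proof. by move=> fi gi fg; apply: le_Rintegral. Qed.

Lemma Int_ge0 f : (forall x, 0 <= f x) -> 0 <= Int f.
Proof. by move=> f0; apply: Rintegral_ge0. Qed.

Lemma Int_abs f : intg f -> `|Int f| <= Int (fun x => `|f x|).
Proof. by move=> fi; apply: le_normr_Rintegral. Qed.

Lemma Int_abs_le f g : msr f -> intg g -> (forall x, `|f x| <= g x) ->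
  `|Int f| <= Int g.
Proof.
move=> mf gi fg; have fi := intg_le mf gi fg.
exact: le_trans (Int_abs fi) (le_Int (intg_abs fi) gi fg).
Qed.

Lemma EFin_Int f : intg f -> (Int f)%:E = (\int[mu]_x (f x)%:E)%E.
Proof. by move=> fi; rewrite /Rintegral fineK//; exact: integrable_fin_num. Qed.

Lemma Int_dct (F : (R -> R)^nat) f g :
  (forall n, msr (F n)) -> intg g -> (forall n x, `|F n x| <= g x) ->
  (forall x, F n x @[n --> \oo] --> f x) ->
  intg f /\ Int (F n) @[n --> \oo] --> Int f.
Proof.
move=> mF gi Fg Ff.
have mf : msr f.
  by apply: (measurable_fun_cvg (fun n => mF n)) => x _; exact: Ff.
have Ff' : {ae mu, forall x, setT x -> (EFin \o F n) x @[n --> \oo] --> (f x)%:E}.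
  by apply: aeW => x _; apply: cvg_EFin; [exact: nearW|exact: Ff].
have [fi _ cv] := dominated_convergence (mu := mu) (D := setT)
  (f_ := fun n => EFin \o F n) (f := EFin \o f) (g := EFin \o g) measurableT
  (fun n => (measurable_EFinP _ _).2 (mF n)) ((measurable_EFinP _ _).2 mf)
  Ff' gi (aeW mu (fun x n _ => Fg n x)).
by split => //; apply: fine_cvg; rewrite -/(Int f) EFin_Int.
Qed.

End integration_on_the_line.

(** * Iterated integrals, affine substitutions and null sets *)

Section fubini_and_affine_change.
Context {R : realType}.
Local Notation mu := (@lebesgue_measure R).
Local Notation Int := (Rintegral mu setT).
Implicit Types (f g w : R -> R) (a b c M : R).

(** Tonelli turns the bound [b] on the inner norms into integrability on the plane. This form serves
    integrands such as [v x * w (x + y * z)], which need not be dominated by a product of functions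
    of one variable. *)
Lemma Fubini_Int (F : R * R -> R) (b : R -> R) :
  measurable_fun [set: R * R] F ->
  (forall y, intg (fun x => F (x, y))) ->
  (forall y, Int (fun x => `|F (x, y)|) <= b y) -> intg b ->
  [/\ intg (fun y => Int (fun x => F (x, y))),
      intg (fun x => Int (fun y => F (x, y))) &
      Int (fun x => Int (fun y => F (x, y))) =
      Int (fun y => Int (fun x => F (x, y)))].
Proof.
move=> mF iF Fb ib.
pose f : R * R -> \bar R := EFin \o F.
have mf : measurable_fun [set: R * R] f by exact/measurable_EFinP.
have maf : measurable_fun [set: R * R] (abse \o f) by exact: measurableT_comp.
have fi : (mu \x mu)%E.-integrable setT f.
  apply/(integrable21ltyP mu mu mf).
  under eq_integral => y _.
    rewrite (_ : (\int[mu]_x `|f (x, y)|)%E = (Int (fun x => `|F (x, y)|))%:E).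
      over.
    by rewrite EFin_Int//; exact: intg_abs.
  move/integrableP : ib => [mb]; apply: le_lt_trans.
  apply: ge0_le_integral => //=.
  - by move=> y _; rewrite lee_fin Int_ge0.
  - have <- : (fun y => \int[mu]_x `|f (x, y)|)%E =
        (fun y => (Int (fun x => `|F (x, y)|))%:E).
      by apply/funext => y; rewrite EFin_Int//; exact: intg_abs.
    exact: (@measurable_fun_fubini_tonelli_G _ _ _ _ _ mu (abse \o f)
      maf (fun=> abse_ge0 _)).
  - apply/measurable_EFinP; apply: measurableT_comp => //.
    exact/measurable_EFinP.
  - by move=> y _; rewrite lee_fin (le_trans (Fb y))// ler_norm.
have GE : fubini_G mu f = EFin \o (fun y => Int (fun x => F (x, y))).
  by apply/funext => y /=; rewrite EFin_Int.
have iG : intg (fun y => Int (fun x => F (x, y))).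
  apply: (intg_le _ ib); last first.
    by move=> y; exact: le_trans (Int_abs (iF y)) (Fb y).
  by apply/measurable_EFinP; rewrite -GE; exact: measurable_fubini_G fi.
have iFF := integrable_fubini_F fi.
have mH : measurable_fun setT (fun x => (Int (fun y => F (x, y)))%:E).
  apply/measurable_EFinP; apply: measurableT_comp => //.
  exact: measurable_int iFF.
(* Equality only almost everywhere: for exceptional [x] the section in [y] may fail to be
   integrable, and [fine] discards an infinite value. *)
have FE' : ae_eq mu setT (fubini_F mu f) (fun x => (Int (fun y => F (x, y)))%:E).
  have := ae_integrable1 fi; apply: filterS => x /= fx _.
  by rewrite EFin_Int.
split.
- exact: iG.
- apply/integrableP; split => //.
  rewrite (_ : \int[mu]_x _ = \int[mu]_x `|fubini_F mu f x|)%E.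
    by move/integrableP : iFF => [].
  apply: ae_eq_integral => //.
  + exact: measurableT_comp.
  + by apply: measurableT_comp => //; exact: measurable_int iFF.
  + by move: FE'; apply: filterS => x + _ => /(_ I) ->.
- have := Fubini fi; rewrite -/(fubini_F mu f) -/(fubini_G mu f).
  rewrite (_ : \int[mu]_x _ = \int[mu]_x (Int (fun y => F (x, y)))%:E)%E; last first.
    by apply: ae_eq_integral => //; exact: measurable_int iFF.
  move=> /(congr1 fine); rewrite -/(Rintegral mu setT _) => ->.
  congr fine; apply: eq_integral => y _.
  by rewrite /= EFin_Int.
Qed.

Lemma Fubini_prod (F : R * R -> R) (a b : R -> R) :
  measurable_fun [set: R * R] F -> intg a -> intg b ->
  (forall x y, `|F (x, y)| <= a x * b y) ->
  [/\ intg (fun y => Int (fun x => F (x, y))),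
      intg (fun x => Int (fun y => F (x, y))) &
      Int (fun x => Int (fun y => F (x, y))) =
      Int (fun y => Int (fun x => F (x, y)))].
Proof.
move=> mF ia ib Fab.
have iF y : intg (fun x => F (x, y)).
  apply: (intg_le _ (intgZ (b y) ia)).
    by apply: (measurableT_comp mF); exact: measurable_pair2.
  by move=> x; rewrite mulrC.
apply: (Fubini_Int mF iF (b := fun y => Int a * b y)).
  move=> y; rewrite mulrC -IntZ//; apply: le_Int.
  - exact: intg_abs.
  - exact: intgZ.
  - by move=> x; rewrite mulrC.
exact: intgZ.
Qed.

Section affine.
Variables (a b : R).
Hypothesis a0 : 0 < a.
Let phi : measurableTypeR R -> measurableTypeR R := fun x => a * x + b.

Let mphi : measurable_fun setT phi.
Proof.
apply: continuous_measurable_fun => x.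
by apply: cvgD; [apply: cvgM; [exact: cvg_cst|exact: cvg_id]|exact: cvg_cst].
Qed.

Let nu : {measure set (measurableTypeR R) -> \bar R}.
Proof.
apply: (measure_function_pushforward__canonical__measure_function_Measure mu (f := phi)).
exact: mphi.
Defined.

(** By uniqueness of Lebesgue measure it suffices to compare half-open intervals, whose preimages
    under [phi] are intervals shorter by the factor [a]. *)
Let scaled_nu (A : set R) : measurable A -> mu A = mscale (NngNum (ltW a0)) nu A.
Proof.
apply: lebesgue_measure_unique => _ [[c d]] _ <- /=.
rewrite /mscale /nu /= /pushforward.
rewrite (_ : _ @^-1` _ = `](c - b) / a, (d - b) / a]%classic); last first.
  apply/seteqP; split => x /=; rewrite !in_itv/=;
    by rewrite ltr_pdivrMr// ler_pdivlMr// ltrBlDr lerBrDr mulrC.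
rewrite !lebesgue_measure_itv/= !lte_fin ltr_pM2r ?invr_gt0// ltrD2r.
case: ifPn => _; last by rewrite mule0.
rewrite -EFinD -EFinM; congr EFin.
by field; rewrite gt_eqF.
Qed.

Let ge0_affine (f : R -> R) : msr f -> (forall x, 0 <= f x) ->
  (\int[mu]_x (f x)%:E = a%:E * \int[mu]_x (f (a * x + b)%R)%:E)%E.
Proof.
move=> mf f0.
rewrite (eq_measure_integral (mscale (NngNum (ltW a0)) nu)); last first.
  by move=> A mA _; exact: scaled_nu.
rewrite ge0_integral_mscale//=; [|exact/measurable_EFinP|by move=> x _; rewrite lee_fin].
congr (_ * _)%E.
rewrite (@ge0_integral_pushforward _ _ _ _ _ phi mphi mu setT (EFin \o f))//.
- exact/measurable_EFinP.
- by move=> x _; rewrite lee_fin.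
Qed.

Let intg_ge0_affine (f : R -> R) : intg f -> (forall x, 0 <= f x) ->
  intg (fun x => f (a * x + b)) /\
  Int (fun x => f (a * x + b)) = a^-1 * Int f.
Proof.
move=> fi f0; have mf := intg_msr fi.
have E := ge0_affine mf f0.
have fi' : intg (fun x => f (a * x + b)).
  apply/integrableP; split.
    by apply/measurable_EFinP; exact: (measurableT_comp mf mphi).
  under eq_integral => x _ do rewrite /= ger0_norm//.
  have : (a%:E * \int[mu]_x (f (a * x + b)%R)%:E < +oo)%E.
    rewrite -E; move/integrableP : fi => [_]; apply: le_lt_trans.
    by apply: ge0_le_integral => //;
      [move=> x _; rewrite lee_fin|exact/measurable_EFinP
      |exact/measurableT_comp/measurable_EFinP|
       move=> x _ /=; rewrite lee_fin ler_norm].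
  case: (\int[mu]_x _)%E => [r _| |_]; rewrite ?ltry ?ltNyr//.
  by rewrite mulry gtr0_sg// mul1e.
split => //; apply: (mulfI (lt0r_neq0 a0)); rewrite mulVKf ?lt0r_neq0//.
by apply: EFin_inj; rewrite EFinM !EFin_Int.
Qed.

Lemma Int_affine f : intg f ->
  intg (fun x => f (a * x + b)) /\ Int (fun x => f (a * x + b)) = a^-1 * Int f.
Proof.
move=> fi; have nfi := intg_abs fi; have bi := intgB nfi fi.
have [i1 e1] := intg_ge0_affine nfi (fun x => normr_ge0 _).
have [|i2 e2] := intg_ge0_affine bi; first by move=> x; rewrite subr_ge0 ler_norm.
(* A difference of two nonnegative functions, for which the substitution is already known. *)
have E : (fun x => f (a * x + b)) =
    fun x => `|f (a * x + b)| - (`|f (a * x + b)| - f (a * x + b)).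
  by apply/funext => x; ring.
rewrite E; split; first exact: intgB.
by rewrite IntB// e1 e2 -mulrBr IntB//; congr (_ * _); ring.
Qed.

End affine.

Lemma Int_shift f b : intg f ->
  intg (fun x => f (x + b)) /\ Int (fun x => f (x + b)) = Int f.
Proof.
move=> fi; have [] := Int_affine b ltr01 fi.
by under eq_fun do rewrite mul1r; rewrite invr1 mul1r.
Qed.

Lemma Int_opp f : intg f ->
  intg (fun x => f (- x)) /\ Int (fun x => f (- x)) = Int f.
Proof.
move=> fi.
pose phi : measurableTypeR R -> measurableTypeR R := -%R.
have mphi : measurable_fun setT phi by exact: oppr_measurable.
pose nu : {measure set (measurableTypeR R) -> \bar R} :=
  measure_function_pushforward__canonical__measure_function_Measure mu mphi.
have nuE (A : set (measurableTypeR R)) : measurable A -> mu A = nu A.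
  by move=> mA; exact/esym/(lebesgue_measureN mA).
have fi' : intg (fun x => f (- x)).
  have /integrableP[mf] := fi.
  rewrite (eq_measure_integral nu); last by move=> A mA _; exact: nuE.
  rewrite (ge0_integral_pushforward mphi)//=; last by have /integrableP[] := intg_abs fi.
  move=> h; apply/integrableP; split => //.
  exact: (measurableT_comp mf mphi).
split => //; rewrite /Rintegral; congr fine.
rewrite [RHS](eq_measure_integral nu); last by move=> A mA _; exact: nuE.
by rewrite (integral_pushforward mphi)//; have /integrableP[] := fi.
Qed.

Lemma Int_odd0 f : intg f -> (forall x, f (- x) = - f x) -> Int f = 0.
Proof.
move=> fi fN; have [_] := Int_opp fi.
rewrite (_ : (fun x => _) = (fun x => -1 * f x)); last first.
  by apply/funext => x; rewrite fN mulN1r.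
by rewrite IntZ//; lra.
Qed.

Lemma ae_impl (P Q : R -> Prop) : (forall x, P x -> Q x) ->
  {ae mu, forall x, P x} -> {ae mu, forall x, Q x}.
Proof.
exact: (@filterS _ (almost_everywhere mu) (ae_filter_ringOfSetsType mu) P Q).
Qed.

Lemma ae_impl2 (P Q S : R -> Prop) : (forall x, P x -> Q x -> S x) ->
  {ae mu, forall x, P x} -> {ae mu, forall x, Q x} -> {ae mu, forall x, S x}.
Proof.
exact: (@filterS2 _ (almost_everywhere mu) (ae_filter_ringOfSetsType mu) P Q).
Qed.

Lemma Int_ae0 f : intg f -> Int (fun x => `|f x|) = 0 -> {ae mu, forall x, f x = 0}.
Proof.
move=> fi f0.
have : (\int[mu]_x `|(f x)%:E| = 0)%E.
  transitivity (Int (fun x => `|f x|))%:E; last by rewrite f0.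
  by rewrite EFin_Int//; exact: intg_abs.
move=> /(@ae_eq_integral_abs _ _ _ mu setT measurableT (EFin \o f)
  ((measurable_EFinP _ _).2 (intg_msr fi))).1.
by apply: filterS => x /(_ I) [].
Qed.

Lemma Int_ae f g : intg f -> msr g -> {ae mu, forall x, f x = g x} ->
  intg g /\ Int f = Int g.
Proof.
move=> fi mg fg.
have mf := intg_msr fi; have mF := (measurable_EFinP _ _).2 mf.
have mG := (measurable_EFinP _ _).2 mg.
split; last first.
  congr fine; apply: (@ae_eq_integral _ _ R mu setT _ _ measurableT mF mG).
  by apply: ae_impl fg => x e _ /=; rewrite e.
apply/integrableP; split => //.
move/integrableP : fi => [_]; congr (_ < +oo)%E.
apply: (@ae_eq_integral _ _ R mu setT (abse \o (EFin \o g)) (abse \o (EFin \o f))) => //=.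
- exact: measurableT_comp.
- exact: measurableT_comp.
by apply: ae_impl fg => x e _ /=; rewrite e.
Qed.

End fubini_and_affine_change.

(** * The Hartley transform *)

Section hartley.
Context {R : realType}.
Local Notation mu := (@lebesgue_measure R).
Local Notation Int := (Rintegral mu setT).
Implicit Types (f g w u v A B : R -> R) (a b c M x t xi : R).

(* The Hartley kernel (cosine and sine): the transform below is a real-valued,
   self-inverse isometry, so no complex integration is needed. *)
Definition cas x xi : R := cos (2 * pi * (x * xi)) + sin (2 * pi * (x * xi)).

Definition hartley w xi : R := Int (fun x => w x * cas x xi).

Local Notation H := hartley.

Lemma casC x xi : cas x xi = cas xi x.
Proof. by rewrite /cas mulrC [x * xi]mulrC mulrC. Qed.

Lemma cas_max x xi : `|cas x xi| <= 2.
Proof.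
rewrite (le_trans (ler_normD _ _))// (_ : 2 = 1 + 1 :> R)//.
by rewrite lerD// ?cos_max ?sin_max.
Qed.

Lemma cas_continuous x : continuous (cas x).
Proof.
move=> xi; rewrite /cas; apply: cvgD.
  apply: continuous_comp; last exact: continuous_cos.
  by apply: cvgM; [exact: cvg_cst|apply: cvgM; [exact: cvg_cst|exact: cvg_id]].
apply: continuous_comp; last exact: continuous_sin.
by apply: cvgM; [exact: cvg_cst|apply: cvgM; [exact: cvg_cst|exact: cvg_id]].
Qed.

Lemma measurable_cas d (T : measurableType d) (f g : T -> R) :
  measurable_fun setT f -> measurable_fun setT g ->
  measurable_fun setT (fun z => cas (f z) (g z)).
Proof.
move=> mf mg; apply: measurable_funD.
  apply: (measurableT_comp (continuous_measurable_fun (@continuous_cos R))).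
  by apply: measurable_funM => //; exact: measurable_funM.
apply: (measurableT_comp (continuous_measurable_fun (@continuous_sin R))).
by apply: measurable_funM => //; exact: measurable_funM.
Qed.

Lemma msr_cas x : msr (cas x).
Proof. by apply: measurable_cas. Qed.

Lemma msr_casr x : msr (cas^~ x).
Proof. by apply: measurable_cas. Qed.

Lemma intg_cas w xi : intg w -> intg (fun x => w x * cas x xi).
Proof.
move=> wi; apply: (intgMb wi (msr_casr xi)) => x; exact: cas_max.
Qed.

Lemma intg_casr w x : intg w -> intg (fun xi => w xi * cas x xi).
Proof. by move=> wi; apply: (intgMb wi (msr_cas x)) => xi; exact: cas_max. Qed.

Lemma hartley_le w xi : intg w -> `|H w xi| <= 2 * Int (fun x => `|w x|).
Proof.
move=> wi; rewrite -IntZ; last exact: intg_abs.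
apply: Int_abs_le; first by apply: intg_msr; exact: intg_cas.
  exact/intgZ/intg_abs.
by move=> x; rewrite normrM mulrC ler_wpM2r// cas_max.
Qed.

Lemma Int_continuous (F : R -> R -> R) g :
  (forall t, msr (F t)) -> (forall x, continuous (F^~ x)) -> intg g ->
  (forall t x, `|F t x| <= g x) -> continuous (fun t => Int (F t)).
Proof.
move=> mF cF gi Fg t; apply/(@cvg_nbhsP _ R^o) => s st.
have [|_] := Int_dct (F := fun n => F (s n)) (f := F t) (fun n => mF (s n)) gi
  (fun n => Fg (s n)); last exact.
by move=> x; have /(@cvg_nbhsP _ R^o)/(_ s st) := cF x t.
Qed.

Lemma hartley_continuous w : intg w -> continuous (H w).
Proof.
move=> wi; apply: (@Int_continuous (fun xi x => w x * cas x xi)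
    (fun x => 2 * `|w x|)).
- by move=> xi; by apply: intg_msr; exact: intg_cas.
- move=> x xi; apply: cvgM; first exact: cvg_cst.
  exact: cas_continuous.
- exact/intgZ/intg_abs.
- by move=> xi x; rewrite normrM mulrC ler_wpM2r// cas_max.
Qed.

Lemma continuous_msr f : continuous f -> msr f.
Proof. exact: continuous_measurable_fun. Qed.

Lemma msr_hartley w : intg w -> msr (H w).
Proof. by move=> wi; apply: continuous_msr; exact: hartley_continuous. Qed.

(** [cas] is not multiplicative: a product of two is the cosine of the difference plus the sine of
    the sum. Against an even [A] every sine integrates to 0, so the product may be replaced by a
    single [cas] at [x - t]. *)
Lemma hartley_shift_cas A x t : intg A -> (forall xi, A (- xi) = A xi) ->
  Int (fun xi => A xi * cas x xi * cas xi t) = H A (x - t).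
Proof.
move=> Ai Ae.
have mA := intg_msr Ai.
have msin c : msr (fun xi => sin (2 * pi * (c * xi))).
  apply: (measurableT_comp (continuous_measurable_fun (@continuous_sin R))).
  by apply: measurable_funM => //; exact: measurable_funM.
have isin c : intg (fun xi => A xi * sin (2 * pi * (c * xi))).
  by apply: (intgMb Ai (msin c)) => xi; exact: sin_max.
have sin0 c : Int (fun xi => A xi * sin (2 * pi * (c * xi))) = 0.
  apply: Int_odd0 => // xi.
  by rewrite Ae mulrN mulrN sinN mulrN.
rewrite (_ : (fun xi => _) = (fun xi => A xi * cas xi (x - t) +
    (A xi * sin (2 * pi * ((x + t) * xi)) - A xi * sin (2 * pi * ((x - t) * xi))))).
  rewrite IntD; [|exact: intg_cas|exact: intgB].
  by rewrite IntB// !sin0 subrr addr0.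
apply/funext => xi; rewrite /cas.
rewrite (_ : 2 * pi * (xi * (x - t)) = 2 * pi * (x * xi) - 2 * pi * (xi * t)); last by ring.
rewrite (_ : 2 * pi * ((x - t) * xi) = 2 * pi * (x * xi) - 2 * pi * (xi * t)); last by ring.
rewrite (_ : 2 * pi * ((x + t) * xi) = 2 * pi * (x * xi) + 2 * pi * (xi * t)); last by ring.
by rewrite cosB sinB sinD; ring.
Qed.

Lemma hartley_convolution A w t : intg A -> (forall xi, A (- xi) = A xi) -> intg w ->
  Int (fun xi => A xi * H w xi * cas xi t) = Int (fun x => w x * H A (x - t)).
Proof.
move=> Ai Ae wi.
pose F (p : R * R) := A p.1 * cas p.1 t * (w p.2 * cas p.2 p.1).
have [||||_ _] := @Fubini_prod _ F (fun xi => `|A xi|) (fun x => 4 * `|w x|).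
- apply: measurable_funM; apply: measurable_funM.
  + exact: (measurableT_comp (intg_msr Ai)).
  + exact: measurable_cas.
  + exact: (measurableT_comp (intg_msr wi)).
  + exact: measurable_cas.
- exact: intg_abs.
- exact/intgZ/intg_abs.
- move=> xi x; rewrite /F/= !normrM.
  have h1 := cas_max xi t; have h2 := cas_max x xi.
  have ? : `|cas xi t| * `|cas x xi| <= 4.
    by rewrite (_ : 4 = 2 * 2 :> R) ?ler_pM//; ring.
  rewrite (_ : _ * _ * _ = `|cas xi t| * `|cas x xi| * (`|A xi| * `|w x|)); last by ring.
  by rewrite [leRHS]mulrCA ler_wpM2r.
move=> E; transitivity (Int (fun xi => Int (fun x => F (xi, x)))).
  apply: eq_Rintegral => xi _; rewrite /F/= IntZ; last exact: intg_cas.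
  by rewrite /hartley; ring.
rewrite E; apply: eq_Rintegral => x _; rewrite -(hartley_shift_cas _ _ Ai Ae).
rewrite -IntZ; last first.
  by apply: intg_cas; apply: (intgMb Ai (msr_cas x)) => xi; exact: cas_max.
by apply: eq_Rintegral => xi _; rewrite /F/=; ring.
Qed.

(** Moves a weighted spectral pairing to the space side, where the weight enters only through
    [H B (x - y)]. Plancherel and translation invariance both start from this form. *)
Lemma hartley_form B u v : intg B -> (forall xi, B (- xi) = B xi) -> intg u ->
  intg v ->
  Int (fun xi => B xi * H u xi * H v xi) =
  Int (fun y => v y * Int (fun x => u x * H B (x - y))).
Proof.
move=> Bi Be ui vi.
pose F (p : R * R) := B p.1 * H u p.1 * (v p.2 * cas p.2 p.1).
have Cu := fun xi => hartley_le xi ui; set C := 2 * _ in Cu.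
have C0 : 0 <= C by rewrite mulr_ge0// Int_ge0.
have BHi : intg (fun xi => B xi * H u xi).
  exact: (intgMb Bi (msr_hartley ui) Cu).
have [||||_ _] := @Fubini_prod _ F (fun xi => `|B xi * H u xi|) (fun y => 2 * `|v y|).
- apply: measurable_funM; last apply: measurable_funM.
  + exact: (measurableT_comp (intg_msr BHi)).
  + exact: (measurableT_comp (intg_msr vi)).
  + exact: measurable_cas.
- exact: intg_abs.
- exact/intgZ/intg_abs.
- move=> xi y; rewrite /F/= normrM ler_wpM2l// normrM mulrC ler_wpM2r//.
  exact: cas_max.
move=> E; transitivity (Int (fun xi => Int (fun y => F (xi, y)))).
  by apply: eq_Rintegral => xi _; rewrite /F/= IntZ//; exact: intg_cas.
rewrite E; apply: eq_Rintegral => y _; rewrite -(hartley_convolution _ Bi Be ui).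
rewrite -IntZ; last exact: intg_cas.
by apply: eq_Rintegral => xi _; rewrite /F/= [cas y xi]casC; ring.
Qed.

(** A translation mixes the values of [H u] at [xi] and [- xi], so the squares do not agree
    pointwise. The integrals do, since the space-side kernel depends only on [x - y]. *)
Lemma hartley_form_shift B u b : intg B -> (forall xi, B (- xi) = B xi) -> intg u ->
  Int (fun xi => B xi * H (fun x => u (x + b)) xi ^+ 2) =
  Int (fun xi => B xi * H u xi ^+ 2).
Proof.
move=> Bi Be ui; have [ubi _] := Int_shift b ui.
under eq_Rintegral do rewrite expr2 mulrA.
under [RHS]eq_Rintegral do rewrite expr2 mulrA.
have HBb x : `|H B x| <= 2 * Int (fun x => `|B x|) by exact: hartley_le.
have msub c : msr (fun x => H B (x - c)).
  by apply: (measurableT_comp (msr_hartley Bi)); exact: measurable_funB.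
have iin c : intg (fun x => u x * H B (x - c)).
  by apply: (intgMb ui (msub c)) => x; exact: HBb.
rewrite !hartley_form//.
have in_shift y : Int (fun x => u (x + b) * H B (x - y)) =
    Int (fun x => u x * H B (x - (y + b))).
  have [_ <-] := Int_shift b (iin (y + b)); apply: eq_Rintegral => x _.
  by congr (_ * H B _); ring.
under eq_Rintegral do rewrite in_shift.
pose g y := u y * Int (fun x => u x * H B (x - y)).
suff gi : intg g by have [_] := Int_shift b gi.
apply: (intgMb (M := 2 * Int (fun x => `|B x|) * Int (fun x => `|u x|)) ui).
  rewrite (_ : (fun y => _) = fun y => Int (fun xi => B xi * H u xi * cas xi y)).
    apply: msr_hartley; apply: (intgMb Bi (msr_hartley ui)) => xi; exact: hartley_le.
  by apply/funext => y; rewrite hartley_convolution.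
move=> y; rewrite -IntZ; last exact: intg_abs.
apply: Int_abs_le; [apply: intg_msr; exact: iin|exact/intgZ/intg_abs|].
by move=> x; rewrite normrM mulrC ler_wpM2r.
Qed.

End hartley.

(** * Abel factors and the Poisson kernel *)

Section poisson.
Context {R : realType}.
Local Notation mu := (@lebesgue_measure R).
Local Notation Int := (Rintegral mu setT).
Implicit Types (f g w u v A B : R -> R) (a b c M x t xi y z : R).

(** The derivative is asked for at positive points only, since the primitive used for [abel] does
    not match it on the negative axis. Nonnegativity yields integrability together with the
    value. *)
Lemma Int_even_FTC f F l : continuous f -> (forall x, 0 <= f x) ->
  (forall x, f (- x) = f x) -> continuous F ->
  (forall x, 0 < x -> is_derive x 1 F (f x)) -> F x @[x --> +oo] --> l ->
  intg f /\ Int f = 2 * (l - F 0).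
Proof.
move=> cf f0 fe cF dF Fl.
have E : (\int[mu]_x (f x)%:E = (2 * (l - F 0))%:E)%E.
  have S0 : [set x : R | 0 <= x] = `[0, +oo[%classic.
    by apply/seteqP; split => x; rewrite /= in_itv/= andbT.
  rewrite ge0_symfun_integralT//; last by move=> x; rewrite /= fe.
  rewrite S0 (ge0_continuous_FTC2y (F := F) (l := l))//.
  - exact: continuous_subspaceT.
  - by move=> x /dF [].
  - by apply: cvg_at_right_filter; exact: cF.
  - by move=> x; rewrite in_itv/= andbT => /dF dFx; rewrite derive1E derive_val.
split; last by rewrite /Rintegral E.
apply/integrableP; split; first by apply/measurable_EFinP; exact: continuous_msr.
by under eq_integral => x _ do rewrite /= ger0_norm//; rewrite E ltry.
Qed.

(** The Poisson kernel of the half-plane (a Cauchy density), scaled to be the transform of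
    [abel y]. *)
Definition poisson y z : R := 2 * y / (y ^+ 2 + (2 * pi * z) ^+ 2).

Definition abel y xi : R := expR (- (y * `|xi|)).

Lemma abel_even y xi : abel y (- xi) = abel y xi.
Proof. by rewrite /abel normrN. Qed.

Lemma abel_continuous y : continuous (abel y).
Proof.
move=> xi; apply: continuous_comp; last exact: continuous_expR.
by apply: cvgN; apply: cvgM; [exact: cvg_cst|exact: cvg_norm].
Qed.

Lemma abel_le1 y xi : 0 <= y -> `|abel y xi| <= 1.
Proof.
move=> y0; rewrite ger0_norm ?expR_ge0// /abel.
by rewrite -expR0 ler_expR oppr_le0 mulr_ge0.
Qed.

Lemma cvg_expRM y (p : R -> R) M : 0 < y -> (forall x, `|p x| <= M) ->
  expR (- (y * x)) * p x @[x --> +oo] --> 0.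
Proof.
move=> y0 pM; apply: norm_cvg0.
have M0 : 0 <= M by rewrite (le_trans _ (pM 0)).
apply: (@squeeze_cvgr _ _ _ _ (cst 0) (fun x => M * expR (- (y * x)))).
- by apply: nearW => x /=; rewrite normr_ge0/= normrM [leLHS]mulrC (ger0_norm (expR_ge0 _)) ler_wpM2r// expR_ge0.
- exact: cvg_cst.
- rewrite -[X in _ --> X](mulr0 M); apply: cvgM; first exact: cvg_cst.
  apply: (@cvg_comp _ _ _ (fun x => y * x) (fun x => expR (- x)) _ +oo); last exact: cvgr_expR.
  exact: gt0_cvgMry.
Qed.

(** A primitive of [expR (- (y * xi)) * (1 + cos (b * xi))]. The summand 1 makes the integrand
    nonnegative, as [Int_even_FTC] demands; subtracting its contribution, known from the case
    [b = 0], leaves the cosine integral. *)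
Let Fb y b xi : R := - y^-1 * expR (- (y * xi)) +
  expR (- (y * xi)) * ((b * sin (b * xi) - y * cos (b * xi)) / (y ^+ 2 + b ^+ 2)).

Let is_derive_Fb y b xi : 0 < y ->
  is_derive xi 1 (Fb y b) (expR (- (y * xi)) * (1 + cos (b * xi))).
Proof.
move=> y0; rewrite /Fb.
apply: is_derive_eq.
rewrite /GRing.scale /=.
set e := expR _; set s := sin _; set co := cos _.
field.
by rewrite (gt_eqF y0)/= andbT gt_eqF// ltr_wpDr ?sqr_ge0// exprn_gt0.
Qed.

Let abel_cos y b : 0 < y -> intg (fun xi => abel y xi * (1 + cos (b * xi))) /\
  Int (fun xi => abel y xi * (1 + cos (b * xi))) =
  2 * (y^-1 + y / (y ^+ 2 + b ^+ 2)).
Proof.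
move=> y0.
have ccos : continuous (fun xi => 1 + cos (b * xi)).
  move=> xi; apply: cvgD; first exact: cvg_cst.
  apply: continuous_comp; last exact: continuous_cos.
  by apply: cvgM; [exact: cvg_cst|exact: cvg_id].
have dF xi := is_derive_Fb b xi y0.
have [||||||fi ->] := @Int_even_FTC (fun xi => abel y xi * (1 + cos (b * xi))) (Fb y b) 0.
- by move=> xi; apply: cvgM; [exact: abel_continuous|exact: ccos].
- by move=> xi; rewrite mulr_ge0 ?expR_ge0// -lerBlDl sub0r cos_geN1.
- by move=> xi; rewrite abel_even mulrN cosN.
- by move=> xi; apply/differentiable_continuous/derivable1_diffP; have [] := dF xi.
- by move=> xi xi0; rewrite /abel gtr0_norm.
- rewrite -[X in _ --> X](addr0 0); apply: cvgD.
    rewrite -[X in _ --> X](mulr0 (- y^-1)); apply: cvgM; first exact: cvg_cst.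
    have := @cvg_expRM y (fun=> 1) 1 y0.
    by under eq_fun do rewrite mulr1; apply => x; rewrite normr1.
  apply: (@cvg_expRM _ _ ((`|b| + `|y|) / (y ^+ 2 + b ^+ 2))) => // x.
  have D0 : 0 < y ^+ 2 + b ^+ 2 by rewrite ltr_wpDr ?sqr_ge0// exprn_gt0.
  rewrite normrM normfV (ger0_norm (ltW D0)) ler_wpM2r ?invr_ge0 ?(ltW D0)//.
  rewrite (le_trans (ler_normB _ _))// !normrM lerD//.
    by rewrite ler_piMr// sin_max.
  by rewrite ler_piMr// cos_max.
split => //; congr (_ * _).
by rewrite /Fb !mulr0 oppr0 expR0 sin0 cos0; ring.
Qed.

Lemma abel_intg y : 0 < y -> intg (abel y).
Proof.
move=> y0; have [] := abel_cos 0 y0.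
under eq_fun do rewrite mul0r cos0.
move=> /(intgZ 2^-1) ei _.
rewrite (_ : abel y = fun xi => 2^-1 * (abel y xi * (1 + 1)))//.
by apply/funext => xi; field.
Qed.

Lemma hartley_abel y z : 0 < y -> hartley (abel y) z = poisson y z.
Proof.
move=> y0; have ai := abel_intg y0.
have [i0 e0] := abel_cos 0 y0; have [ib eb] := abel_cos (2 * pi * z) y0.
have msc (f : R -> R) : continuous f -> msr (fun xi => f (2 * pi * (xi * z))).
  move=> cf; apply: (measurableT_comp (continuous_msr cf)).
  by apply: measurable_funM => //; exact: measurable_funM.
have ci : intg (fun xi => abel y xi * cos (2 * pi * (xi * z))).
  by apply: (intgMb ai (msc _ (@continuous_cos R))) => xi; exact: cos_max.
have si : intg (fun xi => abel y xi * sin (2 * pi * (xi * z))).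
  by apply: (intgMb ai (msc _ (@continuous_sin R))) => xi; exact: sin_max.
rewrite /hartley /cas; under eq_Rintegral do rewrite mulrDr.
rewrite IntD// (@Int_odd0 _ _ si) ?addr0; last first.
  by move=> xi; rewrite abel_even mulNr mulrN sinN mulrN.
have a2 : 2 * Int (abel y) = 4 / y.
  rewrite -IntZ// (_ : (fun x => _) = (fun xi => abel y xi * (1 + cos (0 * xi)))).
    by rewrite e0; field; rewrite gt_eqF.
  by apply/funext => xi; rewrite mul0r cos0; ring.
have : Int (fun xi => abel y xi * (1 + cos (2 * pi * z * xi))) =
    Int (abel y) + Int (fun xi => abel y xi * cos (2 * pi * (xi * z))).
  rewrite -IntD//; apply: eq_Rintegral => xi _.
  by rewrite mulrDr mulr1; congr (_ + _ * cos _); ring.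
have D0 : 0 < y ^+ 2 + (2 * pi * z) ^+ 2 by rewrite ltr_wpDr ?sqr_ge0// exprn_gt0.
rewrite eb => E; apply: (addrI (Int (abel y))); rewrite -E.
have -> : Int (abel y) = 2 / y.
  by apply: (mulfI (_ : 2 != 0 :> R)) => //; rewrite a2; field; rewrite gt_eqF.
rewrite /poisson; move: D0; set D := y ^+ 2 + _ => D0; field.
by rewrite !gt_eqF.
Qed.

Lemma poisson_continuous y : 0 < y -> continuous (poisson y).
Proof.
move=> y0 z; rewrite /poisson; apply: cvgM; first exact: cvg_cst.
apply: cvgV; first by rewrite gt_eqF// ltr_wpDr ?sqr_ge0// exprn_gt0.
apply: cvgD; first exact: cvg_cst.
by rewrite !expr2; apply: cvgM; apply: cvgM; [exact: cvg_cst|exact: cvg_id|exact: cvg_cst|exact: cvg_id].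
Qed.

Lemma poisson_ge0 y z : 0 <= y -> 0 <= poisson y z.
Proof. by move=> y0; rewrite divr_ge0 ?mulr_ge0 ?addr_ge0 ?sqr_ge0. Qed.

Lemma Int_poisson1 : intg (poisson 1) /\ Int (poisson 1) = 1.
Proof.
have pi0 := @pi_gt0 R; have pin : (pi : R) != 0 by rewrite gt_eqF.
have dF x : is_derive x 1 (fun z => pi^-1 * atan (2 * pi * z)) (poisson 1 x).
  apply: is_derive_eq; rewrite /poisson /GRing.scale /= expr1n.
  have D0 : 1 + (2 * pi * x) ^+ 2 != 0 by rewrite gt_eqF// ltr_wpDr ?sqr_ge0.
  move: D0 pin; move: (pi : R) => p D0 pn; field.
  by rewrite D0 pn.
suff [fi ->] : intg (poisson 1) /\
    Int (poisson 1) = 2 * (2^-1 - pi^-1 * atan (2 * pi * 0)).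
  by split => //; rewrite !mulr0 atan0 mulr0 subr0 divff.
apply: (@Int_even_FTC _ (fun z => pi^-1 * atan (2 * pi * z))).
- exact: poisson_continuous.
- by move=> x; exact: poisson_ge0.
- by move=> x; rewrite /poisson mulrN sqrrN.
- by move=> x; apply/differentiable_continuous/derivable1_diffP; have [] := dF x.
- rewrite (_ : 2^-1 = pi^-1 * (pi / 2)); last by rewrite mulrA mulVf// mul1r.
  apply: cvgM; first exact: cvg_cst.
  apply: (@cvg_comp _ _ _ (fun x => 2 * pi * x) (@atan R) _ +oo).
    by apply: gt0_cvgMry; rewrite ?mulr_gt0.
  exact: cvgy_atan.
Qed.

Lemma poisson_dilation w y x : 0 < y -> intg w ->
  intg (fun z => w (x + y * z) * poisson 1 z) /\
  Int (fun s => w s * poisson y (s - x)) =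
  Int (fun z => w (x + y * z) * poisson 1 z).
Proof.
move=> y0 wi.
have -> : (fun z => w (x + y * z) * poisson 1 z) =
    fun z => y * (w (y * z + x) * poisson y (y * z + x - x)).
  apply/funext => z; rewrite addrK (addrC (y * z)) [RHS]mulrCA.
  suff -> : poisson 1 z = y * poisson y (y * z) by [].
  rewrite /poisson (_ : y ^+ 2 + (2 * pi * (y * z)) ^+ 2 =
    y ^+ 2 * (1 ^+ 2 + (2 * pi * z) ^+ 2)); last by ring.
  have D0 : 1 ^+ 2 + (2 * pi * z) ^+ 2 != 0.
    by rewrite expr1n gt_eqF// ltr_wpDr ?sqr_ge0.
  move: D0; set D := 1 ^+ 2 + _ => D0; field.
  by rewrite D0 gt_eqF.
have pm : msr (fun s => poisson y (s - x)).
  apply: (measurableT_comp (continuous_msr (poisson_continuous y0))).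
  exact: measurable_funB.
have ypos s : `|poisson y s| <= 2 / y.
  have h : 0 < y ^+ 2 + (2 * pi * s) ^+ 2 by rewrite ltr_wpDr ?sqr_ge0// exprn_gt0.
  rewrite ger0_norm ?poisson_ge0 ?(ltW y0)// /poisson ler_pdivrMr// mulrDr.
  rewrite (_ : 2 / y * y ^+ 2 = 2 * y); last by field; rewrite gt_eqF.
  by rewrite lerDl mulr_ge0 ?sqr_ge0// divr_ge0 ?ltW.
have gi : intg (fun s => w s * poisson y (s - x)) by exact: (intgMb wi pm).
have [hi he] := Int_affine x y0 gi.
split; first exact: intgZ.
by rewrite IntZ// he mulVKf// gt_eqF.
Qed.

(** The Abel mean of the inversion integral is an average of [w] around [x], at scale [y], against
    one fixed probability density; small [y] should thus recover [w]. *)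
Lemma abel_inversion w y x : 0 < y -> intg w ->
  Int (fun xi => abel y xi * hartley w xi * cas xi x) =
  Int (fun z => w (x + y * z) * poisson 1 z).
Proof.
move=> y0 wi; rewrite (hartley_convolution _ (abel_intg y0) (@abel_even y) wi).
rewrite -(poisson_dilation _ y0 wi).2; apply: eq_Rintegral => s _.
by rewrite hartley_abel.
Qed.

End poisson.

(** * Bounded functions of compact support; continuity of translations *)

Section truncation_and_mollification.
Context {R : realType}.
Local Notation mu := (@lebesgue_measure R).
Local Notation Int := (Rintegral mu setT).
Local Notation H := hartley.
Implicit Types (f g w u v A B : R -> R) (a b c M r x t xi y z : R).

Definition box r x : R := \1_(`[- r, r] : set R) x.

Lemma boxE r x : box r x = (`|x| <= r)%R%:R.
Proof. by rewrite /box indicE; congr (nat_of_bool _)%:R; rewrite ler_norml mem_setE. Qed.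

Lemma box_ge0 r x : 0 <= box r x.
Proof. by rewrite boxE. Qed.

Lemma box_le1 r x : box r x <= 1.
Proof. by rewrite boxE lern1 leq_b1. Qed.

Lemma intg_box r : intg (box r).
Proof. exact: integrable_indic_itv. Qed.

(* Bounded with compact support. *)
Definition bcs u : Prop := msr u /\
  exists M r, (forall x, `|u x| <= M) /\ (forall x, r < `|x| -> u x = 0).

Lemma bcs_le_box u : bcs u -> exists M r,
  [/\ 0 <= M, 0 <= r & forall x, `|u x| <= M * box r x].
Proof.
move=> [mu [M [r [uM ur]]]]; have M0 : 0 <= M by rewrite (le_trans _ (uM 0)).
exists M, `|r|; split => // x; rewrite boxE.
case: (leP `|x| `|r|) => [_|xr]; first by rewrite mulr1.
by rewrite ur ?normr0 ?mulr0// (le_lt_trans (ler_norm _) xr).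
Qed.

Lemma bcs_intg u : bcs u -> intg u.
Proof.
move=> ub; have [M [r [_ _ uM]]] := bcs_le_box ub.
exact: (intg_le ub.1 (intgZ M (intg_box r)) uM).
Qed.

Lemma bcs_sqr_intg u : bcs u -> intg (fun x => u x ^+ 2).
Proof.
move=> ub; have [mu [M [r [uM _]]]] := ub; under eq_fun do rewrite expr2.
exact: (intgMb (bcs_intg ub) mu uM).
Qed.

(** For [c >= 0], the projection of [y] to the interval [[-c, c]], in a form that is visibly
    continuous. *)
Definition clip c y : R := (`|y + c| - `|y - c|) / 2.

Lemma clip_le c y : 0 <= c -> `|clip c y| <= c.
Proof.
move=> c0; rewrite /clip normrM normfV [`|2|]ger0_norm// ler_pdivrMr//.
rewrite (le_trans (ler_dist_dist _ _))// (_ : y + c - (y - c) = c * 2); last by ring.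
by rewrite ger0_norm// mulr_ge0.
Qed.

Lemma clip_id c y : `|y| <= c -> clip c y = y.
Proof.
rewrite ler_norml => /andP[h1 h2]; rewrite /clip ger0_norm; last by lra.
by rewrite ler0_norm; [field|lra].
Qed.

Lemma clip_continuous c : continuous (clip c).
Proof.
move=> y; apply: cvgM; last exact: cvg_cst.
by apply: cvgB; apply: cvg_norm; [apply: cvgD|apply: cvgB];
  try exact: cvg_id; exact: cvg_cst.
Qed.

Lemma approx_bounded_continuous w r e : intg w -> 0 <= r -> 0 < e ->
  exists g, [/\ continuous g, exists C, forall x, `|g x| <= C &
    Int (fun x => box r x * `|w x - g x|) <= e].
Proof.
move=> wi r0 e0.
pose E : set R := `[- r, r]%classic.
have mE : measurable E by exact: measurable_itv.
have fE : (mu E < +oo)%E.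
  by rewrite /E lebesgue_measure_itv/=; case: ifP => _; rewrite ?ltry// -EFinD ltry.
have iE : mu.-integrable E (EFin \o w).
  by apply: (@integrableS _ _ R mu setT E) => //; exact: wi.
have [g_ [cg ig lg]] := approximation_continuous_integrable mE fE iE.
have [n ne] : exists n, (\int[mu]_(z in E) `|(w z - g_ n z)%:E| < e%:E)%E.
  have := lg => /fine_cvgP[fin /cvgrPdist_lt/(_ _ e0) near_e].
  have [n _ /(_ n (leqnn _)) [fn en]] : \forall n \near \oo,
     (\int[mu]_(z in E) `|(w z - g_ n z)%:E|)%E \is a fin_num /\
     `|0 - fine (\int[mu]_(z in E) `|(w z - g_ n z)%:E|)%E| < e.
    by near=> n; split; near: n.
  exists n; rewrite -(fineK fn) lte_fin; move: en.
  by rewrite sub0r normrN ger0_norm// fine_ge0// integral_ge0.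
have [c _ cmax] : exists2 c, c \in `[- r, r] &
    forall t, t \in `[- r, r] -> `|g_ n t| <= `|g_ n c|.
  apply: (@EVT_max _ (fun t => `|g_ n t|)); first by lra.
  by apply: continuous_subspaceT => x; apply: cvg_norm; exact: (cg n x).
(* [C] is the maximum of the approximant on [[-r, r]]: clipping bounds it on the whole line and
   leaves it unchanged where it is compared with [w]. *)
pose C := `|g_ n c|; pose g x := clip C (g_ n x).
exists g; split.
- move=> x; apply: (@continuous_comp _ _ _ (g_ n) (clip C)); first exact: (cg n x).
  exact: clip_continuous.
- by exists C => x; apply: clip_le; exact: normr_ge0.
- rewrite -lee_fin; apply: le_trans (ltW ne).
  rewrite [leRHS]integral_mkcond /Rintegral.
  rewrite (_ : (fun x => (box r x * `|w x - g x|)%:E) =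
      ((fun x => `|(w x - g_ n x)%:E|%E) \_ E)); last first.
    apply/funext => x; rewrite patchE /box indicE; case: ifPn => xr; last by rewrite mul0r.
    by rewrite mul1r /= /g clip_id// cmax// -in_setE.
  rewrite -integral_mkcond fineK// ge0_fin_numE; last exact: integral_ge0.
  exact: (lt_trans ne (ltry _)).
Unshelve. all: by end_near. Qed.

(** Replace [w] by a bounded continuous [g], for which dominated convergence applies; the error is
    uniform over translations of length at most 1. *)
Lemma Int_translate_cvg v w (h : nat -> R) : bcs v -> intg w ->
  h n @[n --> \oo] --> 0 ->
  Int (fun x => v x * w (x + h n)) @[n --> \oo] --> Int (fun x => v x * w x).
Proof.
move=> vb wi h0; have [M [r [M0 r0 vM]]] := bcs_le_box vb.
have vi := bcs_intg vb; have mv := vb.1; have mw := intg_msr wi.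
have vle x : `|v x| <= M.
  by rewrite (le_trans (vM x))// ler_piMr// box_le1.
have mtr (f : R -> R) s : msr f -> msr (fun x => f (x + s)).
  by move=> mf; apply: (measurableT_comp mf); exact: measurable_funD.
have vwi s : intg (fun x => v x * w (x + s)).
  under eq_fun do rewrite mulrC.
  exact: (intgMb (Int_shift s wi).1 mv vle).
apply/cvgrPdist_le => e e0.
(* Two replacements of [w] by [g] cost [M * d] each, and the limit for [g] costs [d]. *)
pose d := e / (2 * M + 1).
have D0 : 0 < 2 * M + 1 by lra.
have d0 : 0 < d by rewrite divr_gt0.
have r10 : 0 <= r + 1 by rewrite addr_ge0.
(* The radius [r + 1] covers the support of [v] moved by at most 1. *)
have [g [cg [C gC] gd]] := approx_bounded_continuous wi r10 d0.
have mg := continuous_msr cg.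
have vgi s : intg (fun x => v x * g (x + s)).
  exact: (intgMb vi (mtr _ _ mg) (fun x => gC _)).
have bi : intg (fun x => box (r + 1) x * `|w x - g x|).
  have -> : (fun x => box (r + 1) x * `|w x - g x|) =
      (fun x => `|box (r + 1) x * w x - box (r + 1) x * g x|).
    by apply/funext => x; rewrite -mulrBr normrM ger0_norm ?box_ge0.
  apply: intg_abs; apply: intgB.
    under eq_fun do rewrite mulrC.
    apply: (intgMb (M := 1) wi (intg_msr (intg_box _))) => x.
    by rewrite ger0_norm ?box_ge0 ?box_le1.
  exact: (intgMb (intg_box _) mg gC).
have close s : `|s| <= 1 ->
    `|Int (fun x => v x * w (x + s)) - Int (fun x => v x * g (x + s))| <= M * d.
  move=> s1; rewrite -IntB//.
  have [bsi bse] := Int_shift s bi.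
  apply: (@le_trans _ _ (Int (fun x => M * (box (r + 1) (x + s) * `|w (x + s) - g (x + s)|)))).
    apply: Int_abs_le; [by apply: intg_msr; exact: intgB|exact: intgZ|].
    move=> x; rewrite -mulrBr normrM mulrA ler_wpM2r// (le_trans (vM x))// ler_wpM2l// !boxE.
    case: (leP `|x| r) => // xr; rewrite (_ : `|x + s| <= r + 1) //.
    by rewrite (le_trans (ler_normD _ _))// lerD.
  by rewrite IntZ// bse ler_wpM2l.
have [||||_ lim] := @Int_dct _ (fun n x => v x * g (x + h n)) (fun x => v x * g x)
    (fun x => C * `|v x|).
- by move=> n; apply: intg_msr; exact: vgi.
- by apply: intgZ; exact: intg_abs.
- by move=> n x; rewrite normrM mulrC ler_wpM2r.
- move=> x; apply: cvgM; first exact: cvg_cst.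
  apply: continuous_cvg; first exact: cg.
  by rewrite -[X in _ --> X]addr0; apply: cvgD => //; exact: cvg_cst.
have h1 : \forall n \near \oo, `|h n| <= 1.
  by move/cvgrPdist_le : h0 => /(_ _ ltr01); apply: filterS => n; rewrite sub0r normrN.
move/cvgrPdist_le : lim => /(_ _ d0) lim.
near=> n.
have c0 := close 0; rewrite normr0 in c0; have {}c0 := c0 ler01.
have cn := close (h n).
have {}cn : `|Int (fun x => v x * w (x + h n)) - Int (fun x => v x * g (x + h n))| <= M * d.
  by apply: cn; near: n.
have ln : `|Int (fun x => v x * g x) - Int (fun x => v x * g (x + h n))| <= d.
  by near: n.
have e1 : Int (fun x => v x * w (x + 0)) = Int (fun x => v x * w x).
  by apply: eq_Rintegral => x _; rewrite addr0.
have e2 : Int (fun x => v x * g (x + 0)) = Int (fun x => v x * g x).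
  by apply: eq_Rintegral => x _; rewrite addr0.
rewrite e1 e2 in c0.
have -> : e = M * d + d + M * d.
  by rewrite /d; field; rewrite gt_eqF.
move: c0 cn ln; rewrite !ler_norml => /andP[? ?] /andP[? ?] /andP[? ?].
by apply/andP; split; lra.
Unshelve. all: by end_near. Qed.

End truncation_and_mollification.

(** * Inversion and the Plancherel identity *)

Section inversion_and_plancherel.
Context {R : realType}.
Local Notation mu := (@lebesgue_measure R).
Local Notation Int := (Rintegral mu setT).
Local Notation H := hartley.
Implicit Types (f g w u v A B : R -> R) (a b c M r x t xi y z : R).

(** By Fubini the Poisson average moves outside the pairing of [v] with a translate of [w]; that
    pairing is bounded and continuous in the translation, so dominated convergence finishes.
    [harmonic n] is [1 / (n + 1)]. *)
Lemma abel_summation v w : bcs v -> intg w ->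
  Int (fun x => v x * Int (fun xi => abel (harmonic n) xi * H w xi * cas xi x))
    @[n --> \oo] --> Int (fun x => v x * w x).
Proof.
move=> vb wi; have vi := bcs_intg vb; have mv := vb.1; have mw := intg_msr wi.
have [M [r [M0 _ vM]]] := bcs_le_box vb.
have vle x : `|v x| <= M by rewrite (le_trans (vM x))// ler_piMr// box_le1.
have [pi1 p1] := @Int_poisson1 R.
have mp := intg_msr pi1.
have wsi s : intg (fun x => w (x + s)) by exact: (Int_shift s wi).1.
have wse s : Int (fun x => `|w (x + s)|) = Int (fun x => `|w x|).
  exact: (Int_shift s (intg_abs wi)).2.
have vwi s : intg (fun x => v x * w (x + s)).
  by under eq_fun do rewrite mulrC; exact: (intgMb (wsi s) mv vle).
have vwle s : Int (fun x => `|v x * w (x + s)|) <= M * Int (fun x => `|w x|).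
  rewrite -(wse s) -IntZ; last exact: intg_abs.
  apply: le_Int; [exact: intg_abs|by apply: intgZ; exact: intg_abs|].
  by move=> x; rewrite normrM ler_wpM2r.
have E n : Int (fun x => v x * Int (fun xi => abel (harmonic n) xi * H w xi * cas xi x)) =
    Int (fun z => poisson 1 z * Int (fun x => v x * w (x + harmonic n * z))).
  have y0 := @harmonic_gt0 R n; set y : R := harmonic n in y0 *.
  pose F (p : R * R) := v p.1 * (w (p.1 + y * p.2) * poisson 1 p.2).
  have [||||_ _] := @Fubini_Int _ F (fun z => M * Int (fun x => `|w x|) * poisson 1 z).
  - apply: measurable_funM; first exact: (measurableT_comp mv).
    apply: measurable_funM; last exact: (measurableT_comp mp).
    apply: (measurableT_comp mw).
    by apply: measurable_funD => //; exact: measurable_funM.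
  - move=> z; rewrite /F/=; under eq_fun do rewrite mulrA mulrC.
    exact/intgZ/vwi.
  - move=> z; rewrite /F/=.
    under eq_Rintegral do rewrite mulrA normrM (ger0_norm (poisson_ge0 _ ler01)).
    by rewrite IntZr ?ler_wpM2r ?poisson_ge0//; exact: intg_abs.
  - exact: intgZ.
  move=> FE; transitivity (Int (fun x => Int (fun z => F (x, z)))).
    apply: eq_Rintegral => x _; rewrite abel_inversion// -IntZ//.
    exact: (poisson_dilation x y0 wi).1.
  rewrite FE; apply: eq_Rintegral => z _; rewrite -IntZ//.
  by apply: eq_Rintegral => x _; rewrite /F/=; ring.
under eq_fun do rewrite E.
rewrite (_ : Int (fun x => v x * w x) = Int (fun z => poisson 1 z * Int (fun x => v x * w x))); last first.
  by rewrite IntZr// p1 mul1r.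
have mI n : msr (fun z => poisson 1 z * Int (fun x => v x * w (x + harmonic n * z))).
  apply: measurable_funM => //.
  set y : R := harmonic n.
  apply: continuous_msr => z; apply/(@cvg_nbhsP _ R^o) => s sz.
  pose w' x := w (x + y * z).
  have := @Int_translate_cvg _ v w' (fun k => y * (s k - z)) vb (wsi _).
  rewrite (_ : Int (fun x => v x * w' x) = Int (fun x => v x * w (x + y * z)))//.
  rewrite (_ : (fun k => Int (fun x => v x * w' (x + y * (s k - z)))) =
    (fun k => Int (fun x => v x * w (x + y * s k)))); last first.
    apply/funext => k; apply: eq_Rintegral => x _; rewrite /w'.
    by congr (_ * w _); ring.
  apply; rewrite -[X in _ --> X](mulr0 y) -[X in y * X](subrr z).
  apply: cvgM; first exact: cvg_cst.
  by apply: cvgB => //; exact: cvg_cst.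
have [||||_ lim] := @Int_dct _
  (fun n z => poisson 1 z * Int (fun x => v x * w (x + harmonic n * z)))
  (fun z => poisson 1 z * Int (fun x => v x * w x))
  (fun z => M * Int (fun x => `|w x|) * poisson 1 z); last exact: lim.
- exact: mI.
- exact: intgZ.
- move=> n z; rewrite normrM (ger0_norm (poisson_ge0 _ ler01)) mulrC ler_wpM2r ?poisson_ge0//.
  exact: le_trans (Int_abs (vwi _)) (vwle _).
- move=> z; apply: cvgM; first exact: cvg_cst.
  apply: Int_translate_cvg => //.
  rewrite -[X in _ --> X](mul0r z); apply: cvgM; last exact: cvg_cst.
  exact: cvg_harmonic.
Qed.

Lemma abel_cvg1 xi : abel (harmonic n) xi @[n --> \oo] --> (1 : R).
Proof.
rewrite /abel -expR0; apply: continuous_cvg; first exact: continuous_expR.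
rewrite -oppr0; apply: cvgN; rewrite -(mul0r `|xi|).
by apply: cvgM; [exact: cvg_harmonic|exact: cvg_cst].
Qed.

Lemma ae0_of_bcs f : msr f -> (forall r, intg (fun x => box r x * f x)) ->
  (forall v, bcs v -> Int (fun x => v x * f x) = 0) ->
  {ae mu, forall x, f x = 0}.
Proof.
move=> mf bfi fv.
(* A bounded continuous substitute for the sign: [s y * y] is nonnegative and vanishes only at 0.
   Cut to an interval, [s (f x)] is an admissible test function. *)
pose s y : R := y / (1 + `|y|).
have D0 y : 0 < 1 + `|y| by rewrite ltr_wpDr.
have sc : continuous s.
  move=> y; apply: cvgM; first exact: cvg_id.
  apply: cvgV; first by rewrite gt_eqF.
  by apply: cvgD; [exact: cvg_cst|apply: cvg_norm; exact: cvg_id].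
have s1 y : `|s y| <= 1.
  by rewrite /s normrM normfV (gtr0_norm (D0 y)) ler_pdivrMr// mul1r lerDr.
have ms : msr (fun x => s (f x)) := measurableT_comp (continuous_msr sc) mf.
have aen n : {ae mu, forall x, box n%:R x * (s (f x) * f x) = 0}.
  have bi : intg (fun x => box n%:R x * (s (f x) * f x)).
    have -> : (fun x => box n%:R x * (s (f x) * f x)) =
      (fun x => box n%:R x * f x * s (f x)) by apply/funext => x; ring.
    exact: (intgMb (bfi _) ms (fun x => s1 _)).
  apply: Int_ae0 => //.
  rewrite -[RHS](fv (fun x => box n%:R x * s (f x))); last first.
    split; first by apply: measurable_funM => //; exact: intg_msr (intg_box _).
    exists 1, n%:R; split => x.
      by rewrite normrM mulr_ile1// ger0_norm ?box_ge0// box_le1.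
    by rewrite boxE leNgt => ->; rewrite mul0r.
  apply: eq_Rintegral => x _; rewrite -mulrA ger0_norm// mulr_ge0 ?box_ge0//.
  by rewrite /s mulrAC mulr_ge0 ?invr_ge0 ?(ltW (D0 _))// -expr2 sqr_ge0.
have := (@ae_foralln _ _ _ mu (fun n x => box n%:R x * (s (f x) * f x) = 0)) aen.
apply: ae_impl => x /(_ (Num.truncn `|x|).+1).
rewrite boxE ltW ?truncnS_gt// mul1r => /eqP.
rewrite mulf_eq0 => /orP[|/eqP//].
by rewrite /s mulf_eq0 invr_eq0 (gt_eqF (D0 _)) orbF => /eqP.
Qed.

(** The Abel means have two weak limits: [w] by [abel_summation], and [H B] by dominated
    convergence, as the transform of [w] is integrable. *)
Lemma hartley_inversion w B : intg w -> intg B -> (forall xi, H w xi = B xi) ->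
  {ae mu, forall x, w x = H B x}.
Proof.
move=> wi Bi wB.
have HBle x : `|H B x| <= 2 * Int (fun x => `|B x|) by exact: hartley_le.
set C := 2 * _ in HBle.
have mHB := msr_hartley Bi; have mw := intg_msr wi; have mB := intg_msr Bi.
have ma n : msr (abel (harmonic n)) := intg_msr (abel_intg (@harmonic_gt0 R n)).
have a1 n xi : `|abel (harmonic n) xi| <= 1 :> R by rewrite abel_le1// ltW// harmonic_gt0.
have aBi n : intg (fun xi => abel (harmonic n) xi * B xi).
  by under eq_fun do rewrite mulrC; exact: (intgMb Bi (ma n) (a1 n)).
have key v : bcs v -> Int (fun x => v x * w x) = Int (fun x => v x * H B x).
  move=> vb; have vi := bcs_intg vb.
  have lim1 := abel_summation vb wi.
  have lim2 : Int (fun x => v x * Int (fun xi => abel (harmonic n) xi * H w xi * cas xi x))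
    @[n --> \oo] --> Int (fun x => v x * H B x).
    under eq_fun do under eq_Rintegral do under eq_Rintegral do rewrite wB.
    have [||||_ lim] := @Int_dct _
      (fun n x => v x * Int (fun xi => abel (harmonic n) xi * B xi * cas xi x))
      (fun x => v x * H B x) (fun x => C * `|v x|); last exact: lim.
    - move=> n; apply: measurable_funM; first exact: vb.1.
      exact: (msr_hartley (aBi n)).
    - by apply: intgZ; exact: intg_abs.
    - move=> n x; rewrite normrM mulrC ler_wpM2r// /C -IntZ; last exact: intg_abs.
      apply: Int_abs_le; [by apply: intg_msr; exact: intg_cas| |].
        by apply: intgZ; exact: intg_abs.
      move=> xi; rewrite normrM mulrC ler_pM// ?cas_max// normrM ler_piMl//.
    - move=> x; apply: cvgM; first exact: cvg_cst.
      have [||||_ lim] := @Int_dct _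
        (fun n xi => abel (harmonic n) xi * B xi * cas xi x)
        (fun xi => B xi * cas xi x) (fun xi => 2 * `|B xi|); last exact: lim.
      + by move=> n; apply: intg_msr; exact: intg_cas.
      + by apply: intgZ; exact: intg_abs.
      + by move=> n xi; rewrite normrM mulrC ler_pM// ?cas_max// normrM ler_piMl.
      + move=> xi; rewrite (_ : B xi * cas xi x = 1 * B xi * cas xi x); last by rewrite mul1r.
        apply: cvgM; last exact: cvg_cst.
        by apply: cvgM; [exact: abel_cvg1|exact: cvg_cst].
  exact: (cvg_unique _ lim1 lim2).
have : {ae mu, forall x, w x - H B x = 0}.
  apply: ae0_of_bcs => [|r|v vb].
  - exact: measurable_funB.
  - under eq_fun do rewrite mulrBr; apply: intgB.
      under eq_fun do rewrite mulrC.
      apply: (intgMb (M := 1) wi (intg_msr (intg_box _))) => x.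
      by rewrite ger0_norm ?box_ge0 ?box_le1.
    exact: (intgMb (intg_box r) mHB HBle).
  - under eq_Rintegral do rewrite mulrBr; rewrite IntB ?key ?subrr//.
      have [M [r [M0 _ vM]]] := bcs_le_box vb.
      under eq_fun do rewrite mulrC; apply: (intgMb (M := M) wi vb.1) => x.
      by rewrite (le_trans (vM x))// ler_piMr ?box_le1.
    exact: (intgMb (bcs_intg vb) mHB HBle).
by apply: ae_impl => x /eqP; rewrite subr_eq0 => /eqP.
Qed.

Lemma Int_mct (F : (R -> R)^nat) f l :
  (forall n x, 0 <= F n x) -> (forall n, intg (F n)) ->
  (forall x, {homo F^~ x : m n / (m <= n)%N >-> m <= n}) ->
  (forall x, F n x @[n --> \oo] --> f x) ->
  Int (F n) @[n --> \oo] --> l -> intg f /\ Int f = l.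
Proof.
move=> F0 Fi Fnd Ff Fl.
have mf : msr f.
  by apply: (measurable_fun_cvg (fun n => intg_msr (Fi n))) => x _; exact: Ff.
have f0 x : 0 <= f x.
  rewrite -(cvg_lim _ (Ff x))//; apply: limr_ge; last by apply: nearW => n; exact: F0.
  by apply/cvg_ex; exists (f x); exact: Ff.
have lim := @cvg_monotone_convergence _ _ R mu setT measurableT (fun n => EFin \o F n)
  (fun n => (measurable_EFinP _ _).2 (intg_msr (Fi n))) (fun n x _ => F0 n x)
  (fun x _ m n mn => Fnd x m n mn).
have limE x : limn (fun n => (F n x)%:E) = (f x)%:E.
  by apply/cvg_lim => //; apply: cvg_EFin; [exact: nearW|exact: Ff].
have Ef : (\int[mu]_x (f x)%:E = l%:E)%E.
  under eq_integral => x _ do rewrite -limE.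
  apply/esym/(cvg_unique _ _ lim) => //.
  apply: cvg_EFin; first by apply: nearW => n /=; rewrite -(EFin_Int (Fi n)).
  by under eq_fun do rewrite /= -(EFin_Int (Fi _)).
split; last by rewrite /Rintegral Ef.
apply/integrableP; split; first exact/measurable_EFinP.
by under eq_integral => x _ do rewrite /= ger0_norm//; rewrite Ef ltry.
Qed.

(** The spectral energy damped by [abel] pairs [u] with its own Abel mean, hence tends to the energy
    of [u]. It increases with [n], so monotone convergence also gives integrability. *)
Lemma plancherel u : bcs u -> intg (fun xi => H u xi ^+ 2) /\
  Int (fun xi => H u xi ^+ 2) = Int (fun x => u x ^+ 2).
Proof.
move=> ub; have ui := bcs_intg ub.
have Hle xi : `|H u xi| <= 2 * Int (fun x => `|u x|) by exact: hartley_le.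
have ai n : intg (abel (harmonic n) : R -> R) := abel_intg (@harmonic_gt0 R n).
have aHi n : intg (fun xi => abel (harmonic n) xi * H u xi).
  exact: (intgMb (ai n) (msr_hartley ui) Hle).
apply: (@Int_mct (fun n xi => abel (harmonic n) xi * H u xi ^+ 2)).
- by move=> n xi; rewrite mulr_ge0 ?sqr_ge0// expR_ge0.
- move=> n; under eq_fun do rewrite expr2 mulrA.
  exact: (intgMb (aHi n) (msr_hartley ui) Hle).
- move=> xi m n mn; rewrite ler_wpM2r ?sqr_ge0// /abel ler_expR lerN2 ler_wpM2r//.
  by rewrite /harmonic/= lef_pV2 ?posrE// ler_nat ltnS.
- move=> xi.
  suff : abel (harmonic n) xi * H u xi ^+ 2 @[n --> \oo] --> 1 * H u xi ^+ 2.
    by rewrite mul1r.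
  by apply: cvgM; [exact: abel_cvg1|exact: cvg_cst].
- under [X in _ --> X]eq_Rintegral do rewrite expr2.
  rewrite (_ : (fun n => _) = (fun n => Int (fun x => u x *
    Int (fun xi => abel (harmonic n) xi * H u xi * cas xi x)))).
    exact: abel_summation.
  apply/funext => n; under eq_Rintegral do rewrite expr2 mulrA.
  rewrite (hartley_form (ai n) (@abel_even _ _) ui ui).
  apply: eq_Rintegral => x _.
  by rewrite (hartley_convolution _ (ai n) (@abel_even _ _) ui).
Qed.

End inversion_and_plancherel.

(** * Fejer means and sampling *)

Section fejer.
Context {R : realType}.
Local Notation mu := (@lebesgue_measure R).
Local Notation Int := (Rintegral mu setT).
Local Notation H := hartley.
Implicit Types (f g p w u v A B Q : R -> R) (a b c e M r x t xi eta zeta : R) (N : nat).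

(* The Cesaro mean [\sum_k (1 - |k| / (N + 1)) d k]. *)
Definition avg N (d : int -> R) : R :=
  N.+1%:R^-1 * \sum_(m < N.+1) \sum_(n < N.+1) d (m%:Z - n%:Z).

Lemma avgD N d1 d2 : avg N (fun k => d1 k + d2 k) = avg N d1 + avg N d2.
Proof.
rewrite /avg -mulrDr -big_split/=; congr (_ * _); apply: eq_bigr => m _.
by rewrite -big_split.
Qed.

Lemma avgZ N a d : avg N (fun k => a * d k) = a * avg N d.
Proof.
rewrite /avg mulrCA; congr (_ * _); rewrite mulr_sumr; apply: eq_bigr => m _.
by rewrite mulr_sumr.
Qed.

Lemma eq_avg N d1 d2 : d1 =1 d2 -> avg N d1 = avg N d2.
Proof. by move=> /funext ->. Qed.

Lemma le_avg N d1 d2 : (forall k, d1 k <= d2 k) -> avg N d1 <= avg N d2.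
Proof.
move=> d12; rewrite /avg ler_wpM2l// ler_sum// => m _; rewrite ler_sum// => n _.
Qed.

Lemma ler_norm_avg N d : `|avg N d| <= avg N (fun k => `|d k|).
Proof.
rewrite /avg normrM ger0_norm// ler_wpM2l// (le_trans (ler_norm_sum _ _ _))//.
by rewrite ler_sum// => m _; rewrite ler_norm_sum.
Qed.

Lemma avg_odd N d : (forall k, d (- k) = - d k) -> avg N d = 0.
Proof.
move=> dN; rewrite /avg; set s := \sum_(_ < _) _.
suff h : s = - s by rewrite (_ : s = 0) ?mulr0//; lra.
rewrite {1}/s exchange_big/= /s -sumrN; apply: eq_bigr => m _; rewrite -sumrN.
by apply: eq_bigr => n _; rewrite -dN opprB.
Qed.

Lemma avg_Int N (G : int -> R -> R) : (forall k, intg (G k)) ->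
  intg (fun xi => avg N (fun k => G k xi)) /\
  avg N (fun k => Int (G k)) = Int (fun xi => avg N (fun k => G k xi)).
Proof.
move=> Gi; rewrite /avg.
have si (m : 'I_N.+1) : intg (fun xi => \sum_(n < N.+1) G (m%:Z - n%:Z) xi).
  by apply: (intg_sum _ (F := fun (n : 'I_N.+1) xi => G (m%:Z - n%:Z) xi)) => n; exact: Gi.
have ssi : intg (fun xi => \sum_(m < N.+1) \sum_(n < N.+1) G (m%:Z - n%:Z) xi).
  apply: (intg_sum _ (F := fun (m : 'I_N.+1) xi => \sum_(n < N.+1) G (m%:Z - n%:Z) xi)).
  exact: si.
split; first exact: intgZ.
rewrite IntZ//; congr (_ * _).
rewrite (@Int_sum _ _ _ (fun (m : 'I_N.+1) xi => \sum_(n < N.+1) G (m%:Z - n%:Z) xi))//.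
by apply: eq_bigr => m _; rewrite Int_sum.
Qed.

(** For fixed [m] the integers [m - n] are distinct, so each of the [N + 1] rows of the mean is one
    of the bounded sums. *)
Lemma avg_le_of_sums N d b :
  (forall s : seq int, uniq s -> \sum_(k <- s) d k <= b) -> avg N d <= b.
Proof.
move=> sb; rewrite /avg ler_pdivrMl ?ltr0n//.
have -> : N.+1%:R * b = \sum_(m < N.+1) b by rewrite sumr_const card_ord mulr_natl.
apply: ler_sum => m _.
rewrite -(big_mkord xpredT (fun n : nat => d (m%:Z - n%:Z))) /index_iota subn0.
rewrite -(big_map (fun n : nat => m%:Z - n%:Z) xpredT d); apply: sb.
rewrite map_inj_in_uniq ?iota_uniq// => i j _ _ /addrI /oppr_inj.
by case.
Qed.

Lemma sums_le_of_avg d l : (forall k, 0 <= d k) ->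
  avg N d @[N --> \oo] --> l ->
  forall s : seq int, uniq s -> \sum_(k <- s) d k <= l.
Proof.
move=> d0 dl s us; set T := \sum_(k <- s) _.
have [M Ms] : exists M : nat, forall k, k \in s -> (`|k| <= M)%N.
  exists (\max_(k <- s) `|k|%N) => k ks.
  by rewrite (big_rem k ks)/= leq_maxl.
have T0 : 0 <= T by rewrite /T sumr_ge0.
(* A row at distance at least [M] from both ends contains all of [s]; only [2 M] of the [N + 1] rows
   can miss a part of it. *)
have row (N m : nat) : (M <= m < N.+1 - M)%N ->
    T <= \sum_(0 <= n < N.+1) d (m%:Z - n%:Z).
  move=> /andP[Mm mN]; rewrite /index_iota subn0.
  rewrite -(big_map (fun n : nat => m%:Z - n%:Z) xpredT d); set t := map _ _.
  have ut : uniq t.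
    by rewrite map_inj_in_uniq ?iota_uniq// => i j _ _ /addrI /oppr_inj [].
  rewrite (_ : T = \sum_(k <- t | k \in s) d k).
    by rewrite [leLHS]big_mkcond/= ler_sum// => k _; case: ifP.
  rewrite /T -[RHS]big_filter; apply: perm_big; apply: uniq_perm => //.
    exact: filter_uniq.
  move=> k; rewrite mem_filter; case ks : (k \in s) => //=.
  apply/esym/mapP; exists (`|m%:Z - k|%N); have := Ms k ks.
    rewrite mem_iota; lia.
  lia.
have low N : (M.*2 <= N)%N -> T * (1 - M.*2%:R * harmonic N) <= avg N d.
  move=> MN; rewrite /avg/= ler_pdivlMl ?ltr0n//.
  have -> : N.+1%:R * (T * (1 - M.*2%:R / N.+1%:R)) = T * (N.+1%:R - M.*2%:R).
    have N0 : N.+1%:R != 0 :> R by rewrite pnatr_eq0.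
    by move: (N.+1%:R : R) N0 => z z0; field.
  rewrite -(big_mkord xpredT (fun m : nat => \sum_(n < N.+1) d (m%:Z - n%:Z))).
  rewrite (@big_cat_nat _ _ _ M)//=; last by lia.
  rewrite (@big_cat_nat _ _ _ (N.+1 - M)%N M)//=; [|lia|lia].
  rewrite -[leLHS]add0r lerD ?sumr_ge0//; first by move=> *; rewrite sumr_ge0.
  rewrite -[leLHS]addr0 lerD ?sumr_ge0//; last by move=> *; rewrite sumr_ge0.
  have -> : T * (N.+1%:R - M.*2%:R) = \sum_(M <= m < N.+1 - M) T.
    rewrite sumr_const_nat -[RHS]mulr_natr -natrB; last by lia.
    by congr (_ * _%:R); lia.
  apply: ler_sum_nat => m mM.
  by rewrite (le_trans (row N m mM))// big_mkord.
have lim : T * (1 - M.*2%:R * harmonic N) @[N --> \oo] --> T.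
  rewrite -[X in _ --> X](mulr1 T); apply: cvgM; first exact: cvg_cst.
  rewrite -[X in _ --> X](subr0 1); apply: cvgB; first exact: cvg_cst.
  rewrite -(mulr0 M.*2%:R); apply: cvgM; [exact: cvg_cst|exact: cvg_harmonic].
apply: (ler_cvg_to lim dl).
by exists M.*2 => // N /= MN; exact: low.
Qed.

Definition fejer N t : R := avg N (fun k => cos (2 * pi * (k%:~R * t))).

Lemma fejer_sqr N t : fejer N t = N.+1%:R^-1 *
  ((\sum_(m < N.+1) cos (2 * pi * (m%:R * t))) ^+ 2 +
   (\sum_(m < N.+1) sin (2 * pi * (m%:R * t))) ^+ 2).
Proof.
rewrite /fejer /avg; congr (_ * _); rewrite !expr2 !big_distrlr/= -big_split/=.
apply: eq_bigr => m _; rewrite -big_split/=; apply: eq_bigr => n _.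
by rewrite rmorphB/= -cosB; congr cos; rewrite -!pmulrn; ring.
Qed.

Lemma fejer_ge0 N t : 0 <= fejer N t.
Proof. by rewrite fejer_sqr mulr_ge0// addr_ge0// sqr_ge0. Qed.

(** Multiplication by [2 * sin (pi * t)] makes both trigonometric sums telescope to two terms of
    modulus at most 1. Keeping the sine on the left avoids a case distinction at integers and
    expresses the decay away from them. *)
Lemma fejer_sin2 N t : sin (pi * t) ^+ 2 * fejer N t <= N.+1%:R^-1.
Proof.
have tel (M : nat) : 2 * sin (pi * t) * \sum_(m < M) cos (2 * pi * (m%:R * t)) =
    sin (pi * t * (2 * M%:R - 1)) + sin (pi * t) /\
  2 * sin (pi * t) * \sum_(m < M) sin (2 * pi * (m%:R * t)) =
    cos (pi * t) - cos (pi * t * (2 * M%:R - 1)).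
  elim: M => [|M ih].
    by rewrite !big_ord0 !mulr0 sub0r mulrN1 sinN cosN; split; ring.
  rewrite (_ : pi * t * (2 * M.+1%:R - 1) = 2 * pi * (M%:R * t) + pi * t); last first.
    by rewrite -natr1; ring.
  move: ih; rewrite (_ : pi * t * (2 * M%:R - 1) = 2 * pi * (M%:R * t) - pi * t) => [[ihc ihs]|]; last by ring.
  by split; rewrite big_ord_recr/= [LHS]mulrDr ?ihc ?ihs ?sinD ?cosD ?sinB ?cosB ?sinN ?cosN; ring.
have [hc hs] := tel N.+1.
rewrite fejer_sqr mulrCA -[leRHS]mulr1 ler_wpM2l//.
set C := \sum_(m < N.+1) cos _ in hc *; set S := \sum_(m < N.+1) sin _ in hs *.
set s := sin (pi * t) in hc hs *; set co := cos (pi * t) in hs.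
have e1 : s ^+ 2 + co ^+ 2 = 1 by rewrite addrC cos2Dsin2.
have e2 := cos2Dsin2 (pi * t * (2 * N.+1%:R - 1)).
set s' := sin (pi * t * (2 * N.+1%:R - 1)) in hc e2.
set c' := cos (pi * t * (2 * N.+1%:R - 1)) in hs e2.
have : (2 * s * C) ^+ 2 + (2 * s * S) ^+ 2 <= 4.
  rewrite hc hs.
  have h1 : 0 <= (s' - s) ^+ 2 by exact: sqr_ge0.
  have h2 : 0 <= (co + c') ^+ 2 by exact: sqr_ge0.
  nra.
rewrite (_ : _ + _ = 4 * (s ^+ 2 * (C ^+ 2 + S ^+ 2))); last by ring.
lra.
Qed.

End fejer.

(** * Convergence of Fejer means inside one period *)

Section fejer_limits.
Context {R : realType}.
Local Notation mu := (@lebesgue_measure R).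
Local Notation Int := (Rintegral mu setT).
Local Notation H := hartley.
Implicit Types (f g p w u v A B Q : R -> R) (a b c e M r x t xi eta zeta : R) (N : nat).

Lemma Int_box_FTC r f (F : R -> R) : 0 < r -> continuous f ->
  (forall x : R, is_derive x 1 F (f x)) ->
  Int (fun x => box r x * f x) = F r - F (- r).
Proof.
move=> r0 cf dF.
have cF : continuous F.
  by move=> x; apply/differentiable_continuous/derivable1_diffP; have [] := dF x.
have rr : - r < r by rewrite gtrN.
transitivity (\int[mu]_(x in `[- r, r]) f x).
  rewrite [RHS]Rintegral_mkcond; apply: eq_Rintegral => x _.
  by rewrite patchE /box indicE; case: ifPn => _; rewrite ?mul1r ?mul0r.
rewrite /Rintegral (continuous_FTC2 (F := F) rr)//.
- exact: continuous_subspaceT.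
- split.
  + by move=> x _; have [] := dF x.
  + by apply: cvg_at_right_filter; exact: cF.
  + by apply: cvg_at_left_filter; exact: cF.
- by move=> x _; rewrite derive1E; have := dF x => dFx; rewrite derive_val.
Qed.

Lemma avg_delta N c : avg N (fun k => if k == 0 then c else 0) = c.
Proof.
rewrite /avg (eq_bigr (fun=> c)) => [|m _].
  by rewrite sumr_const card_ord -[c *+ _]mulr_natl mulrA mulVf ?mul1r// pnatr_eq0.
rewrite (bigD1 m)//= subrr eqxx big1 ?addr0// => n nm.
by rewrite subr_eq0 eqz_nat ifN_eqC.
Qed.

Section period.
Variable alpha : R.
Hypothesis alpha0 : 0 < alpha.
(** Half the period [1 / alpha] that sampling with step [alpha] imposes on frequencies; [box P] cuts
    out one period. *)
Let P := (2 * alpha)^-1.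

Let P0 : 0 < P. Proof. by rewrite invr_gt0 mulr_gt0. Qed.

Let alphaP : alpha * P = 1 / 2.
Proof. by rewrite /P; field; rewrite gt_eqF. Qed.

Lemma Int_box_period : Int (box P) = alpha^-1.
Proof.
transitivity (Int (fun x => box P x * 1)); first by under [RHS]eq_Rintegral do rewrite mulr1.
rewrite (@Int_box_FTC _ _ id)//; last by move=> x; exact: cvg_cst.
by rewrite /P; field; rewrite gt_eqF.
Qed.

Lemma sin_int_pi (k : int) : sin (pi * k%:~R) = 0 :> R.
Proof.
have nat_case n : sin (pi * n%:R) = 0 :> R.
  elim: n => [|n ih]; first by rewrite mulr0 sin0.
  by rewrite -natr1 mulrDr mulr1 sinD sinpi ih; ring.
case: k => n; first exact: nat_case.
by rewrite NegzE rmorphN/= mulrN sinN -pmulrn nat_case oppr0.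
Qed.

Lemma Int_box_cos (k : int) x : k != 0 ->
  Int (fun zeta => box P zeta * cos (2 * pi * (k%:~R * (alpha * (zeta - x))))) = 0.
Proof.
move=> k0; have pin : (pi : R) != 0 by rewrite gt_eqF// pi_gt0.
have kn : k%:~R != 0 :> R by rewrite intr_eq0.
have an : alpha != 0 by rewrite gt_eqF.
pose w : R := 2 * pi * (k%:~R * alpha).
have wn : w != 0 by rewrite !mulf_neq0.
have E zeta : 2 * pi * (k%:~R * (alpha * (zeta - x))) = w * (zeta - x) by rewrite /w; ring.
under eq_Rintegral do rewrite E.
pose F zeta := w^-1 * sin (w * (zeta - x)).
have dF (zeta : R) : is_derive zeta 1 F (cos (w * (zeta - x))).
  apply: is_derive_eq; rewrite /GRing.scale /=.
  by clearbody w; field.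
have cf : continuous (fun zeta => cos (w * (zeta - x))).
  move=> zeta; apply: continuous_comp; last exact: continuous_cos.
  apply: cvgM; first exact: cvg_cst.
  by apply: cvgB; [exact: cvg_id|exact: cvg_cst].
rewrite (@Int_box_FTC P _ F P0 cf dF) /F.
rewrite -mulrBr; apply/eqP; rewrite mulf_eq0; apply/orP; right; apply/eqP.
have wP : w * P = pi * k%:~R.
  by rewrite /w /P; move: an; move: (pi : R) => q a_n; field.
rewrite (_ : w * (P - x) = w * P - w * x); last by ring.
rewrite (_ : w * (- P - x) = - (w * P) - w * x); last by ring.
by rewrite wP !sinB sinN cosN sin_int_pi; ring.
Qed.

Lemma msr_fejer N x : msr (fun zeta => fejer N (alpha * (zeta - x))).
Proof.
apply: measurable_funM => //; apply: measurable_sum => m; apply: measurable_sum => n.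
apply: (measurableT_comp (continuous_msr (@continuous_cos R))).
apply: measurable_funM => //; apply: measurable_funM => //.
by apply: measurable_funM => //; exact: measurable_funB.
Qed.

Lemma fejer_le N t : `|fejer N t| <= N.+1%:R.
Proof.
rewrite (le_trans (ler_norm_avg _ _))// /avg ler_pdivrMl ?ltr0n//.
have -> : N.+1%:R * N.+1%:R = \sum_(m < N.+1) N.+1%:R :> R.
  by rewrite sumr_const card_ord mulr_natl.
apply: ler_sum => m _.
have -> : N.+1%:R = \sum_(n < N.+1) 1 :> R by rewrite sumr_const card_ord.
by apply: ler_sum => n _; exact: cos_max.
Qed.

Lemma Int_box_fejer N x :
  intg (fun zeta => box P zeta * fejer N (alpha * (zeta - x))) /\
  Int (fun zeta => box P zeta * fejer N (alpha * (zeta - x))) = alpha^-1.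
Proof.
split; first exact: (intgMb (intg_box P) (msr_fejer N x) (fun z => fejer_le N _)).
pose G (k : int) zeta := box P zeta * cos (2 * pi * (k%:~R * (alpha * (zeta - x)))).
have Gi k : intg (G k).
  apply: (intgMb (M := 1) (intg_box P)) => [|z]; last exact: cos_max.
  apply: (measurableT_comp (continuous_msr (@continuous_cos R))).
  apply: measurable_funM => //; apply: measurable_funM => //.
  by apply: measurable_funM => //; exact: measurable_funB.
have [_ E] := avg_Int N Gi.
transitivity (Int (fun zeta => avg N (fun k => G k zeta))).
  by apply: eq_Rintegral => zeta _; rewrite /fejer -avgZ.
rewrite -E -[RHS](avg_delta N); apply: eq_avg => k.
case: eqP => [->|/eqP k0]; last exact: Int_box_cos.
rewrite -Int_box_period; apply: eq_Rintegral => zeta _.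
by rewrite /G mul0r mulr0 cos0 mulr1.
Qed.

Lemma fejer_intg N p M x : msr p -> (forall z, `|p z| <= M) ->
  intg (fun zeta => box P zeta * fejer N (alpha * (zeta - x)) * p zeta).
Proof. by move=> mp pM; apply: (intgMb (Int_box_fejer N x).1 mp pM). Qed.

Lemma fejer_bound N p M x : msr p -> (forall z, `|p z| <= M) ->
  `|Int (fun zeta => box P zeta * fejer N (alpha * (zeta - x)) * p zeta)| <= M / alpha.
Proof.
move=> mp pM; have [bi be] := Int_box_fejer N x.
rewrite -be -IntZ//; apply: Int_abs_le.
- by apply: intg_msr; exact: fejer_intg pM.
- exact: intgZ.
- move=> z; rewrite normrM mulrC [`|_ * fejer _ _|]ger0_norm ?ler_wpM2r//.
    by rewrite mulr_ge0 ?box_ge0 ?fejer_ge0.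
  by rewrite mulr_ge0 ?box_ge0 ?fejer_ge0.
Qed.

(** The squared sine increases up to 1/2 and is symmetric about 1/2, so its minimum is at the end
    points. *)
Lemma sin2_lower a t : 0 < a -> a <= `|t| <= 1 - a ->
  sin (pi * a) ^+ 2 <= sin (pi * t) ^+ 2.
Proof.
move=> a0 /andP[at1 ta].
have pi0 := @pi_gt0 R.
have -> : sin (pi * t) ^+ 2 = sin (pi * `|t|) ^+ 2.
  have [t0|t0] := leP 0 t; first by rewrite ger0_norm.
  by rewrite ltr0_norm// mulrN sinN sqrrN.
move: (`|t|) at1 ta => {}t at1 ta.
have mono s : a <= s -> s <= 1 / 2 -> sin (pi * a) ^+ 2 <= sin (pi * s) ^+ 2.
  rewrite le_eqVlt => /predU1P[->//|a_s] s2.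
  have sa : 0 <= sin (pi * a) by apply: sin_ge0_pi; apply/andP; split; nra.
  have : sin (pi * a) < sin (pi * s).
    by rewrite ltr_sin ?in_itv/= ?ltr_pM2l//; apply/andP; split; nra.
  by move=> h; nra.
have [t2|t2] := leP t (1 / 2); first exact: mono.
have -> : sin (pi * t) = sin (pi * (1 - t)).
  by rewrite mulrBr mulr1 sinB sinpi cospi; ring.
by apply: mono; lra.
Qed.

(** Fejer's theorem without periodicity of [p]: for [x] strictly inside the period, the only peak of
    the kernel on [box P] is at [x] itself. *)
Lemma fejer_cvg p M x : msr p -> (forall z, `|p z| <= M) -> `|x| < P ->
  {for x, continuous p} ->
  Int (fun zeta => box P zeta * fejer N (alpha * (zeta - x)) * p zeta)
    @[N --> \oo] --> p x / alpha.
Proof.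
move=> mp pM xP px.
have M0 : 0 <= M by rewrite (le_trans _ (pM 0)).
have an : alpha != 0 by rewrite gt_eqF.
have xa : alpha * `|x| < 1 / 2.
  by rewrite -alphaP ltr_pM2l.
apply/cvgrPdist_le => e e0.
pose e1 := e * alpha / 2.
have e10 : 0 < e1 by rewrite divr_gt0// mulr_gt0.
have [d d0 pd] : exists2 d, 0 < d & forall z, `|z - x| < d -> `|p z - p x| <= e1.
  move/cvgrPdist_le : px => /(_ _ e10) [d /= d0 pd]; exists d => // z zx.
  by rewrite distrC; apply: pd; rewrite /= distrC.
(* With this [a], every [z] in the period with [|z - x| >= d] has [alpha * |z - x|] between [a] and
   [1 - a], away from all integers. *)
pose a := Num.min (alpha * d) (1 / 2 - alpha * `|x|).
have a0 : 0 < a by rewrite lt_min mulr_gt0//=; lra.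
have ad : a <= alpha * d by rewrite ge_min lexx.
have ax : a <= 1 / 2 - alpha * `|x| by rewrite ge_min lexx orbT.
have xx := normr_ge0 x.
pose kappa := sin (pi * a) ^+ 2.
have k0 : 0 < kappa.
  rewrite exprn_gt0// sin_gt0_pi// mulr_gt0 ?pi_gt0//= -[ltRHS]mulr1 ltr_pM2l ?pi_gt0//.
  by have := mulr_ge0 (ltW alpha0) xx; lra.
pose K := 2 * M / kappa.
have K0 : 0 <= K by apply: divr_ge0; [exact: mulr_ge0|exact: ltW].
(* One estimate for near and far points: the first term is integrated against the mass of the
   kernel, the second is absorbed by [fejer_sin2]. *)
have near_all z : `|z| <= P ->
    `|p z - p x| <= e1 + K * sin (pi * (alpha * (z - x))) ^+ 2.
  move=> zP; have [zx|zx] := ltP `|z - x| d.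
    by rewrite (le_trans (pd _ zx))// lerDl mulr_ge0 ?sqr_ge0.
  have azx : `|alpha * (z - x)| = alpha * `|z - x| by rewrite normrM gtr0_norm.
  have h : kappa <= sin (pi * (alpha * (z - x))) ^+ 2.
    apply: sin2_lower => //; rewrite azx; apply/andP; split.
      by rewrite (le_trans ad)// ler_pM2l.
    have h1 : alpha * `|z| <= 1 / 2.
      by rewrite -alphaP ler_pM2l.
    have h2 : alpha * `|z - x| <= alpha * `|z| + alpha * `|x|.
      by rewrite -mulrDr ler_pM2l// ler_normB.
    lra.
  have h2M : `|p z - p x| <= 2 * M.
    rewrite (le_trans (ler_normB _ _))// (_ : 2 * M = M + M) ?lerD//; ring.
  rewrite (le_trans h2M)// (_ : 2 * M = K * kappa); last first.
    by rewrite /K; field; rewrite gt_eqF.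
  by rewrite (le_trans (ler_wpM2l K0 h))// lerDr ltW.
have bound N : `|p x / alpha - Int (fun zeta => box P zeta * fejer N (alpha * (zeta - x)) * p zeta)|
    <= e / 2 + K / alpha * harmonic N.
  have [bi be] := Int_box_fejer N x.
  have ci : intg (fun z => box P z * fejer N (alpha * (z - x)) * p x).
    by under eq_fun do rewrite mulrC; exact: intgZ.
  have -> : p x / alpha = Int (fun z => box P z * fejer N (alpha * (z - x)) * p x).
    by rewrite IntZr// be mulrC.
  have pi' := fejer_intg N x mp pM; rewrite distrC -IntB//.
  have gi : intg (fun z => e1 * (box P z * fejer N (alpha * (z - x))) + K * harmonic N * box P z).
    by apply: intgD; apply: intgZ => //; exact: intg_box.
  have -> : e / 2 + K / alpha * harmonic N =
     Int (fun z => e1 * (box P z * fejer N (alpha * (z - x))) + K * harmonic N * box P z).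
    rewrite IntD; [|exact: intgZ|apply: intgZ; exact: intg_box].
    rewrite !IntZ ?be ?Int_box_period//; last exact: intg_box.
    by rewrite /e1; move: (harmonic N) => y; field.
  apply: Int_abs_le => //.
    by apply: intg_msr; apply: intgB => //; exact: fejer_intg pM.
  move=> z; rewrite boxE; case: (leP `|z| P) => zP; last first.
    by rewrite !mul0r subrr normr0 !mulr0 addr0.
  rewrite !mul1r mulr1 -mulrBr normrM (ger0_norm (fejer_ge0 _ _)).
  rewrite (le_trans (ler_wpM2l (fejer_ge0 _ _) (near_all z zP)))//.
  rewrite mulrDr [fejer _ _ * e1]mulrC lerD2l mulrCA ler_wpM2l//.
  by rewrite mulrC fejer_sin2.
have lim : e / 2 + K / alpha * harmonic N @[N --> \oo] --> e / 2.
  rewrite -[X in _ --> X]addr0 -(mulr0 (K / alpha)).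
  apply: cvgD; first exact: cvg_cst.
  by apply: cvgM; [exact: cvg_cst|exact: cvg_harmonic].
have e2 : e / 2 < e by lra.
have nb : \forall N \near \oo, e / 2 + K / alpha * harmonic N < e.
  exact: (cvgr_lt (e / 2) lim).
by apply: filterS nb => N hN; rewrite (le_trans (bound N))// ltW.
Qed.

End period.
End fejer_limits.

(** * Sampling of band-limited functions on a lattice *)

Section sampling.
Context {R : realType}.
Local Notation mu := (@lebesgue_measure R).
Local Notation Int := (Rintegral mu setT).
Local Notation H := hartley.
Implicit Types (f g p w u v A B Q : R -> R) (a b M r x t xi eta zeta : R) (N : nat).

Lemma msr_avg N (G : int -> R -> R) : (forall k, msr (G k)) ->
  msr (fun xi => avg N (fun k => G k xi)).
Proof.
move=> mG; apply: measurable_funM => //.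
by apply: measurable_sum => m; apply: measurable_sum => n; exact: mG.
Qed.

Variables (alpha c : R).
Hypotheses (alpha0 : 0 < alpha) (c0 : 0 < c) (calpha : 4 * c * alpha <= 1).
Let P := (2 * alpha)^-1.

(** The bound on the step in the form that excludes aliasing: the frequencies [xi - eta] and
    [xi + eta] of a product stay within half a period. *)
Let c2P : 2 * c <= P.
Proof.
rewrite -[P]mul1r ler_pdivlMr ?mulr_gt0//.
by rewrite (_ : _ * (2 * alpha) = 4 * c * alpha)//; ring.
Qed.

Definition band_limited Q : Prop :=
  [/\ continuous Q, exists M, forall x, `|Q x| <= M & forall x, c <= `|x| -> Q x = 0].

Lemma band_limited_bcs Q : band_limited Q -> bcs Q.
Proof.
move=> [cQ [M QM] Q0]; split; first exact: continuous_msr.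
by exists M, c; split => // x /ltW /Q0.
Qed.

Lemma band_limited_intg Q : band_limited Q -> intg Q.
Proof. by move=> /band_limited_bcs /bcs_intg. Qed.

Let Qbox Q x : band_limited Q -> box P x * Q x = Q x.
Proof.
move=> [_ _ Q0]; rewrite boxE; case: (leP `|x| P) => [_|Px]; first by rewrite mul1r.
by rewrite Q0 ?mulr0//; move: c2P c0; lra.
Qed.

Lemma avg_cas2 N xi eta :
  avg N (fun k => cas xi (alpha * k%:~R) * cas eta (alpha * k%:~R)) =
  fejer N (alpha * (eta - xi)).
Proof.
rewrite (_ : (fun k => _) = fun k : int =>
  cos (2 * pi * (k%:~R * (alpha * (eta - xi)))) +
  sin (2 * pi * (k%:~R * (alpha * (eta + xi))))); last first.
  apply/funext => k; rewrite /cas.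
  rewrite (_ : 2 * pi * (k%:~R * (alpha * (eta - xi))) =
    2 * pi * (eta * (alpha * k%:~R)) - 2 * pi * (xi * (alpha * k%:~R))); last by ring.
  rewrite (_ : 2 * pi * (k%:~R * (alpha * (eta + xi))) =
    2 * pi * (eta * (alpha * k%:~R)) + 2 * pi * (xi * (alpha * k%:~R))); last by ring.
  by rewrite cosB sinD; ring.
rewrite avgD [X in _ + X]avg_odd ?addr0// => k.
by rewrite rmorphN/= mulNr mulrN sinN.
Qed.

(** Expanding the three factors gives cosines, which average to Fejer kernels centred at the four
    combinations of [xi] and [eta], and terms odd in [k], which average to 0. *)
Lemma avg_cas3 N xi eta zeta :
  avg N (fun k => cas xi (alpha * k%:~R) * cas eta (alpha * k%:~R) * cas zeta (alpha * k%:~R)) =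
  2^-1 * (fejer N (alpha * (zeta - (xi - eta))) + fejer N (alpha * (zeta - (eta - xi))) +
   (fejer N (alpha * (zeta - (xi + eta))) - fejer N (alpha * (zeta - (- (xi + eta)))))).
Proof.
pose C x (k : int) := cos (2 * pi * (k%:~R * (alpha * (zeta - x)))).
pose w x (k : int) := 2 * pi * (x * (alpha * k%:~R)).
rewrite (_ : (fun k => _) = fun k : int =>
  2^-1 * (C (xi - eta) k + C (eta - xi) k + (C (xi + eta) k + -1 * C (- (xi + eta)) k)) +
  (cos (w xi k - w eta k) * sin (w zeta k) + sin (w xi k + w eta k) * cos (w zeta k))); last first.
  apply/funext => k; rewrite /cas /C -!/(w _ _).
  rewrite (_ : 2 * pi * _ = w zeta k - (w xi k - w eta k)); last by rewrite /w; ring.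
  rewrite (_ : 2 * pi * (k%:~R * (alpha * (zeta - (eta - xi)))) = w zeta k + (w xi k - w eta k)); last by rewrite /w; ring.
  rewrite (_ : 2 * pi * (k%:~R * (alpha * (zeta - (xi + eta)))) = w zeta k - (w xi k + w eta k)); last by rewrite /w; ring.
  rewrite (_ : 2 * pi * (k%:~R * (alpha * (zeta - (- (xi + eta))))) = w zeta k + (w xi k + w eta k)); last by rewrite /w; ring.
  move: (w xi k) (w eta k) (w zeta k) => a1 b1 z1.
  by rewrite !(cosB, sinB, cosD, sinD); field.
rewrite avgD [X in _ + X]avg_odd ?addr0.
  by rewrite avgZ !avgD avgZ mulN1r.
move=> k.
have wN x : w x (- k) = - w x k by rewrite /w rmorphN/=; ring.
rewrite !wN !sinN !cosN -[- w xi k - - w eta k]opprD -[- w xi k - w eta k]opprD !sinN !cosN.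
by ring.
Qed.

Lemma avg_hartley N Q (d : int -> R) : intg Q ->
  avg N (fun k => H Q (alpha * k%:~R) * d k) =
  Int (fun xi => Q xi * avg N (fun k => cas xi (alpha * k%:~R) * d k)).
Proof.
move=> Qi.
have Gi (k : int) : intg (fun xi => d k * (Q xi * cas xi (alpha * k%:~R))).
  by apply: intgZ; exact: intg_cas.
have [_ E] := avg_Int N Gi.
rewrite (_ : (fun k => _) = (fun k : int => Int (fun xi => d k * (Q xi * cas xi (alpha * k%:~R))))); last first.
  by apply/funext => k; rewrite IntZ; [rewrite mulrC|exact: intg_cas].
rewrite E; apply: eq_Rintegral => xi _; rewrite -avgZ; apply: eq_avg => k; ring.
Qed.

(** The mean of the squared samples pairs [Q] with its own Fejer mean, which tends to [Q / alpha] on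
    the band. *)
Lemma sampling_parseval Q : band_limited Q ->
  avg N (fun k => H Q (alpha * k%:~R) ^+ 2) @[N --> \oo] -->
  Int (fun xi => Q xi ^+ 2) / alpha.
Proof.
move=> bQ; have Qi := band_limited_intg bQ; have [cQ [M QM] Q0] := bQ.
have mQ := intg_msr Qi.
have E0 N xi : avg N (fun k => cas xi (alpha * k%:~R) * H Q (alpha * k%:~R)) =
    Int (fun eta => box P eta * fejer N (alpha * (eta - xi)) * Q eta).
  under eq_avg do rewrite mulrC.
  rewrite avg_hartley//; apply: eq_Rintegral => eta _.
  rewrite -{1}(Qbox eta bQ) (eq_avg N (fun k => mulrC _ _)) avg_cas2.
  by rewrite mulrAC.
have E N : avg N (fun k => H Q (alpha * k%:~R) ^+ 2) = Int (fun xi => Q xi *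
    Int (fun eta => box P eta * fejer N (alpha * (eta - xi)) * Q eta)).
  under eq_avg do rewrite expr2.
  by rewrite avg_hartley//; apply: eq_Rintegral => xi _; rewrite E0.
under eq_fun do rewrite E.
rewrite -IntZr; last exact: bcs_sqr_intg (band_limited_bcs bQ).
have [||||_ lim] := @Int_dct _ (fun N xi => Q xi *
    Int (fun eta => box P eta * fejer N (alpha * (eta - xi)) * Q eta))
  (fun xi => Q xi ^+ 2 / alpha) (fun xi => M / alpha * `|Q xi|); last exact: lim.
- move=> N; apply: measurable_funM => //.
  under eq_fun do rewrite -E0.
  by apply: msr_avg => k; apply: measurable_funM => //; exact: msr_casr.
- by apply: intgZ; exact: intg_abs.
- by move=> N xi; rewrite normrM mulrC ler_wpM2r// fejer_bound.
- move=> xi; have [xc|xc] := leP c `|xi|.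
    rewrite Q0// expr0n/= mul0r.
    by under eq_fun do rewrite mul0r; exact: cvg_cst.
  rewrite expr2 -mulrA; apply: cvgM; first exact: cvg_cst.
  apply: (fejer_cvg alpha0 (M := M)) => //; last exact: cQ.
  by rewrite -/P; move: c2P c0; lra.
Qed.

(* [H Q1 * H Q2] has bandwidth [2 * c], hence is the Cesaro sum of its samples
   against the kernel [alpha * S], and [4] bounds [alpha * S]. *)
Lemma sampling_product Q1 Q2 b t : band_limited Q1 -> band_limited Q2 ->
  (forall N, avg N (fun k => `|H Q1 (alpha * k%:~R) * H Q2 (alpha * k%:~R)|) <= b) ->
  `|H Q1 t * H Q2 t| <= 4 * b.
Proof.
move=> bQ1 bQ2 le_b.
have Q1i := band_limited_intg bQ1; have [cQ1 [M1 QM1] Q10] := bQ1.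
have Q2i := band_limited_intg bQ2; have [cQ2 [M2 QM2] Q20] := bQ2.
have mQ1 := intg_msr Q1i; have mQ2 := intg_msr Q2i.
have a_ge0 : 0 <= alpha by exact: ltW.
(* One period of the target [cas^~ t]. Weighting the samples by its transform [S] reproduces,
   through Fejer means, the value at [t]. *)
pose D zeta := box P zeta * cas zeta t.
have Di : intg D by exact: intg_cas (intg_box P).
pose S := H D.
have Sle tau : `|S tau| <= 4 / alpha.
  rewrite (le_trans (hartley_le _ Di))//.
  rewrite (_ : 4 / alpha = 2 * Int (fun x => 2 * box P x)); last first.
    by rewrite IntZ ?Int_box_period//; [ring|exact: intg_box].
  rewrite ler_wpM2l//; apply: le_Int; [exact: intg_abs|by apply: intgZ; exact: intg_box|].
  move=> x; rewrite /D normrM mulrC (ger0_norm (box_ge0 _ _)) ler_wpM2r ?box_ge0//.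
  exact: cas_max.
pose L N x := Int (fun zeta => box P zeta * fejer N (alpha * (zeta - x)) * cas zeta t).
have mk : msr (cas^~ t) by exact: msr_casr.
have L_le N x : `|L N x| <= 2 / alpha.
  by apply: fejer_bound => // z; exact: cas_max.
pose W N xi eta := avg N (fun k => cas xi (alpha * k%:~R) * (cas eta (alpha * k%:~R) * S (alpha * k%:~R))).
have WE N xi eta : W N xi eta =
    2^-1 * (L N (xi - eta) + L N (eta - xi) + (L N (xi + eta) - L N (- (xi + eta)))).
  rewrite /W (_ : (fun k => _) = fun k : int => S (alpha * k%:~R) *
      (cas xi (alpha * k%:~R) * cas eta (alpha * k%:~R))); last by apply/funext => k; ring.
  rewrite avg_hartley//.
  have Fi x := fejer_intg alpha0 N x mk (fun z => cas_max z t).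
  rewrite /L -IntB// -!IntD//; [|exact: intgD|exact: intgB].
  rewrite -IntZ; last by apply: intgD; [exact: intgD|exact: intgB].
  apply: eq_Rintegral => zeta _.
  rewrite (_ : (fun k => _) = fun k : int => cas xi (alpha * k%:~R) * cas eta (alpha * k%:~R) *
     cas zeta (alpha * k%:~R)); last by apply/funext => k; ring.
  by rewrite avg_cas3 /D; ring.
have W_le N xi eta : `|W N xi eta| <= 4 / alpha.
  rewrite WE normrM ger0_norm// mulrC ler_pdivrMr//.
  rewrite (_ : 4 / alpha * 2 = 2 / alpha + 2 / alpha + (2 / alpha + 2 / alpha)); last by ring.
  rewrite (le_trans (ler_normD _ _))// lerD//.
    by rewrite (le_trans (ler_normD _ _))// lerD.
  by rewrite (le_trans (ler_normB _ _))// lerD.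
(* All four centres are interior to the period by [c2P], so Fejer's theorem applies to each; the
   four limits recombine to the product of two [cas]. *)
have W_cvg xi eta : `|xi| < c -> `|eta| < c ->
    W N xi eta @[N --> \oo] --> cas xi t * cas eta t / alpha.
  move=> xc ec; under eq_fun do rewrite WE.
  have lL x : `|x| < 2 * c -> L N x @[N --> \oo] --> cas x t / alpha.
    move=> x2; apply: (fejer_cvg alpha0 (M := 2)) => //.
    - by move=> z; exact: cas_max.
    - exact: lt_le_trans x2 c2P.
    - rewrite (_ : cas^~ t = cas t); first exact: cas_continuous.
      by apply/funext => z; rewrite casC.
  have ab x y : `|x| < c -> `|y| < c -> `|x + y| < 2 * c.
    by move=> hx hy; rewrite (le_lt_trans (ler_normD _ _))//; lra.
  have -> : cas xi t * cas eta t / alpha =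
      2^-1 * (cas (xi - eta) t / alpha + cas (eta - xi) t / alpha +
      (cas (xi + eta) t / alpha - cas (- (xi + eta)) t / alpha)).
    rewrite /cas.
    rewrite (_ : 2 * pi * ((xi - eta) * t) = 2 * pi * (xi * t) - 2 * pi * (eta * t)); last by ring.
    rewrite (_ : 2 * pi * ((eta - xi) * t) = 2 * pi * (eta * t) - 2 * pi * (xi * t)); last by ring.
    rewrite (_ : 2 * pi * ((xi + eta) * t) = 2 * pi * (xi * t) + 2 * pi * (eta * t)); last by ring.
    rewrite (_ : 2 * pi * ((- (xi + eta)) * t) = - (2 * pi * (xi * t) + 2 * pi * (eta * t))); last by ring.
    by rewrite !(sinN, cosN, cosB, sinB, cosD, sinD); field; rewrite gt_eqF.
  apply: cvgM; first exact: cvg_cst.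
  apply: cvgD; first by apply: cvgD; apply: lL; rewrite ab ?normrN.
  by apply: cvgB; apply: lL; rewrite ?normrN ab.
have E N : avg N (fun k => H Q1 (alpha * k%:~R) * (H Q2 (alpha * k%:~R) * S (alpha * k%:~R))) =
    Int (fun xi => Q1 xi * Int (fun eta => Q2 eta * W N xi eta)).
  rewrite avg_hartley//; apply: eq_Rintegral => xi _; congr (_ * _).
  rewrite (_ : (fun k => _) = fun k : int => H Q2 (alpha * k%:~R) *
    (cas xi (alpha * k%:~R) * S (alpha * k%:~R))); last by apply/funext => k; ring.
  rewrite avg_hartley//; apply: eq_Rintegral => eta _; congr (_ * _).
  by apply: eq_avg => k; ring.
have mW N xi : msr (W N xi).
  apply: msr_avg => k; apply: measurable_funM => //.
  by apply: measurable_funM => //; exact: msr_casr.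
have inner_cvg xi : `|xi| < c -> Int (fun eta => Q2 eta * W N xi eta) @[N --> \oo] -->
    cas xi t * H Q2 t / alpha.
  move=> xc; have -> : cas xi t * H Q2 t / alpha = Int (fun eta => Q2 eta * (cas xi t * cas eta t / alpha)).
    rewrite mulrAC {1}/hartley -IntZ; last exact: intg_cas.
    by apply: eq_Rintegral => eta _; ring.
  have [||||_ lim] := @Int_dct _ (fun N eta => Q2 eta * W N xi eta)
    (fun eta => Q2 eta * (cas xi t * cas eta t / alpha)) (fun eta => 4 / alpha * `|Q2 eta|); last exact: lim.
  - by move=> N; apply: measurable_funM; [exact: mQ2|exact: mW].
  - by apply: intgZ; exact: intg_abs.
  - by move=> N eta; rewrite normrM mulrC ler_wpM2r.
  - move=> eta; have [ec|ec] := leP c `|eta|.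
      by rewrite Q20// mul0r; under eq_fun do rewrite mul0r; exact: cvg_cst.
    by apply: cvgM; [exact: cvg_cst|exact: W_cvg].
have lim : Int (fun xi => Q1 xi * Int (fun eta => Q2 eta * W N xi eta)) @[N --> \oo] -->
    H Q1 t * H Q2 t / alpha.
  have -> : H Q1 t * H Q2 t / alpha = Int (fun xi => Q1 xi * (cas xi t * H Q2 t / alpha)).
    rewrite -mulrA mulrC {2}/hartley -IntZ; last exact: intg_cas.
    by apply: eq_Rintegral => xi _; ring.
  have [||||_ lim] := @Int_dct _ (fun N xi => Q1 xi * Int (fun eta => Q2 eta * W N xi eta))
    (fun xi => Q1 xi * (cas xi t * H Q2 t / alpha))
    (fun xi => 4 / alpha * Int (fun eta => `|Q2 eta|) * `|Q1 xi|); last exact: lim.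
  - move=> N; apply: measurable_funM => //.
    rewrite (_ : (fun xi => _) = fun xi => avg N (fun k => cas xi (alpha * k%:~R) *
      (H Q2 (alpha * k%:~R) * S (alpha * k%:~R)))).
      by apply: msr_avg => k; apply: measurable_funM => //; exact: msr_casr.
    apply/funext => xi; rewrite (_ : (fun k => _) = fun k : int => H Q2 (alpha * k%:~R) *
      (cas xi (alpha * k%:~R) * S (alpha * k%:~R))); last by apply/funext => k; ring.
    rewrite avg_hartley//; apply: eq_Rintegral => eta _; congr (_ * _).
    by apply: eq_avg => k; ring.
  - by apply: intgZ; exact: intg_abs.
  - move=> N xi; rewrite normrM mulrC ler_wpM2r// -IntZ; last exact: intg_abs.
    apply: Int_abs_le; [by apply: measurable_funM; [exact: mQ2|exact: mW]|by apply: intgZ; exact: intg_abs|].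
    by move=> eta; rewrite normrM mulrC ler_wpM2r.
  - move=> xi; have [xc|xc] := leP c `|xi|.
      by rewrite Q10// mul0r; under eq_fun do rewrite mul0r; exact: cvg_cst.
    by apply: cvgM; [exact: cvg_cst|exact: inner_cvg].
have le4 N : `|Int (fun xi => Q1 xi * Int (fun eta => Q2 eta * W N xi eta))| <= 4 / alpha * b.
  rewrite -E (le_trans (ler_norm_avg _ _))//.
  rewrite (le_trans _ (ler_wpM2l _ (le_b N))) ?divr_ge0// -avgZ; apply: le_avg => k.
  by rewrite mulrA normrM mulrC ler_wpM2r.
have : `|H Q1 t * H Q2 t / alpha| <= 4 / alpha * b.
  apply: (ler_cvg_to (cvg_norm lim) (cvg_cst (4 / alpha * b))).
  by apply: nearW => N; exact: le4.
rewrite normrM normfV (gtr0_norm alpha0) mulrAC ler_pM2r ?invr_gt0//.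
Qed.

End sampling.

(** * Analyticity and voices *)

Section taylor.
Context {R : realType}.
Implicit Types (theta h x t s a c : R) (N m : nat).

(** Each derivative of the cosine is a shift by [pi / 2], so one formula gives all Taylor
    coefficients at [theta]. *)
Definition cos_taylor N theta h : R :=
  \sum_(m < N) cos (theta + m%:R * (pi / 2)) * (h ^+ m / m`!%:R).

Let cos_taylorS N theta : cos_taylor N.+1 theta =
  (fun h => cos_taylor N theta h + cos (theta + N%:R * (pi / 2)) / N`!%:R * h ^+ N).
Proof.
apply/funext => h; rewrite /cos_taylor big_ord_recr/=; congr (_ + _).
by rewrite -mulrA; congr (_ * _); rewrite mulrC.
Qed.

Let is_derive_exprnS N h : is_derive h 1 (fun y : R => y ^+ N.+1) (N.+1%:R * h ^+ N).
Proof.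
apply: DeriveDef; first exact: exprn_derivable.
by rewrite exp_derive /GRing.scale/= mulr1.
Qed.

Let is_derive_cos_taylor N theta h :
  is_derive h 1 (cos_taylor N.+1 theta) (cos_taylor N (theta + pi / 2) h).
Proof.
elim: N => [|N ih].
  rewrite cos_taylorS (_ : (fun _ => _) = cst (cos theta)); last first.
    apply/funext => y; rewrite /cos_taylor big_ord0 expr0 add0r mul0r addr0.
    by rewrite fact0 divr1 mulr1.
  by rewrite /cos_taylor big_ord0; exact: is_derive_cst.
rewrite cos_taylorS [in X in is_derive _ _ _ X]cos_taylorS.
have gen (T : R -> R) (dT k : R) : is_derive h 1 T dT ->
    is_derive h 1 (fun y => T y + k * y ^+ N.+1) (dT + k * (N.+1%:R * h ^+ N)).
  move=> TdT; have dX := is_derive_exprnS N h.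
  apply: is_derive_eq; rewrite /GRing.scale/=; ring.
apply: is_derive_eq (gen _ _ _ ih) _; congr (_ + _).
have f0 : (N`!%:R : R) != 0 by rewrite pnatr_eq0 -lt0n fact_gt0.
have S0 : (N.+1%:R : R) != 0 by rewrite pnatr_eq0.
rewrite factS natrM (_ : theta + N.+1%:R * (pi / 2) = theta + pi / 2 + N%:R * (pi / 2)); last first.
  by rewrite -natr1; ring.
move: (cos _) => co; move: (N.+1%:R : R) (N`!%:R : R) S0 f0 => y z y0 z0.
by field; rewrite y0 z0.
Qed.

(** Induction on the order: the derivative in [h] of the remainder is the previous remainder at
    [theta + pi / 2], and the mean value theorem transfers the bound. *)
Let cos_taylor_pos N theta h : 0 <= h ->
  `|cos (theta + h) - cos_taylor N theta h| <= h ^+ N / N`!%:R.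
Proof.
elim: N theta h => [|N ih] theta h h0.
  by rewrite /cos_taylor big_ord0 subr0 expr0 fact0 divr1 cos_max.
(* Taking [e] to be 1 and -1 gives both sides of the absolute value. *)
have main (e : R) : `|e| <= 1 -> e * (cos (theta + h) - cos_taylor N.+1 theta h) <= h ^+ N.+1 / N.+1`!%:R.
  move=> e1.
  pose g y := y ^+ N.+1 / N.+1`!%:R - e * (cos (theta + y) - cos_taylor N.+1 theta y).
  pose dg y := y ^+ N / N`!%:R - e * (cos (theta + pi / 2 + y) - cos_taylor N (theta + pi / 2) y).
  have dgE (y : R) : is_derive y 1 g (dg y).
    have gen (T : R -> R) (dT k : R) : is_derive y 1 T dT ->
        is_derive y 1 (fun z => z ^+ N.+1 / k - e * (cos (theta + z) - T z))
          (N.+1%:R * y ^+ N / k - e * (- sin (theta + y) - dT)).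
      move=> TdT; have dX := is_derive_exprnS N y.
      apply: is_derive_eq; rewrite /GRing.scale/=; ring.
    apply: is_derive_eq (gen _ _ _ (is_derive_cos_taylor N theta y)) _.
    rewrite /dg (_ : cos (theta + pi / 2 + y) = - sin (theta + y)); last first.
      by rewrite -addrA [_ / 2 + y]addrC addrA cosDpihalf.
    congr (_ - _).
    have f0 : (N`!%:R : R) != 0 by rewrite pnatr_eq0 -lt0n fact_gt0.
    have S0 : (N.+1%:R : R) != 0 by rewrite pnatr_eq0.
    rewrite factS natrM; move: (N.+1%:R : R) (N`!%:R : R) S0 f0 => y1 z y0 z0.
    by field; rewrite y0 z0.
  have cg : continuous g.
    by move=> y; apply/differentiable_continuous/derivable1_diffP; have [] := dgE y.
  have g0 : g 0 = 0.
    rewrite /g expr0n/= mul0r /cos_taylor big_ord_recl/= mul0r addr0 big1 => [|i _].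
      by rewrite expr0 fact0 divr1 mulr1; ring.
    by rewrite /bump/= add1n expr0n/= mul0r mulr0.
  have [y] := @MVT_segment _ g dg 0 h h0 (fun y _ => dgE y) (continuous_subspaceT cg).
  rewrite in_itv/= => /andP[y0 _] gE.
  suff : 0 <= g h by rewrite /g subr_ge0.
  have -> : g h = dg y * h by move: gE; rewrite g0 !subr0.
  rewrite mulr_ge0// /dg subr_ge0.
  apply: le_trans (ih (theta + pi / 2) y y0).
  rewrite (le_trans (ler_norm _))// normrM ler_piMl//.
rewrite ler_norml; apply/andP; split.
  have := main (-1); rewrite normrN normr1 lexx mulN1r => /(_ isT).
  by rewrite lerNl.
by have := main 1; rewrite normr1 lexx mul1r => /(_ isT).
Qed.

Lemma cos_taylor_le N theta h :
  `|cos (theta + h) - cos_taylor N theta h| <= `|h| ^+ N / N`!%:R.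
Proof.
have [h0|h0] := leP 0 h; first by rewrite (ger0_norm h0); exact: cos_taylor_pos.
rewrite (ltr0_norm h0) -cosN opprD.
rewrite (_ : cos_taylor N theta h = cos_taylor N (- theta) (- h)).
  by apply: cos_taylor_pos; rewrite oppr_ge0 ltW.
rewrite /cos_taylor; apply: eq_bigr => m _.
have -> : - theta + m%:R * (pi / 2) = - (theta + m%:R * (pi / 2)) + pi *+ m.
  by rewrite -mulr_natr; field.
rewrite (alternatingn (@cosDpi R)) cosN -[- h]mulN1r exprMn_comm; last exact: mulrC.
have : ((-1) ^+ m * (-1) ^+ m = 1 :> R) by rewrite -exprMn_comm ?mulN1r ?opprK ?expr1n//; exact: mulrC.
move: ((-1) ^+ m : R) (cos _) (h ^+ m) => e co y e2.
rewrite -{1}[co]mul1r -e2; ring.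
Qed.

Lemma expR_ge_monomial x N : 0 <= x -> x ^+ N / N`!%:R <= expR x.
Proof.
move=> x0; case: N => [|N].
  by rewrite expr0 fact0 divr1 -[leLHS]addr0 (le_trans _ (expR_ge1Dx x))// lerD2l.
by rewrite (le_trans _ (expR_ge1Dxn N x0))// lerDr.
Qed.

(** Taylor coefficient of [cas x] at [t], with the sine written as a cosine delayed by [pi / 2]. *)
Definition cas_coeff m x t : R :=
  (cos (2 * pi * (x * t) + m%:R * (pi / 2)) +
   cos (2 * pi * (x * t) - pi / 2 + m%:R * (pi / 2))) * ((2 * pi * x) ^+ m / m`!%:R).

Lemma cas_taylor N x t s :
  `|cas x (t + s) - \sum_(m < N) cas_coeff m x t * s ^+ m| <=
  2 * (`|2 * pi * x * s| ^+ N / N`!%:R).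
Proof.
set y := 2 * pi * (x * t); set h := 2 * pi * x * s.
have -> : cas x (t + s) - \sum_(m < N) cas_coeff m x t * s ^+ m =
    (cos (y + h) - cos_taylor N y h) + (cos (y - pi / 2 + h) - cos_taylor N (y - pi / 2) h).
  rewrite /cas (_ : 2 * pi * (x * (t + s)) = y + h); last by rewrite /y /h; ring.
  rewrite (_ : y - pi / 2 + h = y + h - pi / 2); last by ring.
  rewrite cosBpihalf (_ : \sum_(m < N) _ = cos_taylor N y h + cos_taylor N (y - pi / 2) h).
    by ring.
  rewrite /cos_taylor -big_split/=; apply: eq_bigr => m _.
  by rewrite /cas_coeff -/y /h [(2 * pi * x * s) ^+ m]exprMn; ring.
by rewrite (le_trans (ler_normD _ _))// mulr_natl mulr2n lerD// cos_taylor_le.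
Qed.

Lemma cas_coeff_le m x t : `|cas_coeff m x t| <= 2 * (`|2 * pi * x| ^+ m / m`!%:R).
Proof.
rewrite /cas_coeff normrM normrM normfV normrX (@ger0_norm _ m`!%:R)// ler_wpM2r//.
by rewrite (le_trans (ler_normD _ _))// -[2]/(1 + 1) lerD// cos_max.
Qed.

Lemma msr_cas_coeff m t : msr (cas_coeff m ^~ t).
Proof.
have mc (y : R) : measurable_fun [set: R] (fun x => cos (2 * pi * (x * t) + y)).
  apply: (measurableT_comp (continuous_msr (@continuous_cos R))).
  apply: measurable_funD => //; apply: measurable_funM => //.
  exact: measurable_funM.
apply: measurable_funM.
  apply: measurable_funD; first exact: mc.
  by under eq_fun do rewrite -addrA; exact: mc.
apply: measurable_funM => //; apply: measurable_funX.
exact: measurable_funM.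
Qed.

(* The radius [rho] does not depend on the center, so that a zero set with an
   interior point spreads over the line in steps of length [rho]. *)
Definition uniformly_analytic (T : R -> R) : Prop :=
  exists K rho, 0 < rho /\ forall t, exists a : nat -> R, forall N s,
    `|s| <= rho -> `|T (t + s) - \sum_(m < N) a m * s ^+ m| <= K * (`|s| / rho) ^+ N.

Lemma uniformly_analytic_continuous T : uniformly_analytic T -> continuous T.
Proof.
move=> [K [rho [rho0 Ta]]] t; have [a aT] := Ta t.
have K0 : 0 <= K.
  have := aT 0%N 0; rewrite normr0 big_ord0 subr0 expr0 mulr1 => h.
  by rewrite (le_trans _ (h (ltW rho0))).
have a0 : a 0%N = T t.
  have := aT 1%N 0; rewrite normr0 mul0r expr1 mulr0 addr0 big_ord1 expr0 mulr1 => h.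
  by apply/eqP; rewrite eq_sym -subr_eq0 -normr_le0 h// ltW.
apply/cvgrPdist_le => e e0.
pose d := Num.min rho (e * rho / (K + 1)).
have K1 : 0 < K + 1 by lra.
have d0 : 0 < d by rewrite lt_min rho0 divr_gt0// mulr_gt0.
exists d => // z /= zt.
have zd : `|z - t| <= d by rewrite distrC ltW.
have := aT 1%N (z - t); rewrite big_ord1 expr0 mulr1 a0 expr1 (addrC t) subrK => h.
rewrite distrC (le_trans (h _))//; first by rewrite (le_trans zd)// ge_min lexx.
rewrite mulrA ler_pdivrMr//.
have : `|z - t| <= e * rho / (K + 1) by rewrite (le_trans zd)// ge_min lexx orbT.
rewrite ler_pdivlMr// => h2; have h3 := normr_ge0 (z - t); nra.
Qed.

(** A first nonzero coefficient would dominate near [t], so all vanish; the remainder bound is then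
    a geometric sequence bounding [T] itself, up to radius [rho]. *)
Let analytic_local T K rho (a : nat -> R) t d : 0 < rho -> 0 < d ->
  (forall N s, `|s| <= rho -> `|T (t + s) - \sum_(m < N) a m * s ^+ m| <= K * (`|s| / rho) ^+ N) ->
  (forall s, `|s| < d -> T (t + s) = 0) ->
  forall s, `|s| < rho -> T (t + s) = 0.
Proof.
move=> rho0 d0 aT Td.
have K0 : 0 <= K.
  have := aT 0%N 0; rewrite normr0 big_ord0 subr0 expr0 mulr1 => h.
  by rewrite (le_trans _ (h (ltW rho0))).
have a0 m : a m = 0.
  have [n mn] := ubnP m; elim: n m mn => // n ih m; rewrite ltnS => mn.
  apply/eqP; apply: contraT => am.
  have am0 : 0 < `|a m| by rewrite normr_gt0.
  (* The remainder bound at this point forces [|a m| * rho ^+ m.+1 <= K * s], which the last entry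
     of the minimum contradicts. *)
  pose s := Num.min (d / 2) (Num.min rho (`|a m| * rho ^+ m.+1 / (2 * (K + 1)))).
  have K1 : 0 < 2 * (K + 1) by lra.
  have s0 : 0 < s by rewrite !lt_min rho0 !divr_gt0// mulr_gt0// exprn_gt0.
  have sd : s < d by rewrite (@le_lt_trans _ _ (d / 2))// ?ge_min ?lexx//; lra.
  have sr : s <= rho by rewrite !ge_min lexx orbT.
  have sa : s <= `|a m| * rho ^+ m.+1 / (2 * (K + 1)) by rewrite !ge_min lexx !orbT.
  have := aT m.+1 s; rewrite (gtr0_norm s0) => /(_ sr).
  rewrite Td ?(gtr0_norm s0)// big_ord_recr/= big1 => [|i _]; last first.
    by rewrite ih ?mul0r// (leq_trans (ltn_ord i)).
  rewrite !add0r normrN normrM normrX (gtr0_norm s0) expr_div_n mulrA.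
  rewrite ler_pdivlMr ?exprn_gt0// => h.
  have sm : 0 < s ^+ m by rewrite exprn_gt0.
  have {}h : `|a m| * rho ^+ m.+1 <= K * s.
    by rewrite -(ler_pM2r sm) mulrAC (le_trans h)// exprS mulrA.
  move: sa; rewrite ler_pdivlMr//; have := mulr_gt0 am0 (exprn_gt0 m.+1 rho0); nra.
move=> s sr; apply/eqP; rewrite -normr_le0.
have q1 : `| (`|s| / rho) | < 1.
  by rewrite ger0_norm ?divr_ge0 ?(ltW rho0)// ltr_pdivrMr// mul1r.
have lim : K * (`|s| / rho) ^+ N @[N --> \oo] --> 0.
  by rewrite -(mulr0 K); apply: cvgM; [exact: cvg_cst|exact: cvg_expr].
apply: (ler_cvg_to (cvg_cst `|T (t + s)|) lim); apply: nearW => N.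
have := aT N s (ltW sr); rewrite big1 ?subr0// => i _.
by rewrite a0 mul0r.
Qed.

Lemma uniformly_analytic_zero T t d : uniformly_analytic T -> 0 < d ->
  (forall s, `|s| < d -> T (t + s) = 0) -> forall x, T x = 0.
Proof.
move=> [K [rho [rho0 Ta]]] d0 Td x.
pose Z t := forall s, `|s| < rho -> T (t + s) = 0.
have Zt : Z t by have [a aT] := Ta t; exact: (analytic_local rho0 d0 aT Td).
have step u h : Z u -> `|h| < rho -> Z (u + h).
  move=> Zu hr; have [a aT] := Ta (u + h).
  have hr0 : 0 < rho - `|h| by rewrite subr_gt0.
  apply: (analytic_local rho0 hr0 aT) => s sh.
  by rewrite -addrA Zu// (le_lt_trans (ler_normD _ _))//; lra.
pose n := (Num.truncn (`|x - t| / rho)).+1.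
have n0 : 0 < n%:R :> R by rewrite ltr0n.
pose h := (x - t) / n%:R.
have hr : `|h| < rho.
  rewrite /h normrM normfV (gtr0_norm n0) ltr_pdivrMr// mulrC -ltr_pdivrMr//.
  exact: truncnS_gt.
have Zn (m : nat) : Z (t + m%:R * h).
  elim: m => [|m ih]; first by rewrite mul0r addr0.
  by rewrite -natr1 mulrDl mul1r addrA; exact: step.
have := Zn n 0; rewrite normr0 addr0 => /(_ rho0).
by rewrite /h mulrC divfK ?gt_eqF// addrC subrK.
Qed.

End taylor.

(** * Square-integrable functions and their truncations *)

Section square_integrable.
Context {R : realType}.
Local Notation mu := (@lebesgue_measure R).
Local Notation Int := (Rintegral mu setT).
Implicit Types (f g u v : R -> R) (a b d x : R).

Definition l2 f : Prop := msr f /\ intg (fun x => f x ^+ 2).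

Lemma l2_mul f g : l2 f -> l2 g -> intg (fun x => f x * g x).
Proof.
move=> [mf f2] [mg g2]; apply: (intg_le _ (intgD f2 g2)); first exact: measurable_funM.
move=> x; rewrite normrM -(real_normK (num_real (f x))) -(real_normK (num_real (g x))).
have := normr_ge0 (f x); have := normr_ge0 (g x).
by move: (`|f x|) (`|g x|) => p q; nra.
Qed.

Lemma l2D f g : l2 f -> l2 g -> l2 (fun x => f x + g x).
Proof.
move=> lf lg; split; first by apply: measurable_funD; [exact: lf.1|exact: lg.1].
rewrite (_ : (fun x => _) = fun x => f x ^+ 2 + 2 * (f x * g x) + g x ^+ 2).
  by apply: intgD (lg.2); apply: intgD (lf.2) _; apply: intgZ; exact: l2_mul.
by apply/funext => x; ring.
Qed.

Lemma l2Z a f : l2 f -> l2 (fun x => a * f x).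
Proof.
move=> lf; split; first by apply: measurable_funM => //; exact: lf.1.
by under eq_fun do rewrite exprMn; apply: intgZ; exact: lf.2.
Qed.

Lemma l2B f g : l2 f -> l2 g -> l2 (fun x => f x - g x).
Proof.
by move=> lf /(l2Z (-1)) lg; have := l2D lf lg; under eq_fun do rewrite mulN1r.
Qed.

Lemma bcs_l2 u : bcs u -> l2 u.
Proof. by move=> ub; split; [exact: ub.1|exact: bcs_sqr_intg]. Qed.

Lemma l2_shift f b : l2 f -> l2 (fun x => f (x + b)).
Proof.
move=> lf; split; first by apply: (measurableT_comp lf.1); exact: measurable_funD.
exact: (Int_shift b lf.2).1.
Qed.

Lemma Int_sqr_ge0 f : 0 <= Int (fun x => f x ^+ 2).
Proof. by apply: Int_ge0 => x; exact: sqr_ge0. Qed.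

Lemma Cauchy_Schwarz f g : l2 f -> l2 g ->
  Int (fun x => f x * g x) ^+ 2 <= Int (fun x => f x ^+ 2) * Int (fun x => g x ^+ 2).
Proof.
move=> lf lg; have fg := l2_mul lf lg.
set F := Int (fun x => f x ^+ 2); set G := Int (fun x => g x ^+ 2).
set X := Int (fun x => f x * g x).
have quad (l : R) : 0 <= F - 2 * l * X + l ^+ 2 * G.
  have -> : F - 2 * l * X + l ^+ 2 * G = Int (fun x => (f x - l * g x) ^+ 2).
    rewrite (_ : (fun x => (f x - l * g x) ^+ 2) =
      (fun x => f x ^+ 2 - 2 * l * (f x * g x) + l ^+ 2 * g x ^+ 2)); last first.
      by apply/funext => x; ring.
    have i0 : intg (fun x => f x ^+ 2) := lf.2.
    have i1 : intg (fun x => 2 * l * (f x * g x)) by exact: intgZ.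
    have i2 : intg (fun x => l ^+ 2 * g x ^+ 2) by apply: intgZ; exact: lg.2.
    rewrite IntD//; last exact: intgB.
    by rewrite IntB// !IntZ//; exact: lg.2.
  exact: Int_sqr_ge0.
have G0 : 0 <= G by exact: Int_sqr_ge0.
have [G00|Gpos] := eqVneq G 0.
  rewrite G00 mulr0; have [->|X0] := eqVneq X 0; first by rewrite expr0n.
  (* With [G = 0] the quadratic is affine in [l]; this value makes it equal to -1. *)
  have := quad ((F + 1) / (2 * X)); rewrite G00 mulr0 addr0.
  rewrite (_ : F - _ = -1); last by clearbody X F; field.
  by rewrite ler0N1.
have {}Gpos : 0 < G by rewrite lt_neqAle eq_sym Gpos.
have := quad (X / G).
rewrite (_ : F - _ + _ = (F * G - X ^+ 2) / G).
  by rewrite pmulr_lge0 ?invr_gt0// subr_ge0.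
by clearbody X F G; field; rewrite gt_eqF.
Qed.

(** Large values are dropped rather than clipped, so pointwise the truncation is [f x] or 0, and
    [|f x|] dominates both it and the error. *)
Definition trunc n f x : R := box n%:R x * (box n%:R (f x) * f x).

Lemma trunc_bcs n f : msr f -> bcs (trunc n f).
Proof.
move=> mf; split.
  apply: measurable_funM; first exact: intg_msr (intg_box _).
  apply: measurable_funM => //.
  exact: (measurableT_comp (intg_msr (intg_box _)) mf).
exists n%:R, n%:R; split => x; rewrite /trunc.
  rewrite normrM ger0_norm ?box_ge0// (le_trans (ler_piMl _ (box_le1 _ _)))//.
  rewrite boxE; case: (leP `|f x| n%:R) => [h|_]; first by rewrite mul1r.
  by rewrite mul0r normr0.
by rewrite [box _ x]boxE leNgt => ->; rewrite mul0r.
Qed.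

Lemma trunc_sub n f x : `|f x - trunc n f x| <= `|f x| /\ `|trunc n f x| <= `|f x|.
Proof.
rewrite /trunc !boxE; case: (leP `|x| _) => _; case: (leP `|f x| _) => _;
  by rewrite ?mul1r ?mul0r ?subrr ?subr0 ?normr0 ?lexx ?normr_ge0.
Qed.

Lemma trunc_cvg f x : trunc n f x @[n --> \oo] --> f x.
Proof.
apply: cvg_near_cst; exists (maxn (Num.truncn `|x|).+1 (Num.truncn `|f x|).+1) => // n /=.
rewrite geq_max => /andP[xn fn]; rewrite /trunc !boxE.
have h (z : R) : (Num.truncn `|z| < n)%N -> `|z| <= n%:R.
  by move=> zn; rewrite (le_trans (ltW (truncnS_gt _)))// ler_nat.
by rewrite !h// !mul1r.
Qed.

Lemma trunc_l2_cvg f : l2 f ->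
  Int (fun x => (f x - trunc n f x) ^+ 2) @[n --> \oo] --> 0.
Proof.
move=> lf; rewrite -[X in _ --> X]Int0.
have [||||_ lim] := @Int_dct _ (fun n x => (f x - trunc n f x) ^+ 2) (fun=> 0)
  (fun x => f x ^+ 2); last exact: lim.
- move=> n; apply: measurable_funX; apply: measurable_funB; first exact: lf.1.
  exact: (trunc_bcs n lf.1).1.
- exact: lf.2.
- move=> n x; rewrite normrX -[leRHS]real_normK ?num_real// lerXn2r ?nnegrE//.
  exact: (trunc_sub n f x).1.
- move=> x; have h : f x - trunc n f x @[n --> \oo] --> f x - f x.
    by apply: cvgB; [exact: cvg_cst|exact: trunc_cvg].
  have e0 : 0 = (f x - f x) * (f x - f x) by rewrite subrr mulr0.
  by rewrite e0; under eq_fun do rewrite expr2; exact: cvgM.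
Qed.

Lemma trunc_mul_cvg f g : l2 f -> l2 g ->
  Int (fun x => trunc n f x * g x) @[n --> \oo] --> Int (fun x => f x * g x).
Proof.
move=> lf lg; have fg := l2_mul lf lg.
have [||||_ lim] := @Int_dct _ (fun n x => trunc n f x * g x) (fun x => f x * g x)
  (fun x => `|f x * g x|); last exact: lim.
- by move=> n; apply: measurable_funM; [exact: (trunc_bcs n lf.1).1|exact: lg.1].
- exact: intg_abs.
- move=> n x; rewrite (normrM (trunc n f x)) (normrM (f x)) ler_wpM2r//.
  exact: (trunc_sub n f x).2.
- by move=> x; apply: cvgM; [exact: trunc_cvg|exact: cvg_cst].
Qed.

Lemma trunc_sqr_le n f : l2 f ->
  Int (fun x => trunc n f x ^+ 2) <= Int (fun x => f x ^+ 2).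
Proof.
move=> lf; apply: le_Int; [exact: bcs_sqr_intg (trunc_bcs n lf.1)|exact: lf.2|].
move=> x; rewrite -(real_normK (num_real (trunc n f x))) -[leRHS]real_normK ?num_real//.
by rewrite lerXn2r ?nnegrE//; exact: (trunc_sub n f x).2.
Qed.

End square_integrable.

(** * Voices of a single generator *)

Section generator.
Context {R : realType}.
Local Notation mu := (@lebesgue_measure R).
Local Notation Int := (Rintegral mu setT).
Local Notation H := hartley.
Implicit Types (f g u v : R -> R) (a b d x t s : R).

Definition generator c (A : R -> R) : Prop :=
  [/\ continuous A, forall x, A (- x) = A x, forall x, `|A x| <= 1 &
      forall x, c <= `|x| -> A x = 0].

(* The inner products of [f] with the translates of one band-limited function. *)
Definition voice (A f : R -> R) t : R := Int (fun x => f x * H A (x - t)).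

Variables (c : R) (A : R -> R).
Hypotheses (c0 : 0 < c) (genA : generator c A).

Let cA : continuous A. Proof. by have [] := genA. Qed.
Let Ae x : A (- x) = A x. Proof. by have [] := genA. Qed.
Let A1 x : `|A x| <= 1. Proof. by have [] := genA. Qed.
Let A0 x : c <= `|x| -> A x = 0. Proof. by have [_ _ _] := genA; exact. Qed.
Let mA : msr A. Proof. exact: continuous_msr. Qed.

Lemma generator_bcs : bcs A.
Proof. by split => //; exists 1, c; split => // x /ltW /A0. Qed.

Let Ai : intg A. Proof. exact: bcs_intg generator_bcs. Qed.

Lemma generator_band_limited g : continuous g -> (exists M, forall x, `|g x| <= M) ->
  band_limited c (fun x => A x * g x).
Proof.
move=> cg [M gM]; split.
- by move=> x; apply: cvgM; [exact: cA|exact: cg].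
- by exists M => x; rewrite normrM (le_trans _ (gM x))// ler_piMl.
- by move=> x /A0 ->; rewrite mul0r.
Qed.

Lemma hartley_generator_l2 t : l2 (fun x => H A (x - t)).
Proof.
have [h2 _] := plancherel generator_bcs.
by apply: (l2_shift (f := H A) (- t)); split => //; exact: msr_hartley.
Qed.

(** Here the voice is seen to be band-limited. The formula needs [H u] as an integral, whereas
    [voice] makes sense for every square-integrable function. *)
Lemma voice_bcs u t : bcs u -> voice A u t = H (fun xi => A xi * H u xi) t.
Proof. by move=> ub; rewrite /voice -hartley_convolution//; exact: bcs_intg. Qed.

Lemma voice_band_limited u : bcs u -> band_limited c (fun xi => A xi * H u xi).
Proof.
move=> ub; have ui := bcs_intg ub; apply: generator_band_limited.
  exact: hartley_continuous.
by exists (2 * Int (fun x => `|u x|)) => x; exact: hartley_le.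
Qed.

Lemma voiceB f g t : l2 f -> l2 g ->
  voice A (fun x => f x - g x) t = voice A f t - voice A g t.
Proof.
move=> lf lg; have lG := hartley_generator_l2 t; rewrite /voice -IntB; try exact: l2_mul.
by apply: eq_Rintegral => x _; rewrite mulrBl.
Qed.

Lemma bcs_shift u b : bcs u -> bcs (fun x => u (x + b)).
Proof.
move=> [mu_ [M [r [uM ur]]]]; split.
  by apply: (measurableT_comp mu_); exact: measurable_funD.
exists M, (r + `|b|); split => // x xr; apply: ur.
have : `|x| <= `|x + b| + `|b| by rewrite -{1}[x](addrK b) ler_normB.
lra.
Qed.

Lemma voice_shift u b t : bcs u ->
  voice A (fun x => u (x + b)) t = voice A u (t + b).
Proof.
move=> ub.
have gi : intg (fun x => u x * H A (x - (t + b))).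
  by apply: l2_mul; [exact: bcs_l2|exact: hartley_generator_l2].
have [_ e] := Int_shift b gi; rewrite {2}/voice -e; apply: eq_Rintegral => x _.
by rewrite (_ : x + b - (t + b) = x - t)//; ring.
Qed.

Lemma trunc_voice_cvg f t : l2 f -> voice A (trunc n f) t @[n --> \oo] --> voice A f t.
Proof. by move=> lf; apply: trunc_mul_cvg => //; exact: hartley_generator_l2. Qed.

Lemma generator_energy_le u : bcs u ->
  Int (fun xi => A xi ^+ 2 * H u xi ^+ 2) <= Int (fun x => u x ^+ 2).
Proof.
move=> ub; have [hi <-] := plancherel ub; apply: le_Int => //.
  have := bcs_sqr_intg (band_limited_bcs (voice_band_limited ub)).
  by under eq_fun do rewrite exprMn.
move=> x; rewrite ler_piMl ?sqr_ge0// -real_normK ?num_real// -[leRHS](expr1n _ 2).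
by rewrite lerXn2r ?nnegrE.
Qed.

Section lattice.
Variables (alpha b : R).
Hypotheses (alpha0 : 0 < alpha) (calpha : 4 * c * alpha <= 1).

(** The offset [b] is absorbed into a translate of [u], and [hartley_form_shift] removes it from the
    limit. *)
Lemma voice_avg_cvg u : bcs u ->
  avg N (fun k => voice A u (alpha * k%:~R + b) ^+ 2) @[N --> \oo] -->
  Int (fun xi => A xi ^+ 2 * H u xi ^+ 2) / alpha.
Proof.
move=> ub; have sb := bcs_shift b ub; have ui := bcs_intg ub.
have A2i : intg (fun xi => A xi ^+ 2) by exact: bcs_sqr_intg generator_bcs.
rewrite -(hartley_form_shift b A2i _ ui) => [|xi]; last by rewrite Ae.
have lim := sampling_parseval alpha0 c0 calpha (voice_band_limited sb).
have e1 : Int (fun xi => (A xi * H (fun x => u (x + b)) xi) ^+ 2) =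
    Int (fun xi => A xi ^+ 2 * H (fun x => u (x + b)) xi ^+ 2).
  by apply: eq_Rintegral => xi _; rewrite exprMn.
rewrite e1 in lim; apply: cvg_trans lim; apply: near_eq_cvg; apply: nearW => N.
by apply: eq_avg => k; rewrite -voice_bcs// voice_shift.
Qed.

Lemma voice_sums_le u (s : seq int) : bcs u -> uniq s ->
  \sum_(k <- s) voice A u (alpha * k%:~R + b) ^+ 2 <=
  Int (fun xi => A xi ^+ 2 * H u xi ^+ 2) / alpha.
Proof.
move=> ub us; apply: (sums_le_of_avg _ (voice_avg_cvg ub)) => // k.
exact: sqr_ge0.
Qed.

Lemma voice_sums_l2 f (s : seq int) : l2 f -> uniq s ->
  \sum_(k <- s) voice A f (alpha * k%:~R + b) ^+ 2 <= Int (fun x => f x ^+ 2) / alpha.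
Proof.
move=> lf us.
have lim : \sum_(k <- s) voice A (trunc n f) (alpha * k%:~R + b) ^+ 2 @[n --> \oo] -->
    \sum_(k <- s) voice A f (alpha * k%:~R + b) ^+ 2.
  elim: s {us} => [|k s ih].
    by under eq_fun do rewrite big_nil; rewrite big_nil; exact: cvg_cst.
  under eq_fun do rewrite big_cons; rewrite big_cons; apply: cvgD => //.
  under eq_fun do rewrite expr2; rewrite expr2.
  by apply: cvgM; exact: trunc_voice_cvg.
apply: (ler_cvg_to lim (cvg_cst _)); apply: nearW => n.
have tb := trunc_bcs n lf.1.
rewrite (le_trans (voice_sums_le tb us))// ler_pM2r ?invr_gt0//.
exact: le_trans (generator_energy_le tb) (trunc_sqr_le n lf).
Qed.

Lemma voice_product_bcs u v e t : bcs u -> bcs v ->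
  (forall N, avg N (fun k => `|voice A u (alpha * k%:~R + b) * voice A v (alpha * k%:~R + b)|) <= e) ->
  `|voice A u (t + b) * voice A v (t + b)| <= 4 * e.
Proof.
move=> ub vb le_e; have sub := bcs_shift b ub; have svb := bcs_shift b vb.
rewrite -!voice_shift// !voice_bcs//.
have bu := voice_band_limited sub; have bv := voice_band_limited svb.
apply: (sampling_product alpha0 calpha t bu bv) => N; apply: le_trans (le_e N); rewrite le_eqVlt; apply/orP; left; apply/eqP.
by apply: eq_avg => k; rewrite -!voice_bcs// !voice_shift.
Qed.

Let amgm (d p q : R) : 0 < d -> `|p * q| <= 2^-1 * (d^-1 * p ^+ 2 + d * q ^+ 2).
Proof.
move=> d0.
have e2 : 2^-1 * (d^-1 * p ^+ 2 + d * q ^+ 2) =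
    p * q + 2^-1 * d^-1 * (p - d * q) ^+ 2 by field; rewrite gt_eqF.
have e3 : 2^-1 * (d^-1 * p ^+ 2 + d * q ^+ 2) =
    - (p * q) + 2^-1 * d^-1 * (p + d * q) ^+ 2 by field; rewrite gt_eqF.
have w0 (z : R) : 0 <= 2^-1 * d^-1 * z ^+ 2.
  by rewrite mulr_ge0 ?sqr_ge0// mulr_ge0// invr_ge0 ltW.
have w1 := w0 (p - d * q); have w2 := w0 (p + d * q).
by rewrite ler_norml; apply/andP; split; [rewrite e3|rewrite e2]; lra.
Qed.

Lemma voice_product_zero u v t : l2 u -> l2 v ->
  (forall k : int, voice A u (alpha * k%:~R + b) * voice A v (alpha * k%:~R + b) = 0) ->
  voice A u t * voice A v t = 0.
Proof.
move=> lu lv uv0.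
pose Eu := Int (fun x => u x ^+ 2); pose Ev := Int (fun x => v x ^+ 2).
pose r n := Int (fun x => (u x - trunc n u x) ^+ 2) + Int (fun x => (v x - trunc n v x) ^+ 2).
have r_cvg : r n @[n --> \oo] --> 0.
  rewrite -(addr0 0); apply: (@cvgD _ R^o); exact: trunc_l2_cvg.
have avg_le f N : l2 f -> avg N (fun k => voice A f (alpha * k%:~R + b) ^+ 2) <=
    Int (fun x => f x ^+ 2) / alpha.
  by move=> lf; apply: avg_le_of_sums => s us; exact: voice_sums_l2.
(* Sampling applies only to the truncations, whose samples have a small product:
   one factor is within the truncation error of 0, and AM-GM with parameter [d]
   balances that error against the bounded energy of the other factor. *)
have key (d : R) n : 0 < d -> `|voice A (trunc n u) t * voice A (trunc n v) t| <=
    4 * (2^-1 * (d^-1 * (r n / alpha) + d * ((Eu + Ev) / alpha))).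
  move=> d0; rewrite -[t](subrK b).
  have ub := trunc_bcs n lu.1; have vb := trunc_bcs n lv.1.
  have lub := bcs_l2 ub; have lvb := bcs_l2 vb.
  apply: voice_product_bcs => // N.
  pose un (k : int) := voice A (trunc n u) (alpha * k%:~R + b).
  pose vn (k : int) := voice A (trunc n v) (alpha * k%:~R + b).
  pose du (k : int) := voice A (fun x => u x - trunc n u x) (alpha * k%:~R + b).
  pose dv (k : int) := voice A (fun x => v x - trunc n v x) (alpha * k%:~R + b).
  have : avg N (fun k => `|un k * vn k|) <=
      avg N (fun k => 2^-1 * (d^-1 * (du k ^+ 2 + dv k ^+ 2) + d * (un k ^+ 2 + vn k ^+ 2))).
    apply: le_avg => k.
    have duE : du k = voice A u (alpha * k%:~R + b) - un k by rewrite /du voiceB.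
    have dvE : dv k = voice A v (alpha * k%:~R + b) - vn k by rewrite /dv voiceB.
    have i0 : 0 <= d^-1 by rewrite invr_ge0 ltW.
    have := uv0 k => /eqP; rewrite mulf_eq0 => /orP[/eqP e1|/eqP e1].
      have -> : `|un k * vn k| = `|du k * vn k| by rewrite duE e1 sub0r mulNr normrN.
      rewrite (le_trans (amgm _ _ d0))// ler_pM2l//.
      have := mulr_ge0 i0 (sqr_ge0 (dv k)); have := mulr_ge0 (ltW d0) (sqr_ge0 (un k)).
      by rewrite !mulrDr; lra.
    have -> : `|un k * vn k| = `|dv k * un k| by rewrite dvE e1 sub0r mulNr normrN mulrC.
    rewrite (le_trans (amgm _ _ d0))// ler_pM2l//.
    have := mulr_ge0 i0 (sqr_ge0 (du k)); have := mulr_ge0 (ltW d0) (sqr_ge0 (vn k)).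
    by rewrite !mulrDr; lra.
  move=> /le_trans; apply; rewrite avgZ ler_pM2l// avgD !avgZ !avgD.
  have hu := avg_le _ N (l2B lu lub); have hv := avg_le _ N (l2B lv lvb).
  have hun := avg_le _ N lub; have hvn := avg_le _ N lvb.
  have iap : 0 < alpha^-1 by rewrite invr_gt0.
  apply: lerD; first by rewrite ler_wpM2l ?invr_ge0 ?(ltW d0)// /r mulrDl lerD.
  rewrite ler_wpM2l ?(ltW d0)// mulrDl lerD//.
    by rewrite (le_trans hun)// ler_pM2r// trunc_sqr_le.
  by rewrite (le_trans hvn)// ler_pM2r// trunc_sqr_le.
pose S := (Eu + Ev) / alpha.
(* For fixed [d] the truncation error disappears as [n] grows; only afterwards does [d] tend to
   0. *)
have key2 (d : R) : 0 < d -> `|voice A u t * voice A v t| <= 4 * (2^-1 * (d^-1 * 0 + d * S)).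
  move=> d0.
  have l1 : `|voice A (trunc n u) t * voice A (trunc n v) t| @[n --> \oo] -->
      `|voice A u t * voice A v t|.
    by apply: cvg_norm; apply: cvgM; exact: trunc_voice_cvg.
  have l2' : 4 * (2^-1 * (d^-1 * (r n / alpha) + d * S)) @[n --> \oo] -->
      4 * (2^-1 * (d^-1 * (0 / alpha) + d * S)).
    apply: cvgM; first exact: cvg_cst.
    apply: cvgM; first exact: cvg_cst.
    apply: cvgD; last exact: cvg_cst.
    apply: cvgM; first exact: cvg_cst.
    by apply: cvgM; last exact: cvg_cst.
  rewrite mul0r in l2'.
  by apply: (ler_cvg_to l1 l2'); apply: nearW => n; exact: key.
apply/eqP; rewrite -normr_le0.
have lim : 4 * (2^-1 * (harmonic n * S)) @[n --> \oo] --> 4 * (2^-1 * (0 * S)).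
  apply: cvgM; first exact: cvg_cst.
  apply: cvgM; first exact: cvg_cst.
  by apply: cvgM; [exact: cvg_harmonic|exact: cvg_cst].
rewrite mul0r !mulr0 in lim.
apply: (ler_cvg_to (cvg_cst _) lim); apply: nearW => n.
have := key2 _ (@harmonic_gt0 R n); by rewrite mulr0 add0r.
Qed.

End lattice.

(** Only frequencies below [c] occur, so the Taylor remainder of [cas] is at most
    [2 * (2 pi c |s|) ^ N] on the band. Plancherel and Cauchy-Schwarz carry this bound over to the
    pairing with [f]. *)
Lemma voice_analytic f : l2 f -> uniformly_analytic (voice A f).
Proof.
move=> lf.
pose F := Int (fun x => f x ^+ 2).
have F0 : 0 <= F by exact: Int_sqr_ge0.
have pp : 0 < 2 * pi :> R by rewrite mulr_gt0// pi_gt0.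
have pc : 0 < 2 * pi * c by rewrite mulr_gt0.
pose rho := (2 * pi * c)^-1.
have rho0 : 0 < rho by rewrite invr_gt0.
have pxc x : `|x| < c -> `|2 * pi * x| <= 2 * pi * c.
  by move=> xc; rewrite normrM (gtr0_norm pp) ler_wpM2l ?(ltW pp)// ltW.
have AgB g (M : R) : msr g -> (forall x, `|x| < c -> `|g x| <= M) -> 0 <= M ->
    bcs (fun x => A x * g x) /\ forall x, `|A x * g x| <= M * box c x.
  move=> mg gM M0.
  have le_box x : `|A x * g x| <= M * box c x.
    rewrite boxE; case: (leP `|x| c) => [|/ltW xc]; last first.
      by rewrite A0// mul0r normr0 mulr0.
    rewrite le_eqVlt => /predU1P[xc|xc].
      by rewrite A0 ?xc// mul0r normr0 mulr1.
    by rewrite mulr1 normrM (le_trans _ (gM _ xc))// ler_piMl.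
  split => //; split; first exact: measurable_funM.
  exists M, c; split => x; first by rewrite (le_trans (le_box x))// ler_piMr// box_le1.
  by move=> /ltW /A0 ->; rewrite mul0r.
have l2H (B : R -> R) : bcs B -> l2 (H B).
  by move=> bB; split; [exact: msr_hartley (bcs_intg bB)|exact: (plancherel bB).1].
pose B m t xi := A xi * cas_coeff m xi t.
have bB m t : bcs (B m t).
  have [] // := AgB (cas_coeff m ^~ t) (2 * ((2 * pi * c) ^+ m / m`!%:R)).
  - exact: msr_cas_coeff.
  - move=> x xc; rewrite (le_trans (cas_coeff_le _ _ _))// ler_wpM2l// ler_wpM2r//.
    by rewrite lerXn2r ?nnegrE ?(ltW pc)// pxc.
  - by rewrite mulr_ge0// divr_ge0// exprn_ge0// ltW.
(* The square of the error is at most [8 * c * F] times the squared rate, and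
   [8 * c * F <= (F + 2 * c) ^+ 2]; this choice avoids a square root. *)
exists (F + 2 * c), rho; split => // t.
exists (fun m => Int (fun x => f x * H (B m t) x)) => N s srho.
pose rem xi := cas xi (t + s) - \sum_(m < N) cas_coeff m xi t * s ^+ m.
have mrem : msr rem.
  apply: measurable_funB; first exact: msr_casr.
  by apply: measurable_sum => m; apply: measurable_funM => //; exact: msr_cas_coeff.
pose tau := (`|s| / rho) ^+ N.
have tau0 : 0 <= tau by rewrite exprn_ge0// divr_ge0// ltW.
have rem_le xi : `|xi| < c -> `|rem xi| <= 2 * tau.
  move=> xc; rewrite (le_trans (cas_taylor _ _ _ _))// ler_wpM2l//.
  apply: (@le_trans _ _ (`|2 * pi * xi * s| ^+ N)).
    rewrite ler_pdivrMr ?ltr0n ?fact_gt0// ler_peMr ?exprn_ge0//.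
    by rewrite ler1n fact_gt0.
  rewrite /tau lerXn2r ?nnegrE//; first by rewrite divr_ge0// ltW.
  by rewrite /rho invrK normrM mulrC ler_wpM2l// pxc.
have t20 : 0 <= 2 * tau by rewrite mulr_ge0.
have [bR Rle] := AgB rem (2 * tau) mrem rem_le t20.
have E : voice A f (t + s) - \sum_(m < N) Int (fun x => f x * H (B m t) x) * s ^+ m =
    Int (fun x => f x * H (fun xi => A xi * rem xi) x).
  have fHi m : intg (fun x => f x * H (B m t) x) by apply: l2_mul => //; exact: l2H.
  pose G1 (m : 'I_N) x := s ^+ m * (f x * H (B m t) x).
  have G1i m : intg (G1 m) by exact: intgZ.
  have -> : \sum_(m < N) Int (fun x => f x * H (B m t) x) * s ^+ m = Int (fun x => \sum_(m < N) G1 m x).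
    by rewrite Int_sum//; apply: eq_bigr => m _; rewrite IntZ// mulrC.
  have vi : intg (fun x => f x * H A (x - (t + s))).
    by apply: l2_mul => //; exact: hartley_generator_l2.
  rewrite /voice -IntB//; last exact: intg_sum.
  apply: eq_Rintegral => x _.
  have Bki m : intg (fun xi => B m t xi * cas xi x) by apply: intg_cas; exact: bcs_intg.
  pose G2 (m : 'I_N) xi := s ^+ m * (B m t xi * cas xi x).
  have G2i m : intg (G2 m) by exact: intgZ.
  have -> : \sum_(m < N) G1 m x = f x * Int (fun xi => \sum_(m < N) G2 m xi).
    rewrite Int_sum// mulr_sumr; apply: eq_bigr => m _.
    by rewrite IntZ// /G1 -/(H (B m t) x) mulrCA.
  rewrite -mulrBr; congr (_ * _).
  rewrite -(hartley_shift_cas _ _ Ai Ae) -IntB; last 2 first.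
  - by apply: intg_cas; apply: (intgMb Ai (msr_cas x)) => xi; exact: cas_max.
  - exact: intg_sum.
  apply: eq_Rintegral => xi _; rewrite /rem [cas x xi]casC mulrBr mulrBl mulr_sumr mulr_suml.
  congr (_ - _); first by rewrite mulrAC.
  by apply: eq_bigr => m _; rewrite /G2 /B; ring.
rewrite E -/tau.
have K0 : 0 <= (F + 2 * c) * tau by rewrite mulr_ge0// addr_ge0// mulr_ge0// ltW.
rewrite -ler_sqr ?nnegrE// real_normK ?num_real//.
rewrite (le_trans (Cauchy_Schwarz lf (l2H _ bR)))// (plancherel bR).2 -/F.
(* The square of [2 * tau] times the length [2 * c] of the band. *)
have X8 : Int (fun xi => (A xi * rem xi) ^+ 2) <= 8 * c * tau ^+ 2.
  have -> : 8 * c * tau ^+ 2 = Int (fun xi => (2 * tau) ^+ 2 * box c xi).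
    rewrite IntZ; last exact: intg_box.
    have c20 : 0 < (2 * c)^-1 by rewrite invr_gt0 mulr_gt0.
    have := Int_box_period c20; rewrite (_ : (2 * (2 * c)^-1)^-1 = c); last by field; rewrite gt_eqF.
    by move=> ->; field; rewrite gt_eqF.
  apply: le_Int; [exact: bcs_sqr_intg|by apply: intgZ; exact: intg_box|].
  move=> xi; rewrite -real_normK ?num_real//.
  have -> : box c xi = box c xi ^+ 2.
    by rewrite boxE; case: (leP `|xi| c) => _; rewrite ?expr1n ?expr0n.
  by rewrite -exprMn lerXn2r ?nnegrE ?mulr_ge0 ?box_ge0.
rewrite (le_trans (ler_wpM2l F0 X8))// exprMn mulrA ler_wpM2r ?sqr_ge0//.
by have := sqr_ge0 (F - 2 * c); nra.
Qed.

Lemma voice_product_zero_either u v : l2 u -> l2 v ->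
  (forall t, voice A u t * voice A v t = 0) ->
  (forall t, voice A u t = 0) \/ (forall t, voice A v t = 0).
Proof.
move=> lu lv uv0.
have [[t0 ut0]|nu] := pselect (exists t, voice A u t != 0); last first.
  by left => t; apply/eqP; apply: contra_notT nu => h; exists t.
right; have cu := uniformly_analytic_continuous (voice_analytic lu).
have [d /= d0 hd] : \forall z \near t0, voice A u z != 0.
  exact: (cvgr_neq0 (voice A u t0) (cu t0) ut0).
apply: (uniformly_analytic_zero (t := t0) (voice_analytic lv) d0) => s sd.
have := uv0 (t0 + s) => /eqP; rewrite mulf_eq0 => /orP[|/eqP//].
have /negbTE -> // : voice A u (t0 + s) != 0.
by apply: hd; rewrite /= opprD addrA subrr sub0r normrN.
Qed.

End generator.

(** * Systems made of overlapping voices *)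

Section wavelet_levels.
Context {R : realType}.
Local Notation mu := (@lebesgue_measure R).
Local Notation Int := (Rintegral mu setT).
Local Notation H := hartley.
Implicit Types (f g u v : R -> R) (t x xi : R).

(* Level [n] consists of the translates by [al n * k + b n] of [w n] times the
   transform of [B n]. *)
Record levels (alpha : R) (B : nat -> R -> R) (c al b w : nat -> R) : Prop := Levels {
  level_c : forall n, 0 < c n;
  level_al : forall n, 0 < al n;
  level_cal : forall n, 4 * c n * al n <= 1;
  level_w : forall n, w n ^+ 2 / al n = alpha^-1;
  level_generator : forall n, generator (c n) (B n);
  level_le1 : forall N xi, \sum_(n < N) B n xi ^+ 2 <= 1;
  level_cvg1 : forall xi, \sum_(n < N) B n xi ^+ 2 @[N --> \oo] --> (1 : R);
  level_hartley : forall n, intg (H (B n));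
  level_overlap : forall n, exists xi, B n xi * B n.+1 xi != 0
}.

Variables (alpha : R) (B : nat -> R -> R) (c al b w : nat -> R).
Hypotheses (alpha0 : 0 < alpha) (lv : levels alpha B c al b w).

Let c0 := level_c lv.
Let al0 := level_al lv.
Let cal := level_cal lv.
Let wal := level_w lv.
Let gen := level_generator lv.

Let ialpha : 0 < alpha^-1. Proof. by rewrite invr_gt0. Qed.

Lemma level_w_neq0 n : w n != 0.
Proof.
by apply/eqP => w0; have := wal n; rewrite w0 expr0n mul0r => /eqP; rewrite lt_eqF.
Qed.

Definition coef f (p : nat * int) : R := w p.1 * voice (B p.1) f (al p.1 * p.2%:~R + b p.1).

(** The part of the spectral energy of [u] seen by level [n]; since the squared generators add up to
    1, these parts add up to the energy of [u]. *)
Let E n u := Int (fun xi => B n xi ^+ 2 * H u xi ^+ 2).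

Let E_intg n u : bcs u -> intg (fun xi => B n xi ^+ 2 * H u xi ^+ 2).
Proof.
move=> ub; have := bcs_sqr_intg (band_limited_bcs (voice_band_limited (gen n) ub)).
by under eq_fun do rewrite exprMn.
Qed.

Let E_sum N u : bcs u -> \sum_(n < N) E n u =
  Int (fun xi => (\sum_(n < N) B n xi ^+ 2) * H u xi ^+ 2).
Proof.
move=> ub; rewrite -(Int_sum _ (F := fun (n : 'I_N) xi => B n xi ^+ 2 * H u xi ^+ 2)).
  by apply: eq_Rintegral => xi _; rewrite mulr_suml.
by move=> n; exact: E_intg.
Qed.

Let sum_intg N u : bcs u -> intg (fun xi => (\sum_(n < N) B n xi ^+ 2) * H u xi ^+ 2).
Proof.
move=> ub.
have := intg_sum (index_enum _) (F := fun (n : 'I_N) xi => B n xi ^+ 2 * H u xi ^+ 2)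
  (fun n => E_intg n ub).
by under eq_fun do rewrite -mulr_suml.
Qed.

Let E_le N u : bcs u -> \sum_(n < N) E n u <= Int (fun x => u x ^+ 2).
Proof.
move=> ub; have [hi <-] := plancherel ub; rewrite E_sum//.
apply: le_Int => // [|xi]; first exact: sum_intg.
by rewrite ler_piMl ?sqr_ge0//; exact: level_le1 lv _ _.
Qed.

Let E_cvg u : bcs u -> \sum_(n < N) E n u @[N --> \oo] --> Int (fun x => u x ^+ 2).
Proof.
move=> ub; have [hi <-] := plancherel ub; under eq_fun do rewrite E_sum//.
have [||||_ lim] := @Int_dct _ (fun N xi => (\sum_(n < N) B n xi ^+ 2) * H u xi ^+ 2)
  (fun xi => H u xi ^+ 2) (fun xi => H u xi ^+ 2); last exact: lim.
- by move=> N; apply: intg_msr; exact: sum_intg.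
- exact: hi.
- move=> N xi; rewrite ger0_norm; last first.
    by rewrite mulr_ge0 ?sqr_ge0// sumr_ge0// => n _; exact: sqr_ge0.
  by rewrite ler_piMl ?sqr_ge0//; exact: level_le1 lv _ _.
- move=> xi; rewrite -[X in _ --> X]mul1r; apply: cvgM; last exact: cvg_cst.
  exact: level_cvg1 lv _.
Qed.

Let level_sums u n (s : seq int) : bcs u -> uniq s ->
  \sum_(k <- s) coef u (n, k) ^+ 2 <= E n u / alpha.
Proof.
move=> ub us; under eq_bigr do rewrite /coef/= exprMn.
rewrite -mulr_sumr -(wal n) mulrCA ler_wpM2l ?sqr_ge0//.
exact: (voice_sums_le (c0 n) (gen n) (b n) (al0 n) (cal n) ub us).
Qed.

(** With [level_sums], this is Parseval on one level in terms of finite sums: [E n u / alpha] is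
    their least upper bound. *)
Let level_sums_sup u n (r : R) : bcs u ->
  (forall s : seq int, uniq s -> \sum_(k <- s) coef u (n, k) ^+ 2 <= r) -> E n u / alpha <= r.
Proof.
move=> ub sr; rewrite -(wal n).
have lim : w n ^+ 2 * avg N (fun k => voice (B n) u (al n * k%:~R + b n) ^+ 2) @[N --> \oo] -->
    w n ^+ 2 * (E n u / al n).
  apply: cvgM; first exact: cvg_cst.
  exact: (voice_avg_cvg (c0 n) (gen n) (b n) (al0 n) (cal n) ub).
rewrite mulrCA; apply: (ler_cvg_to lim (cvg_cst _)); apply: nearW => N.
rewrite -avgZ; apply: avg_le_of_sums => s /sr; apply: le_trans.
by under [leRHS]eq_bigr do rewrite /coef/= exprMn.
Qed.

Lemma coef_sums_bcs u (s : seq (nat * int)) : bcs u -> uniq s ->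
  \sum_(p <- s) coef u p ^+ 2 <= Int (fun x => u x ^+ 2) / alpha.
Proof.
move=> ub us.
pose N := (\max_(p <- s) p.1).+1.
have sN p : p \in s -> (p.1 < N)%N.
  by move=> ps; rewrite ltnS; exact: (@leq_bigmax_seq _ s predT (fun p : nat * int => p.1)).
apply: le_trans (ler_wpM2r (ltW ialpha) (E_le N ub)).
have -> : \sum_(p <- s) coef u p ^+ 2 =
    \sum_(n < N) \sum_(p <- s | p.1 == nat_of_ord n) coef u p ^+ 2.
  rewrite (exchange_big_dep predT)//= big_seq [RHS]big_seq; apply: eq_bigr => p ps.
  by rewrite (big_pred1 (Ordinal (sN p ps)))// => n; rewrite -val_eqE eq_sym.
rewrite mulr_suml; apply: ler_sum => n _.
have -> : \sum_(p <- s | p.1 == nat_of_ord n) coef u p ^+ 2 =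
    \sum_(k <- [seq p.2 | p <- s & p.1 == nat_of_ord n]) coef u (nat_of_ord n, k) ^+ 2.
  rewrite big_map big_filter; apply: eq_bigr => -[m k] /= /eqP -> //.
apply: level_sums => //; rewrite map_inj_in_uniq ?filter_uniq// => -[m k] [m' k'].
by rewrite !mem_filter/= => /andP[/eqP -> _] /andP[/eqP -> _] ->.
Qed.

Lemma coef_trunc_cvg f p : l2 f -> coef (trunc n f) p @[n --> \oo] --> coef f p.
Proof.
move=> lf; rewrite /coef; apply: cvgM; first exact: cvg_cst.
apply: (trunc_voice_cvg (gen p.1) lf).
Qed.

Lemma coef_sums_le f (s : seq (nat * int)) : l2 f -> uniq s ->
  \sum_(p <- s) coef f p ^+ 2 <= Int (fun x => f x ^+ 2) / alpha.
Proof.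
move=> lf us.
have lim : \sum_(p <- s) coef (trunc n f) p ^+ 2 @[n --> \oo] --> \sum_(p <- s) coef f p ^+ 2.
  elim: s {us} => [|p s ih].
    by under eq_fun do rewrite big_nil; rewrite big_nil; exact: cvg_cst.
  under eq_fun do rewrite big_cons; rewrite big_cons; apply: cvgD => //.
  under eq_fun do rewrite expr2; rewrite expr2.
  by apply: cvgM; exact: coef_trunc_cvg.
apply: (ler_cvg_to lim (cvg_cst _)); apply: nearW => n.
rewrite (le_trans (coef_sums_bcs (trunc_bcs n lf.1) us))// ler_pM2r//.
exact: trunc_sqr_le.
Qed.

Lemma coefB f g p : l2 f -> l2 g -> coef (fun x => f x - g x) p = coef f p - coef g p.
Proof. by move=> lf lg; rewrite /coef (voiceB (gen p.1))// mulrBr. Qed.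

Lemma energy_bcs_le u (r : R) : bcs u ->
  (forall s : seq (nat * int), uniq s -> \sum_(p <- s) coef u p ^+ 2 <= r) ->
  Int (fun x => u x ^+ 2) / alpha <= r.
Proof.
move=> ub sr.
(* The levels below [N] are replaced one at a time by their full energy; the free [s] in the higher
   levels leaves room for the finite sums of level [N] in the next step. *)
have step N : forall s : seq (nat * int), uniq s -> all (fun p => N <= p.1)%N s ->
    \sum_(p <- s) coef u p ^+ 2 + (\sum_(n < N) E n u) / alpha <= r.
  elim: N => [s us _|N ih s us sN]; first by rewrite big_ord0 mul0r addr0 sr.
  rewrite big_ord_recr/= mulrDl addrA -lerBrDl; apply: level_sums_sup => // t ut.
  rewrite lerBrDl addrAC.
  have := ih (s ++ [seq (N, k) | k <- t]); rewrite big_cat big_map; apply.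
    rewrite cat_uniq us/= map_inj_uniq ?ut ?andbT; last by move=> ? ? [].
    apply/hasPn => _ /mapP[k _ ->]; apply/negP => /(allP sN).
    by rewrite /= ltnn.
  rewrite all_cat; apply/andP; split; first by apply: sub_all sN => p /ltnW.
  by rewrite all_map; apply/allP => k _ /=.
have lim : (\sum_(n < N) E n u) / alpha @[N --> \oo] --> Int (fun x => u x ^+ 2) / alpha.
  by apply: cvgM; [exact: E_cvg|exact: cvg_cst].
apply: (ler_cvg_to lim (cvg_cst _)); apply: nearW => N.
by have := step N [::] isT isT; rewrite big_nil add0r.
Qed.

(** The factor 2 comes from [z ^ 2 <= 2 y ^ 2 + 2 (y - z) ^ 2], comparing the coefficients [y] of
    [f] and [z] of its truncation; the upper bound applied to the truncation error makes the last
    term vanish in the limit. *)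
Lemma energy_le f (r : R) : l2 f ->
  (forall s : seq (nat * int), uniq s -> \sum_(p <- s) coef f p ^+ 2 <= r) ->
  Int (fun x => f x ^+ 2) / alpha <= 2 * r.
Proof.
move=> lf sr.
pose d n := Int (fun x => (f x - trunc n f x) ^+ 2).
have l1 : Int (fun x => trunc n f x ^+ 2) / alpha @[n --> \oo] --> Int (fun x => f x ^+ 2) / alpha.
  apply: cvgM; last exact: cvg_cst.
  have [||||_ lim] := @Int_dct _ (fun n x => trunc n f x ^+ 2) (fun x => f x ^+ 2)
    (fun x => f x ^+ 2); last exact: lim.
  - by move=> n; apply: measurable_funX; exact: (trunc_bcs n lf.1).1.
  - exact: lf.2.
  - move=> n x; rewrite normrX -[leRHS]real_normK ?num_real// lerXn2r ?nnegrE//.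
    exact: (trunc_sub n f x).2.
  - move=> x; under eq_fun do rewrite expr2; rewrite expr2.
    by apply: cvgM; exact: trunc_cvg.
have l2' : 2 * r + 2 * (d n / alpha) @[n --> \oo] --> 2 * r + 2 * (0 / alpha).
  apply: cvgD; first exact: cvg_cst.
  apply: cvgM; first exact: cvg_cst.
  by apply: cvgM; [exact: trunc_l2_cvg|exact: cvg_cst].
rewrite mul0r mulr0 addr0 in l2'.
apply: (ler_cvg_to l1 l2'); apply: nearW => n.
have ub := trunc_bcs n lf.1; have lu := bcs_l2 ub.
apply: energy_bcs_le => // s us.
have h1 := sr s us; have h2 := coef_sums_le (l2B lf lu) us.
apply: (@le_trans _ _ (2 * \sum_(p <- s) coef f p ^+ 2 +
    2 * \sum_(p <- s) coef (fun x => f x - trunc n f x) p ^+ 2)).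
  rewrite !mulr_sumr -big_split/=; apply: ler_sum => p _; rewrite coefB//.
  move: (coef f p) (coef (trunc n f) p) => y z.
  by have := sqr_ge0 (2 * y - z); nra.
by apply: lerD; rewrite ler_pM2l.
Qed.

Lemma coef_eq0 f : l2 f -> (forall p, coef f p = 0) -> {ae mu, forall x, f x = 0}.
Proof.
move=> lf f0.
have : Int (fun x => f x ^+ 2) / alpha <= 2 * 0.
  apply: energy_le => // s _; rewrite big1// => p _; by rewrite f0 expr0n.
rewrite mulr0 pmulr_lle0// => e.
have e0 : Int (fun x => `|f x ^+ 2|) = 0.
  transitivity (Int (fun x => f x ^+ 2)).
    by apply: eq_Rintegral => x _; rewrite ger0_norm ?sqr_ge0.
  by apply/eqP; rewrite eq_le e Int_sqr_ge0.
have := Int_ae0 lf.2 e0; apply: ae_impl => x /eqP; by rewrite sqrf_eq0 => /eqP.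
Qed.

End wavelet_levels.

(** * Comparison of signs on adjacent levels *)

Section uniqueness.
Context {R : realType}.
Local Notation mu := (@lebesgue_measure R).
Local Notation Int := (Rintegral mu setT).
Local Notation H := hartley.
Implicit Types (f g h u v : R -> R) (t x xi s : R).

Lemma hartley_even (A : R -> R) xi : intg A -> (forall x, A (- x) = A x) ->
  H A (- xi) = H A xi.
Proof.
move=> Ai Ae; have [_ e] := Int_opp (intg_cas xi Ai).
rewrite [RHS]/hartley -e /hartley; apply: eq_Rintegral => x _.
by rewrite Ae /cas mulrN mulNr.
Qed.

Lemma continuous_Int_sqr_eq0 (q : R -> R) : continuous q -> intg (fun x => q x ^+ 2) ->
  Int (fun x => q x ^+ 2) = 0 -> forall x, q x = 0.
Proof.
move=> cq qi q0 x0; apply/eqP/negPn/negP => qx0.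
have c2 : q x ^+ 2 @[x --> x0] --> q x0 ^+ 2.
  by under eq_fun do rewrite expr2; rewrite expr2; apply: cvgM; exact: cq.
have q2 : 0 < q x0 ^+ 2 by rewrite exprn_even_gt0.
have [d /= d0 hd] : \forall z \near x0, q x0 ^+ 2 / 2 < q z ^+ 2.
  by apply: (cvgr_gt (q x0 ^+ 2) c2); rewrite ltr_pdivrMr//; lra.
pose r := d / 2; have r0 : 0 < r by rewrite divr_gt0.
have bi : intg (fun x => q x0 ^+ 2 / 2 * box r (x - x0)).
  by apply: intgZ; exact: (Int_shift (- x0) (intg_box r)).1.
have : Int (fun x => q x0 ^+ 2 / 2 * box r (x - x0)) <= Int (fun x => q x ^+ 2).
  apply: le_Int => // x; rewrite boxE; case: (leP `|x - x0| r) => [xr|_].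
    rewrite mulr1 ltW//; apply: hd; rewrite /= distrC (le_lt_trans xr)//.
    by rewrite ltr_pdivrMr//; lra.
  by rewrite mulr0 sqr_ge0.
rewrite IntZ; last exact: (Int_shift (- x0) (intg_box r)).1.
have [_ ->] := Int_shift (- x0) (intg_box r).
have r20 : 0 < (2 * r)^-1 by rewrite invr_gt0 mulr_gt0.
have := Int_box_period r20; rewrite (_ : (2 * (2 * r)^-1)^-1 = r); last first.
  by field; rewrite gt_eqF.
move=> ->; rewrite invrK q0 leNgt => /negP; apply.
by apply: mulr_gt0; [exact: divr_gt0|exact: mulr_gt0].
Qed.

Lemma exp_decaying_intg f a : 0 < a -> msr f ->
  (\int[mu]_x (`|f x| * expR (a * `|x|))%:E < +oo)%E ->
  intg (fun x => `|f x| * expR (a * `|x|)).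
Proof.
move=> a0 mf fa; apply/integrableP; split.
  apply/measurable_EFinP; apply: measurable_funM.
    exact: measurableT_comp.
  apply: measurableT_comp; first exact: measurable_expR.
  by apply: measurable_funM => //; exact: measurableT_comp.
under eq_integral => x _ do rewrite gee0_abs ?lee_fin ?mulr_ge0 ?expR_ge0//.
exact: fa.
Qed.

(** With [rho = a / (2 pi)], the Taylor remainder of [cas] is [(|s| / rho) ^ N] times
    [(a |x|) ^ N / N!], and the last factor is below [expR (a * |x|)]. *)
Lemma hartley_analytic f a : 0 < a -> msr f ->
  intg (fun x => `|f x| * expR (a * `|x|)) -> intg f /\ uniformly_analytic (H f).
Proof.
move=> a0 mf fai; pose M := Int (fun x => `|f x| * expR (a * `|x|)).
have fi : intg f.
  apply: (intg_le mf fai) => x; rewrite ler_peMr// -expR0 ler_expR.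
  by rewrite mulr_ge0// ltW.
split => //.
have pp : 0 < 2 * pi :> R by rewrite mulr_gt0// pi_gt0.
pose rho := a / (2 * pi); have rho0 : 0 < rho by rewrite divr_gt0.
have key N x s : `|2 * pi * x * s| ^+ N / N`!%:R <= (`|s| / rho) ^+ N * expR (a * `|x|).
  have -> : `|2 * pi * x * s| = `|s| / rho * (a * `|x|).
    rewrite (normrM (2 * pi * x)) (normrM (2 * pi)) (gtr0_norm pp) /rho.
    move: (2 * pi) pp => p p0; field.
    by rewrite !gt_eqF.
  have sr0 : 0 <= `|s| / rho by exact: divr_ge0 (ltW rho0).
  rewrite exprMn -mulrA ler_wpM2l ?(exprn_ge0 _ sr0)//.
  by apply: expR_ge_monomial; rewrite mulr_ge0 ?(ltW a0).
have ci m t : intg (fun x => f x * cas_coeff m x t).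
  apply: (intg_le _ (intgZ (2 * (1 / rho) ^+ m) fai)).
    by apply: measurable_funM => //; exact: msr_cas_coeff.
  move=> x; rewrite normrM mulrCA ler_wpM2l// -mulrA (le_trans (cas_coeff_le _ _ _))//.
  by rewrite ler_pM2l//; have := key m x 1; rewrite mulr1 normr1.
exists (2 * M), rho; split => // t.
exists (fun m => Int (fun x => f x * cas_coeff m x t)) => N s srho.
pose G (m : 'I_N) x := s ^+ m * (f x * cas_coeff m x t).
have Gi m : intg (G m) by exact: intgZ.
have -> : H f (t + s) - \sum_(m < N) Int (fun x => f x * cas_coeff m x t) * s ^+ m =
    Int (fun x => f x * (cas x (t + s) - \sum_(m < N) cas_coeff m x t * s ^+ m)).
  have -> : \sum_(m < N) Int (fun x => f x * cas_coeff m x t) * s ^+ m =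
      Int (fun x => \sum_(m < N) G m x).
    by rewrite Int_sum//; apply: eq_bigr => m _; rewrite IntZ// mulrC.
  rewrite /hartley -IntB; [|exact: intg_cas|exact: intg_sum].
  apply: eq_Rintegral => x _; rewrite mulrBr mulr_sumr; congr (_ - _).
  by apply: eq_bigr => m _; rewrite /G; ring.
have -> : 2 * M * (`|s| / rho) ^+ N =
    Int (fun x => 2 * (`|s| / rho) ^+ N * (`|f x| * expR (a * `|x|))).
  by rewrite IntZ// mulrAC.
apply: Int_abs_le; last 1 first.
- move=> x; rewrite normrM mulrCA ler_wpM2l// (le_trans (cas_taylor _ _ _ _))//.
  by rewrite -[leRHS]mulrA ler_pM2l.
- apply: measurable_funM => //; apply: measurable_funB; first exact: msr_casr.
  by apply: measurable_sum => m; apply: measurable_funM => //; exact: msr_cas_coeff.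
- exact: intgZ.
Qed.

Lemma generatorM c1 c2 (A1 A2 : R -> R) : generator c1 A1 -> generator c2 A2 ->
  generator c1 (fun x => A1 x * A2 x).
Proof.
move=> [cA1 eA1 bA1 zA1] [cA2 eA2 bA2 zA2]; split.
- by move=> x; apply: cvgM; [exact: cA1|exact: cA2].
- by move=> x; rewrite eA1 eA2.
- by move=> x; rewrite normrM mulr_ile1.
- by move=> x /zA1 ->; rewrite mul0r.
Qed.

(* The transform of [A1 * A2] is the convolution of those of [A1] and [A2]. *)
Lemma voiceM_eq0 c1 c2 (A1 A2 : R -> R) u : generator c1 A1 -> generator c2 A2 ->
  intg (H A2) -> l2 u -> (forall t, voice A1 u t = 0) ->
  forall s, voice (fun x => A1 x * A2 x) u s = 0.
Proof.
move=> g1 g2 HA2 lu v0 s.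
have b1 := generator_bcs g1; have b2 := generator_bcs g2.
have i1 := bcs_intg b1; have i2 := bcs_intg b2.
have [cA1 e1 le1 _] := g1.
have E t : H (fun x => A1 x * A2 x) t = Int (fun y => H A2 y * H A1 (y - t)).
  rewrite -hartley_convolution//; apply/esym.
  have inv := hartley_inversion i2 HA2 (fun xi => erefl).
  have [|||_ e] := @Int_ae _ (fun x => A1 x * A2 x * cas x t)
    (fun x => A1 x * H (H A2) x * cas x t); last exact: esym.
  - by apply: intg_cas; apply: (intgMb i1 b2.1) => x; have [_ _] := g2; exact.
  - apply: measurable_funM; last exact: msr_casr.
    by apply: measurable_funM; [exact: b1.1|exact: msr_hartley].
  - by apply: ae_impl inv => x ->.
have l1 := hartley_generator_l2 g1.
pose F (p : R * R) := u p.1 * H A1 (p.1 - (p.2 + s)) * H A2 p.2.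
pose b y := (Int (fun x => u x ^+ 2) + Int (fun x => H A1 x ^+ 2)) * `|H A2 y|.
have Fi y : intg (fun x => F (x, y)).
  by rewrite /F/=; under eq_fun do rewrite mulrC; apply: intgZ; exact: l2_mul.
have [||||_ _ e] := @Fubini_Int _ F b.
- apply: measurable_funM; first apply: measurable_funM.
  + exact: (measurableT_comp lu.1 measurable_fst).
  + apply: (measurableT_comp (msr_hartley i1)).
    apply: measurable_funB; first exact: measurable_fst.
    by apply: measurable_funD; [exact: measurable_snd|].
  + exact: (measurableT_comp (msr_hartley i2) measurable_snd).
- exact: Fi.
- move=> y; rewrite /b /F/=.
  have lt := l1 (y + s).
  have -> : Int (fun x => H A1 x ^+ 2) = Int (fun x => H A1 (x - (y + s)) ^+ 2).
    by have [_ ->] := Int_shift (- (y + s)) (plancherel b1).1.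
  rewrite -IntD; [|exact: lu.2|exact: lt.2].
  rewrite -IntZr; last by apply: intgD; [exact: lu.2|exact: lt.2].
  apply: le_Int; first by apply: intg_abs; exact: Fi.
    under eq_fun do rewrite mulrC; apply: intgZ.
    by apply: intgD; [exact: lu.2|exact: lt.2].
  move=> x; rewrite (normrM (_ * _)) ler_wpM2r//.
  rewrite (normrM (u x)) -(real_normK (num_real (u x))).
  rewrite -(real_normK (num_real (H A1 (x - (y + s))))).
  have := normr_ge0 (u x); have := normr_ge0 (H A1 (x - (y + s))).
  by move: (`|u x|) (`|_|) => p q; nra.
- by apply: intgZ; exact: intg_abs.
rewrite /voice; transitivity (Int (fun x => Int (fun y => F (x, y)))).
  apply: eq_Rintegral => x _; rewrite E /F/= -IntZ.
    apply: eq_Rintegral => y _; rewrite -mulrA; congr (_ * _); rewrite mulrC; congr (_ * _).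
    by rewrite -(hartley_even _ i1 e1); congr (H A1 _); ring.
  apply: (intgMb HA2).
    by apply: (measurableT_comp (msr_hartley i1)); exact: measurable_funB.
  by move=> y; exact: hartley_le.
rewrite e; transitivity (Int (fun=> 0 : R)); last exact: Int0.
apply: eq_Rintegral => y _; rewrite /F/= IntZr; last exact: l2_mul.
by have := v0 (y + s); rewrite /voice => ->; rewrite mul0r.
Qed.

(** For the multiplier [A1 * A2] both [u1] and [u2] have zero voice, so the transform of
    [A1 * A2 * H g] vanishes. Plancherel gives [H g = 0] on an open set where both generators are
    nonzero, and analyticity and inversion give the rest. *)
Lemma voice_mixed_eq0 c1 c2 (A1 A2 : R -> R) g u1 u2 :
  0 < c1 -> generator c1 A1 -> generator c2 A2 -> intg (H A1) -> intg (H A2) ->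
  (exists xi, A1 xi * A2 xi != 0) -> l2 u1 -> l2 u2 -> (forall x, g x = u1 x + u2 x) ->
  intg g -> uniformly_analytic (H g) ->
  (forall t, voice A1 u1 t = 0) -> (forall t, voice A2 u2 t = 0) ->
  {ae mu, forall x, g x = 0}.
Proof.
move=> c10 g1 g2 HA1 HA2 [xi0 A12] lu1 lu2 gE gi ga v1 v2.
have g12 := generatorM g1 g2; have b12 := generator_bcs g12.
have [c12 e12 _ _] := g12; have i12 := bcs_intg b12.
pose q x := A1 x * A2 x * H g x.
have bq : band_limited c1 q.
  apply: (generator_band_limited g12); first exact: hartley_continuous.
  by exists (2 * Int (fun x => `|g x|)) => x; exact: hartley_le.
have qb := band_limited_bcs bq.
have Hq0 s : H q s = 0.
  rewrite /q [LHS]hartley_convolution//.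
  have l12 := hartley_generator_l2 g12 s.
  transitivity (voice (fun x => A1 x * A2 x) u1 s + voice (fun x => A1 x * A2 x) u2 s).
    rewrite /voice -IntD; [|exact: l2_mul|exact: l2_mul].
    by apply: eq_Rintegral => x _; rewrite gE mulrDl.
  rewrite (voiceM_eq0 g1 g2)// (_ : (fun x => _) = fun x => A2 x * A1 x).
    by rewrite (voiceM_eq0 g2 g1)// addr0.
  by apply/funext => x; rewrite mulrC.
have q0 : forall x, q x = 0.
  apply: continuous_Int_sqr_eq0; [by case: bq|exact: bcs_sqr_intg|].
  have [_ <-] := plancherel qb; transitivity (Int (fun=> 0 : R)); last exact: Int0.
  by apply: eq_Rintegral => x _; rewrite Hq0 expr0n.
have [d /= d0 hd] : \forall z \near xi0, A1 z * A2 z != 0.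
  exact: (cvgr_neq0 (A1 xi0 * A2 xi0) (c12 xi0) A12).
have Hg0 : forall xi, H g xi = 0.
  apply: (uniformly_analytic_zero (t := xi0) ga d0) => s sd.
  have := q0 (xi0 + s) => /eqP; rewrite mulf_eq0 => /orP[|/eqP//].
  have /negbTE -> // : A1 (xi0 + s) * A2 (xi0 + s) != 0.
  by apply: hd; rewrite /= opprD addrA subrr sub0r normrN.
have := hartley_inversion gi (@intg0 R) Hg0; apply: ae_impl => x ->.
rewrite /hartley -[RHS]Int0; apply: eq_Rintegral => xi _; by rewrite mul0r.
Qed.

(* On each level one of [f - h] and [f + h] has a vanishing voice; by
   [voice_mixed_eq0] the choice is the same on adjacent levels unless [f = 0]. *)
Lemma levels_sign_uniqueness alpha (B : nat -> R -> R) (c al b w : nat -> R) f h a :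
  0 < alpha -> levels alpha B c al b w ->
  0 < a -> l2 f -> l2 h -> intg (fun x => `|f x| * expR (a * `|x|)) ->
  (forall p, coef B al b w h p ^+ 2 = coef B al b w f p ^+ 2) ->
  {ae mu, forall x, h x = f x} \/ {ae mu, forall x, h x = - f x}.
Proof.
move=> alpha0 lv a0 lf lh fa fh.
(* The sum is written as a difference so that [l2B] and [voiceB] cover both functions. *)
pose u x := f x - h x; pose v x := f x - - h x.
have lNh : l2 (fun x => - h x).
  by have := l2Z (-1) lh; under eq_fun do rewrite mulN1r.
have lu : l2 u := l2B lf lh.
have lv' : l2 v := l2B lf lNh.
have gen := level_generator lv.
have vN n t : voice (B n) (fun x => - h x) t = - voice (B n) h t.
  rewrite /voice -[RHS]mulN1r -IntZ; last by apply: l2_mul => //; exact: (hartley_generator_l2 (gen n)).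
  by apply: eq_Rintegral => x _; ring.
have either n : (forall t, voice (B n) u t = 0) \/ (forall t, voice (B n) v t = 0).
  apply: (voice_product_zero_either (level_c lv n) (gen n)) => // t.
  apply: (voice_product_zero (level_c lv n) (gen n) (level_al lv n) (level_cal lv n) (b := b n)) => // k.
  rewrite !(voiceB (gen n))// vN opprK.
  have := fh (n, k); rewrite /coef/= !exprMn.
  have w2 : w n ^+ 2 != 0 by rewrite sqrf_eq0 (level_w_neq0 alpha0 lv).
  by move=> /(mulfI w2) e; rewrite -subr_sqr e subrr.
have [fi fan] := hartley_analytic a0 lf.1 fa.
have f2a : 0 < a -> uniformly_analytic (H (fun x => 2 * f x)) /\ intg (fun x => 2 * f x).
  move=> _; have fa2 : intg (fun x => `|2 * f x| * expR (a * `|x|)).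
    by under eq_fun do rewrite normrM -mulrA; exact: intgZ.
  by have [] := hartley_analytic a0 (l2Z 2 lf).1 fa2.
have [ga gi] := f2a a0.
(* If [f] vanishes, so do all coefficients of [h], and then [h] itself by completeness; either sign
   will do. *)
have mixed : {ae mu, forall x, 2 * f x = 0} ->
    {ae mu, forall x, h x = f x} \/ {ae mu, forall x, h x = - f x}.
  move=> f20.
  have f0 : {ae mu, forall x, f x = 0}.
    by apply: ae_impl f20 => x /eqP; rewrite mulf_eq0 pnatr_eq0/= => /eqP.
  left; have h0 : {ae mu, forall x, h x = 0}.
    apply: (coef_eq0 alpha0 lv lh) => p; apply/eqP; rewrite -sqrf_eq0 fh sqrf_eq0.
    rewrite /coef mulf_eq0; apply/orP; right; apply/eqP; rewrite /voice -[RHS]Int0.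
    have lG := hartley_generator_l2 (gen p.1) (al p.1 * p.2%:~R + b p.1).
    have [||_ ->//] := Int_ae (l2_mul lf lG) (g := fun=> 0).
      exact: measurable_cst.
    by apply: ae_impl f0 => x ->; rewrite mul0r.
  by apply: ae_impl2 f0 h0 => x -> ->.
have [[n hn]|nomix] := pselect (exists n,
    ((forall t, voice (B n) u t = 0) /\ (forall t, voice (B n.+1) v t = 0)) \/
    ((forall t, voice (B n) v t = 0) /\ (forall t, voice (B n.+1) u t = 0))).
  apply: mixed; have := level_hartley lv => Hi.
  case: hn => -[h1 h2].
    apply: (voice_mixed_eq0 (level_c lv n) (gen n) (gen n.+1) (Hi n) (Hi n.+1)
      (level_overlap lv n) lu lv' _ gi ga h1 h2) => x; rewrite /u /v; ring.
  apply: (voice_mixed_eq0 (level_c lv n) (gen n) (gen n.+1) (Hi n) (Hi n.+1)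
      (level_overlap lv n) lv' lu _ gi ga h1 h2) => x; rewrite /u /v; ring.
have [u0|v0] := either 0.
  left; have un n : forall t, voice (B n) u t = 0.
    elim: n => // n ih; have [//|hv] := either n.+1.
    by exfalso; apply: nomix; exists n; left.
  have ae0 : {ae mu, forall x, u x = 0}.
    by apply: (coef_eq0 alpha0 lv lu) => p; rewrite /coef un mulr0.
  by apply: ae_impl ae0 => x /eqP; rewrite subr_eq0 => /eqP.
right; have vn n : forall t, voice (B n) v t = 0.
  elim: n => // n ih; have [hu|//] := either n.+1.
  by exfalso; apply: nomix; exists n; right.
have ae0 : {ae mu, forall x, v x = 0}.
    by apply: (coef_eq0 alpha0 lv lv') => p; rewrite /coef vn mulr0.
by apply: ae_impl ae0 => x /eqP; rewrite subr_eq0 => /eqP ->; rewrite opprK.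
Qed.

End uniqueness.

(** * The Meyer system *)

Section meyer.
Context {R : realType}.
Local Notation mu := (@lebesgue_measure R).
Local Notation Int := (Rintegral mu setT).
Local Notation H := hartley.
Implicit Types (f g : R -> R) (t x xi s : R).

Section profile.
Variable beta : R -> R.
Hypothesis profile : meyer_profile beta.

Let beta0 x : x <= 0 -> beta x = 0. Proof. by have [_ + _ _] := profile; exact. Qed.
Let beta1 x : 1 <= x -> beta x = 1. Proof. by have [_ _ + _] := profile; exact. Qed.

Let beta_half : beta (1 / 2) = 1 / 2.
Proof.
have [_ _ _ h] := profile.
have e : 1 - 1 / 2 = 1 / 2 :> R by field.
have : 0 <= (1 / 2 : R) <= 1 by lra.
by move=> /h; rewrite e => b2; lra.
Qed.

Let cbeta : continuous beta.
Proof.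
have [sm _ _ _] := profile => x.
by have := sm 0 x => /derivable1_diffP/differentiable_continuous.
Qed.

(* Since [beta] is constant outside [0, 1], the single formulas below cover all
   cases of [phi_hat] and, up to the factor [expi (pi * xi)], of [psi_hat]. *)
Definition meyer_low xi : R := cos (pi / 2 * beta (3 * `|xi| - 1)).

Definition meyer_band xi : R :=
  sin (pi / 2 * beta (3 * `|xi| - 1)) * cos (pi / 2 * beta (3 * `|xi| / 2 - 1)).

Let c_angle (a : R) : continuous (fun xi => pi / 2 * beta (a * `|xi| - 1)).
Proof.
move=> x; apply: cvgM; first exact: cvg_cst.
apply: (@cvg_comp _ _ _ (fun xi : R => a * `|xi| - 1) beta); last exact: cbeta.
by apply: cvgB; [apply: cvgM; [exact: cvg_cst|exact: norm_continuous]|exact: cvg_cst].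
Qed.

Let low0 xi : 2 / 3 <= `|xi| -> meyer_low xi = 0.
Proof. by move=> h; rewrite /meyer_low beta1 ?mulr1 ?cos_pihalf//; lra. Qed.

Let low1 xi : `|xi| <= 1 / 3 -> meyer_low xi = 1.
Proof. by move=> h; rewrite /meyer_low beta0 ?mulr0 ?cos0//; lra. Qed.

(** The support already lies in [[-2/3, 2/3]]. The band of [meyer_band] is used because the scaling
    functions are sampled with the same step as the wavelets at scale 1. *)
Lemma meyer_low_generator : generator (4 / 3) meyer_low.
Proof.
split.
- move=> x; apply: (continuous_comp (f := fun xi => pi / 2 * beta (3 * `|xi| - 1))).
    exact: c_angle.
  exact: continuous_cos.
- by move=> x; rewrite /meyer_low normrN.
- by move=> x; rewrite /meyer_low cos_max.
- by move=> x h; apply: low0; lra.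
Qed.

Lemma meyer_band_generator : generator (4 / 3) meyer_band.
Proof.
split.
- move=> x; apply: cvgM.
    apply: (continuous_comp (f := fun xi => pi / 2 * beta (3 * `|xi| - 1))).
      exact: c_angle.
    exact: continuous_sin.
  apply: (continuous_comp (f := fun xi => pi / 2 * beta (3 * `|xi| / 2 - 1))).
    have -> : (fun xi => pi / 2 * beta (3 * `|xi| / 2 - 1)) =
        (fun xi => pi / 2 * beta (3 / 2 * `|xi| - 1)).
      by apply/funext => z; congr (_ * beta (_ - _)); rewrite mulrAC.
    exact: c_angle.
  exact: continuous_cos.
- by move=> x; rewrite /meyer_band normrN.
- by move=> x; rewrite /meyer_band normrM mulr_ile1// ?sin_max ?cos_max.
- move=> x h; rewrite /meyer_band [X in cos (_ * X)]beta1 ?mulr1 ?cos_pihalf ?mulr0//.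
  by lra.
Qed.

(** Up to [|xi| = 2/3] the cosine factor of the band is 1 and this is [cos ^ 2 + sin ^ 2 = 1];
    beyond, [meyer_low xi] is 0 and the sine factor is 1. *)
Lemma meyer_telescope xi : meyer_low (xi / 2) ^+ 2 = meyer_low xi ^+ 2 + meyer_band xi ^+ 2.
Proof.
have -> : meyer_low (xi / 2) = cos (pi / 2 * beta (3 * `|xi| / 2 - 1)).
  by rewrite /meyer_low normrM (@gtr0_norm _ 2^-1) ?invr_gt0// mulrA.
rewrite /meyer_low /meyer_band exprMn.
have := leP `|xi| (2 / 3) => -[h|h].
  rewrite [beta (3 * `|xi| / 2 - 1)]beta0; last lra.
  by rewrite mulr0 cos0 expr1n mulr1 cos2Dsin2.
rewrite [beta (3 * `|xi| - 1)]beta1; last lra.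
by rewrite mulr1 cos_pihalf sin_pihalf expr0n expr1n mul1r add0r.
Qed.

(** At 1/2 the argument of [beta] is 1/2, where symmetry forces the value 1/2: both generators are
    taken at the angle [pi / 4]. *)
Lemma meyer_band_low_half : meyer_low (1 / 2) * meyer_band (1 / 2) != 0.
Proof.
have pp := pi_gt0 R.
have n2 : `|1 / 2 : R| = 1 / 2 by rewrite ger0_norm.
rewrite /meyer_low /meyer_band n2 [X in cos (_ * X) * _](_ : _ = 1 / 2); last first.
  by rewrite -[RHS]beta_half; congr beta; field.
rewrite [X in sin (_ * X)](_ : _ = 1 / 2); last first.
  by rewrite -[RHS]beta_half; congr beta; field.
rewrite [X in _ * (_ * cos (_ * X))]beta0; last lra.
rewrite mulr0 cos0 mulr1 mulf_neq0// gt_eqF//.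
  by apply: cos_gt0_pihalf; lra.
by apply: sin_gt0_pi; lra.
Qed.

Lemma meyer_band_one_neq0 : meyer_band 1 != 0.
Proof.
have pp := pi_gt0 R; rewrite /meyer_band normr1 [X in sin (_ * X)]beta1; last lra.
rewrite mulr1 sin_pihalf mul1r [X in cos (_ * X)](_ : _ = 1 / 2); last first.
  by rewrite -[RHS]beta_half; congr beta; field.
by rewrite gt_eqF//; apply: cos_gt0_pihalf; lra.
Qed.

Definition meyer_level n : R -> R :=
  if n is j.+1 then fun xi => meyer_band (xi / 2 ^+ j) else meyer_low.

Lemma generator_dilation c (A : R -> R) (a : R) : 0 < a -> generator c A ->
  generator (c * a) (fun xi => A (xi / a)).
Proof.
move=> a0 [cA eA bA zA]; split.
- move=> x; apply: (continuous_comp (f := fun xi => xi / a)); last exact: cA.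
  by apply: cvgM; [exact: cvg_id|exact: cvg_cst].
- by move=> x; rewrite mulNr eA.
- by move=> x; exact: bA.
- by move=> x h; apply: zA; rewrite normrM normfV (gtr0_norm a0) ler_pdivlMr.
Qed.

Lemma meyer_level_generator n : generator (4 / 3 * 2 ^+ n.-1) (meyer_level n).
Proof.
case: n => [|j]; first by rewrite mulr1; exact: meyer_low_generator.
by apply: generator_dilation; [exact: exprn_gt0|exact: meyer_band_generator].
Qed.

Lemma meyer_level_sum N xi :
  \sum_(n < N.+1) meyer_level n xi ^+ 2 = meyer_low (xi / 2 ^+ N) ^+ 2.
Proof.
elim: N => [|N ih]; first by rewrite big_ord1 expr0 divr1.
by rewrite big_ord_recr/= ih -meyer_telescope (exprSr (2 : R) N) invfM mulrA.
Qed.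

Lemma meyer_level_le1 N xi : \sum_(n < N) meyer_level n xi ^+ 2 <= 1.
Proof.
case: N => [|N]; first by rewrite big_ord0.
rewrite meyer_level_sum -real_normK ?num_real// expr_le1//.
by have [_ _ + _] := meyer_low_generator; exact.
Qed.

(** The partial sums are eventually equal to 1, as soon as the rescaled [xi] enters the plateau
    [[-1/3, 1/3]] of [meyer_low]. *)
Lemma meyer_level_cvg1 xi : \sum_(n < N) meyer_level n xi ^+ 2 @[N --> \oo] --> (1 : R).
Proof.
apply: cvg_near_cst; exists (Num.truncn (3 * `|xi|)).+2 => // N /=.
case: N => // N; rewrite ltnS => tN; rewrite meyer_level_sum low1 ?expr1n//.
rewrite normrM normfV (@gtr0_norm _ (2 ^+ N)) ?exprn_gt0// ler_pdivrMr ?exprn_gt0//.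
have : 3 * `|xi| <= 2 ^+ N.
  rewrite (le_trans (ltW (truncnS_gt _)))// -natrX ler_nat.
  by rewrite (leq_trans tN)// ltnW// ltn_expl.
by move=> h; lra.
Qed.

Lemma meyer_level_overlap n : exists xi, meyer_level n xi * meyer_level n.+1 xi != 0.
Proof.
case: n => [|j].
  by exists (1 / 2); rewrite /= expr0 divr1; exact: meyer_band_low_half.
have p0 : (2 ^+ j : R) != 0 by rewrite gt_eqF ?exprn_gt0.
exists (2 ^+ j); rewrite /= divff// mulf_neq0 ?meyer_band_one_neq0//.
have -> : 2 ^+ j / 2 ^+ j.+1 = 1 / 2 :> R by rewrite exprSr invfM mulrA divff.
by have := meyer_band_low_half; rewrite mulf_eq0 negb_or => /andP[].
Qed.

Lemma psi_hatE xi : psi_hat beta xi = (meyer_band xi)%:C%C * expi (pi * xi).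
Proof.
rewrite /psi_hat /meyer_band; case: ifP => [/andP[h1 h2]|h].
  by rewrite [beta (3 * `|xi| / 2 - 1)]beta0 ?mulr0 ?cos0 ?mulr1//; lra.
case: ifP => [/andP[h1 h2]|h'].
  by rewrite [beta (3 * `|xi| - 1)]beta1 ?mulr1 ?sin_pihalf ?mul1r//; lra.
have [h1|h1] := ltP `|xi| (1 / 3).
  by rewrite [beta (3 * `|xi| - 1)]beta0 ?mulr0 ?sin0 ?mul0r//; lra.
rewrite [beta (3 * `|xi| / 2 - 1)]beta1 ?mulr1 ?cos_pihalf ?mulr0 ?mul0r//.
by move: h h' h1; case: leP; case: leP; case: leP; case: leP => //=; lra.
Qed.

Lemma phi_hatE xi : phi_hat beta xi = (meyer_low xi)%:C%C.
Proof.
by rewrite /phi_hat; case: leP => // h; rewrite low0// ltW.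
Qed.

End profile.

End meyer.

(** * The Meyer system in terms of levels *)

Section meyer_system.
Context {R : realType}.
Local Notation mu := (@lebesgue_measure R).
Local Notation Int := (Rintegral mu setT).
Local Notation H := hartley.
Implicit Types (f g : R -> R) (t x xi s : R).

(** The Fourier kernel has imaginary part minus the sine, hence the difference. *)
Lemma hartley_fourier f xi : intg f ->
  H f xi = complex.Re (fourier f xi) - complex.Im (fourier f xi).
Proof.
move=> fi; rewrite /fourier /cintegral/=.
have ci : intg (fun x => f x * cos (2 * pi * (x * xi))).
  apply: (intgMb fi (M := 1)) => [|x]; last by rewrite cos_max.
  apply: (measurableT_comp (continuous_msr (@continuous_cos R))).
  by apply: measurable_funM => //; exact: measurable_funM.
have si : intg (fun x => f x * sin (2 * pi * (x * xi))).
  apply: (intgMb fi (M := 1)) => [|x]; last by rewrite sin_max.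
  apply: (measurableT_comp (continuous_msr (@continuous_sin R))).
  by apply: measurable_funM => //; exact: measurable_funM.
transitivity (Int (fun x => f x * cos (2 * pi * (x * xi))) +
    Int (fun x => f x * sin (2 * pi * (x * xi)))).
  by rewrite -IntD//; apply: eq_Rintegral => x _; rewrite mulrDr.
congr (_ + _).
  by apply: eq_Rintegral => x _; rewrite mul0r subr0 cosN mulrA.
rewrite -mulN1r -IntZ; last first.
  rewrite (_ : (fun x => _) = fun x => - (f x * sin (2 * pi * (x * xi)))); first exact: intgN.
  by apply/funext => x; rewrite mul0r addr0 sinN mulrN mulrA.
by apply: eq_Rintegral => x _; rewrite mul0r addr0 sinN mulN1r mulrN opprK mulrA.
Qed.

Lemma hartley_dilation (a : R) w xi : 0 < a -> intg w ->
  H (fun x => w (x / a)) xi = a * H w (a * xi).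
Proof.
move=> a0 wi; have ia0 : 0 < a^-1 by rewrite invr_gt0.
have ki : intg (fun x => w x * cas (a * x) xi).
  apply: (intgMb wi) => [|x]; last exact: cas_max.
  by apply: (measurableT_comp (msr_casr xi)); exact: measurable_funM.
have [_ e] := Int_affine 0 ia0 ki; rewrite invrK in e.
rewrite [LHS](_ : _ = Int (fun x => w (a^-1 * x + 0) * cas (a * (a^-1 * x + 0)) xi)); last first.
  apply: eq_Rintegral => x _; rewrite addr0 mulrA divff ?gt_eqF// mul1r.
  by rewrite [a^-1 * x]mulrC.
rewrite e; congr (_ * _); apply: eq_Rintegral => x _; congr (_ * _).
by rewrite /cas; congr (cos _ + sin _); ring.
Qed.

Lemma ae_affine f g (a b : R) : 0 < a -> intg f -> intg g ->
  {ae mu, forall x, f x = g x} -> {ae mu, forall x, f (a * x + b) = g (a * x + b)}.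
Proof.
move=> a0 fi gi fg; have di := intgB fi gi.
have [ai ae0] := Int_affine b a0 di.
have d0 : Int (fun x => `|f x - g x|) = 0.
  have [||_ <-] := Int_ae (@intg0 R) (g := fun x => `|f x - g x|); last exact: Int0.
    by apply: intg_msr; exact: intg_abs.
  by apply: ae_impl fg => x ->; rewrite subrr normr0.
have [_ e] := Int_affine b a0 (intg_abs di).
have : {ae mu, forall x, f (a * x + b) - g (a * x + b) = 0}.
  by apply: (Int_ae0 ai); rewrite e d0 mulr0.
by apply: ae_impl => x /eqP; rewrite subr_eq0 => /eqP.
Qed.

Variables (beta psi phi : R -> R) (alpha : R).
Hypotheses (profile : meyer_profile beta) (hpsi : is_meyer_wavelet beta psi)
  (hphi : is_meyer_scaling beta phi) (alpha0 : 0 < alpha) (alpha_le : alpha <= 3 / 16).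

Let psii : intg psi. Proof. by have [] := hpsi. Qed.
Let phii : intg phi. Proof. by have [] := hphi. Qed.

Let band_bcs : bcs (meyer_band beta).
Proof. exact: generator_bcs (meyer_band_generator profile). Qed.

Let low_bcs : bcs (meyer_low beta).
Proof. exact: generator_bcs (meyer_low_generator profile). Qed.

(** Real minus imaginary part of the phase [expi (pi * xi)] is [cas (- (1 / 2)) xi], which inversion
    turns into a shift by 1/2. *)
Lemma psi_ae : {ae mu, forall x, psi x = H (meyer_band beta) (x + 1 / 2)}.
Proof.
have bi := bcs_intg band_bcs; have [_ be _ _] := meyer_band_generator profile.
have Hpsi xi : H psi xi = meyer_band beta xi * cas (- (1 / 2)) xi.
  have [_ e] := hpsi; rewrite hartley_fourier// e psi_hatE//= !mul0r subr0 addr0 -mulrBr.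
  have ee : 2 * pi * (- (1 / 2) * xi) = - (pi * xi) :> R.
    by move: (pi : R) => p; field.
  by rewrite /cas ee cosN sinN.
have := hartley_inversion psii (intg_casr (- (1 / 2)) bi) Hpsi; apply: ae_impl => x ->.
rewrite [LHS](hartley_shift_cas _ _ bi be) -(hartley_even _ bi be); congr (H _ _).
by rewrite opprB opprK.
Qed.

Lemma phi_ae : {ae mu, forall x, phi x = H (meyer_low beta) x}.
Proof.
apply: hartley_inversion; [exact: phii|exact: bcs_intg|] => xi.
by have [_ e] := hphi; rewrite hartley_fourier// e phi_hatE//= subr0.
Qed.

(** Integrability is inherited from [psi], a translate of this function up to a null set. *)
Lemma hartley_band_intg : intg (H (meyer_band beta)).
Proof.
have bi := bcs_intg band_bcs.
have mH : msr (fun x => H (meyer_band beta) (x + 1 / 2)).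
  by apply: (measurableT_comp (msr_hartley bi)); exact: measurable_funD.
have [i _] := Int_ae psii mH psi_ae.
have [] := Int_shift (- (1 / 2)) i.
by under eq_fun do rewrite subrK.
Qed.

Lemma hartley_low_intg : intg (H (meyer_low beta)).
Proof. by have [] := Int_ae phii (msr_hartley (bcs_intg low_bcs)) phi_ae. Qed.

(* Level 0 is the scaling function and level [j.+1] the wavelet at scale [2 ^ j];
   the offset is the phase [expi (pi * xi)] of [psi_hat]. *)
Definition level_step n : R := alpha / 2 ^+ n.-1.
Definition level_offset n : R := if n is j.+1 then - (2 * 2 ^+ j)^-1 else 0.
(** The denominator cancels the factor that dilation gives the transform in [hartley_level]. *)
Definition level_weight n : R := 2 `^ (n.-1%:R / 2) / 2 ^+ n.-1.
Definition level_index (m : (nat * int) + int) : nat * int :=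
  match m with inl (j, k) => (j.+1, k) | inr k => (0, k) end.

Let p2 j : 0 < 2 ^+ j :> R. Proof. exact: exprn_gt0. Qed.

Lemma hartley_level j x :
  H (meyer_level beta j.+1) x = 2 ^+ j * H (meyer_band beta) (2 ^+ j * x).
Proof. by rewrite /meyer_level (hartley_dilation _ (p2 j) (bcs_intg band_bcs)). Qed.

Lemma meyer_levels : levels alpha (meyer_level beta) (fun n => 4 / 3 * 2 ^+ n.-1)
  level_step level_offset level_weight.
Proof.
split.
- by move=> n; rewrite mulr_gt0.
- by move=> n; rewrite divr_gt0.
- move=> n; rewrite /level_step; move: (p2 n.-1); move: (2 ^+ n.-1) => p p0.
  (* The scale cancels, so the sampling condition is the same at all levels: [alpha <= 3 / 16]. *)
  have -> : 4 * (4 / 3 * p) * (alpha / p) = 16 / 3 * alpha.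
    by field; rewrite gt_eqF.
  rewrite mulrAC ler_pdivrMr// mul1r [16 * _]mulrC -ler_pdivlMr//.
- move=> n; rewrite /level_weight /level_step; set j := n.-1.
  rewrite exprMn -powR_mulrn ?powR_ge0// -powRrM divfK// powR_mulrn//.
  by move: (p2 j); move: (2 ^+ j) => p p0; field; rewrite !gt_eqF.
- by move=> n; exact: meyer_level_generator.
- exact: meyer_level_le1.
- exact: meyer_level_cvg1.
- case=> [|j]; first exact: hartley_low_intg.
  rewrite (funext (hartley_level j)).
  apply: intgZ; have [] := Int_affine 0 (p2 j) hartley_band_intg.
  by under eq_fun do rewrite addr0.
- exact: meyer_level_overlap.
Qed.

Lemma meyer_system_ae m : let: (n, k) := level_index m in
  {ae mu, forall x, meyer_system psi phi alpha m x =
    level_weight n * H (meyer_level beta n) (x - (level_step n * k%:~R + level_offset n))}.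
Proof.
case: m => [[j k]|k] /=.
  have hi : intg (fun x => H (meyer_band beta) (x + 1 / 2)).
    exact: (Int_shift _ hartley_band_intg).1.
  have := ae_affine (- (alpha * k%:~R)) (p2 j) psii hi psi_ae; apply: ae_impl => x ->.
  rewrite hartley_level /level_weight /level_step/= mulrA divfK ?gt_eqF//.
  congr (_ * H _ _); move: (p2 j) (k%:~R : R); move: (2 ^+ j) => p p0 q.
  by field; rewrite gt_eqF.
have := ae_affine (- (alpha * k%:~R)) ltr01 phii hartley_low_intg phi_ae.
apply: ae_impl => x; rewrite mul1r => ->.
by rewrite /level_weight /level_step/= mul0r powRr0 expr0 !divr1 mul1r addr0.
Qed.

Lemma meyer_system_msr m : msr (meyer_system psi phi alpha m).
Proof.
case: m => [[j k]|k] /=; last first.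
  by apply: (measurableT_comp (intg_msr phii)); exact: measurable_funB.
apply: measurable_funM => //; apply: (measurableT_comp (intg_msr psii)).
by apply: measurable_funB => //; exact: measurable_funM.
Qed.

Lemma meyer_system_l2 m : l2 (meyer_system psi phi alpha m).
Proof.
split; first exact: meyer_system_msr.
have := meyer_system_ae m; case: (level_index m) => n k e.
have lG := hartley_generator_l2 (meyer_level_generator profile n)
  (level_step n * k%:~R + level_offset n).
have [] // := Int_ae (l2Z (level_weight n) lG).2 (g := fun x => meyer_system psi phi alpha m x ^+ 2).
  by apply: measurable_funX; exact: meyer_system_msr.
by apply: ae_impl e => x ->.
Qed.

Lemma meyer_system_coef m f : l2 f -> Int (fun x => f x * meyer_system psi phi alpha m x) =
  coef (meyer_level beta) level_step level_offset level_weight f (level_index m).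
Proof.
move=> lf; have := meyer_system_ae m; case: (level_index m) => n k e.
have lG := hartley_generator_l2 (meyer_level_generator profile n)
  (level_step n * k%:~R + level_offset n).
have i : intg (fun x => f x * meyer_system psi phi alpha m x).
  by apply: l2_mul => //; exact: meyer_system_l2.
rewrite /coef/= /voice -IntZ; last exact: l2_mul.
have [||_] := Int_ae i (g := fun x => level_weight n *
    (f x * H (meyer_level beta n) (x - (level_step n * k%:~R + level_offset n)))); last by [].
  by apply: intg_msr; apply: intgZ; exact: l2_mul.
by apply: ae_impl e => x ->; rewrite mulrCA.
Qed.

End meyer_system.

(** * Passage to complex inner products, unordered sums and the stated properties *)

Section interface.
Context {R : realType}.
Local Notation mu := (@lebesgue_measure R).
Local Notation Int := (Rintegral mu setT).

Lemma Lfun2_l2 (f : R -> R) : f \in Lfun mu 2%:E <-> l2 f.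
Proof.
split=> [lf|[mf f2]].
  split; last exact: Lfun2_integrable_sqr.
  by move: lf; rewrite inE => /andP[]; rewrite inE.
rewrite inE; apply/andP; split; rewrite inE//= /finite_norm unlock poweR_lty//.
have /integrableP[_] := f2; apply: le_lt_trans; rewrite le_eqVlt; apply/orP; left; apply/eqP.
by apply: eq_integral => x _; rewrite /= powR_mulrn// normrX.
Qed.

Lemma modulus_sqr (z : R[i]) : modulus z ^+ 2 = complex.Re z ^+ 2 + complex.Im z ^+ 2.
Proof. by case: z => a b; rewrite /modulus/= sqr_sqrtr// addr_ge0 ?sqr_ge0. Qed.

Lemma inner_toC (f : R -> R[i]) (g : R -> R) : inner f (toC g) =
  (Int (fun x => complex.Re (f x) * g x) +i* Int (fun x => complex.Im (f x) * g x))%C.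
Proof.
rewrite /inner /cintegral /toC; congr (_ +i* _)%C; apply: eq_Rintegral => x _;
  case: (f x) => a b /=.
  by rewrite oppr0 mulr0 subr0.
by rewrite oppr0 mulr0 add0r.
Qed.

Lemma normL2_sqE (f : R -> R[i]) : L2 f -> normL2_sq f =
  (Int (fun x => complex.Re (f x) ^+ 2) + Int (fun x => complex.Im (f x) ^+ 2))%:E.
Proof.
move=> [/Lfun2_l2 lr /Lfun2_l2 li]; rewrite -IntD; [|exact: lr.2|exact: li.2].
rewrite EFin_Int; last by apply: intgD; [exact: lr.2|exact: li.2].
by rewrite /normL2_sq; apply: eq_integral => x _; rewrite modulus_sqr.
Qed.

Lemma esum_le (T : choiceType) (a : T -> R) (r : R) :
  (\esum_(i in [set: T]) (a i)%:E <= r%:E)%E <->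
  forall s : seq T, uniq s -> \sum_(i <- s) a i <= r.
Proof.
split=> [ar s us|ar].
  rewrite -lee_fin; apply: le_trans ar; apply: esum_ge.
  exists [set` s]; first by split=> //; exact: finite_seq.
  by rewrite -fsbig_seq// sumEFin.
apply: ge_ereal_sup => _ [X [finX _] <-].
by rewrite fsbig_finite//= sumEFin lee_fin; apply: ar; exact: finmap.fset_uniq.
Qed.

Variables (I : countType) (omega : I -> R -> R) (index : I -> nat * int).
Variables (alpha : R) (B : nat -> R -> R) (c al b w : nat -> R).
Hypotheses (index_bij : bijective index) (alpha0 : 0 < alpha)
  (lv : levels alpha B c al b w) (omega_l2 : forall m, l2 (omega m))
  (omega_coef : forall m f, l2 f -> Int (fun x => f x * omega m x) = coef B al b w f (index m)).

Let cf := coef B al b w.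

Lemma levels_frame : is_frame (fun m => toC (omega m)).
Proof.
split=> [m|].
  split; apply/Lfun2_l2 => //=.
  by split; [exact: measurable_cst|rewrite expr0n; exact: intg0].
have ia : 0 < alpha^-1 by rewrite invr_gt0.
(* In the lower bound one factor 2 is that of [energy_le]; the other arises because the real and
   imaginary parts are each bounded by the whole coefficient sum. *)
exists (alpha^-1 / 4), alpha^-1; split; [by rewrite divr_gt0|by rewrite ler_pdivrMr//; lra|].
move=> f L2f; have [/Lfun2_l2 lr /Lfun2_l2 li] := L2f.
rewrite normL2_sqE// -!EFinM.
pose re x := complex.Re (f x); pose im x := complex.Im (f x).
rewrite -/re -/im.
have E m : modulus (inner f (toC (omega m))) ^+ 2 = cf re (index m) ^+ 2 + cf im (index m) ^+ 2.
  by rewrite modulus_sqr inner_toC/= !omega_coef.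
under eq_esum do rewrite E.
have [index' indexK index'K] := index_bij.
split; last first.
  apply: (esum_le (fun m => cf re (index m) ^+ 2 + cf im (index m) ^+ 2) _).2 => s us.
  have ui : uniq (map index s) by rewrite map_inj_uniq//; exact: can_inj indexK.
  have h1 := coef_sums_le alpha0 lv lr ui; have h2 := coef_sums_le alpha0 lv li ui.
  rewrite !big_map in h1 h2.
  by rewrite big_split/= mulrC mulrDl lerD.
set S := (\esum_(i in _) _)%E.
have S0 : (0 <= S)%E.
  by apply: esum_ge0 => m _; rewrite lee_fin addr_ge0 ?sqr_ge0.
(* If the coefficient sum is infinite the lower bound is trivial; otherwise its value [r] bounds all
   finite sums. *)
move: (erefl S); rewrite {2}/S; move: S0; case: S => [r _ Sr|_ _|//]; last first.
  by rewrite leey.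
have sums (s : seq I) : uniq s ->
    \sum_(m <- s) (cf re (index m) ^+ 2 + cf im (index m) ^+ 2) <= r.
  by apply: (esum_le (fun m => cf re (index m) ^+ 2 + cf im (index m) ^+ 2) r).1; rewrite -Sr.
have part g : (forall m, cf g (index m) ^+ 2 <= cf re (index m) ^+ 2 + cf im (index m) ^+ 2) ->
    l2 g -> Int (fun x => g x ^+ 2) / alpha <= 2 * r.
  move=> gle lg; apply: (energy_le alpha0 lv lg) => s us.
  have ui : uniq (map index' s) by rewrite map_inj_uniq//; exact: can_inj index'K.
  apply: le_trans (sums _ ui); rewrite big_map; apply: ler_sum => p _.
  by have := gle (index' p); rewrite index'K.
have h1 : Int (fun x => re x ^+ 2) / alpha <= 2 * r.
  by apply: part => // m; rewrite lerDl sqr_ge0.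
have h2 : Int (fun x => im x ^+ 2) / alpha <= 2 * r.
  by apply: part => // m; rewrite lerDr sqr_ge0.
rewrite lee_fin mulrAC ler_pdivrMr// mulrC mulrDl.
by lra.
Qed.

Lemma levels_sign_retrieval : sign_retrieval omega.
Proof.
split; first exact: levels_frame.
move=> f h [/Lfun2_l2 lf _] [a a0 fa] [/Lfun2_l2 lh _] fh.
apply: (levels_sign_uniqueness alpha0 lv a0 lf lh (exp_decaying_intg a0 lf.1 fa)) => p.
have [index' _ index'K] := index_bij.
have E g : l2 g -> cf g p ^+ 2 = modulus (inner (toC g) (toC (omega (index' p)))) ^+ 2.
  move=> lg; rewrite modulus_sqr inner_toC/= omega_coef// index'K.
  rewrite [X in _ + X ^+ 2](_ : _ = 0) ?expr0n ?addr0//.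
  by rewrite -[RHS]Int0; apply: eq_Rintegral => x _; rewrite mul0r.
by rewrite -/(cf h p) -/(cf f p) !E// /modulus fh.
Qed.

End interface.

Lemma level_index_bij : bijective level_index.
Proof.
exists (fun p : nat * int => match p.1 with j.+1 => inl (j, p.2) | _ => inr p.2 end).
  by case=> [[]|].
by case=> [[|j] k].
Qed.

Theorem theorem3 (R : realType) (beta psi phi : R -> R) (alpha : R)
    (hbeta : meyer_profile beta)
    (hpsi : is_meyer_wavelet beta psi)
    (hphi : is_meyer_scaling beta phi)
    (alpha_gt0 : 0 < alpha) (alpha_le : alpha <= 3 / 16) :
  sign_retrieval (meyer_system psi phi alpha).
Proof.
apply: (levels_sign_retrieval level_index_bij alpha_gt0
  (meyer_levels hbeta hpsi hphi alpha_gt0 alpha_le)) => [m|m f].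
  exact: (meyer_system_l2 alpha hbeta hpsi hphi).
exact: (meyer_system_coef alpha hbeta hpsi hphi).
Qed.
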